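(* Let $\mu$ be a finite positive Borel measure on $\mathbb{D}$, let $\Psi_1,\Psi_2$ be Orlicz functions, and let $I_\mu\colon\mathfrak{B}^{\Psi_1}\to L^{\Psi_2}(\mu)$ be the canonical map $I_\mu(f)=f$. (1) If $I_\mu$ is compact, then $$\lim_{h\to0}\frac{\Psi_1^{-1}(1/h^2)}{\Psi_2^{-1}\big(1/\rho_\mu(h)\big)}=0.$$ (2) For $I_\mu$ to be compact, it suffices that $$\lim_{h\to0}\frac{\Psi_1^{-1}(1/h^2)}{\Psi_2^{-1}\big(1/(h^2K_{\mu,2}(h))\big)}=0.$$
   Context: $\mathbb{D}$ is the open unit disk, $\mathbb{T}$ the unit circle, $\mathcal{A}$ the normalized area measure $dx\,dy/\pi$. An Orlicz function is a nonnegative increasing convex $\Psi\colon[0,\infty)\to[0,\infty)$ with $\Psi(0)=0$, $\Psi(x)>0$ for $x>0$, $\Psi(\infty)=\infty$; $\Psi^{-1}$ is its inverse, with $\Psi^{-1}(\infty)=\infty$. $L^{\Psi}(\mu)$ is the Orlicz space with Luxemburg norm $\|f\|=\inf\{C>0:\int\Psi(|f|/C)\,d\mu\le1\}$; $\mathfrak{B}^{\Psi}$ is the subspace of $L^{\Psi}(\mathbb{D},\mathcal{A})$ of analytic functions. For $\xi\in\mathbb{T}$, $0<h\le1$: $W(\xi,h)=\{z\in\mathbb{D}:|z|\ge1-h,\ |\arg(z\bar\xi)|\le\pi h\}$; $\rho_\mu(h)=\sup_{\xi\in\mathbb{T}}\mu(W(\xi,h))$; $K_{\mu,2}(h)=\sup_{0<t<h}\rho_\mu(t)/t^2$.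 Compact means mapping bounded sets to relatively compact sets (in (2) this includes that every $f\in\mathfrak{B}^{\Psi_1}$ lies in $L^{\Psi_2}(\mu)$). *)

(* Defs.v *)
From HB Require Import structures.
From mathcomp Require Import all_boot all_order all_algebra.
From mathcomp Require Import all_classical all_reals all_analysis.
From mathcomp.real_closed Require Import complex.
Set Implicit Arguments. Unset Strict Implicit. Unset Printing Implicit Defensive.
Import Order.TTheory GRing.Theory Num.Theory.
Local Open Scope classical_set_scope.
Local Open Scope ring_scope.

Section Defs.
Variable R : realType.

Definition cabs (z : R[i]) : R := Num.sqrt (complex.Re z ^+ 2 + complex.Im z ^+ 2).

Definition toC (p : R * R) : R[i] := (p.1 +i* p.2)%C.

Definition diskC : set R[i] := [set z | cabs z < 1].
Definition disk : set (R * R) := [set p | cabs (toC p) < 1].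

Definition circle : set R[i] := [set z | cabs z = 1].

Definition cdifferentiable (f : R[i] -> R[i]) (z : R[i]) : Prop :=
  exists l : R[i], forall e : R, 0 < e -> exists d : R, 0 < d /\
    forall w : R[i], cabs (w - z) < d ->
      cabs (f w - f z - l * (w - z)) <= e * cabs (w - z).

Definition analytic_on_disk (f : R[i] -> R[i]) : Prop :=
  forall z, diskC z -> cdifferentiable f z.

Definition orlicz (Psi : R -> R) : Prop :=
  [/\ Psi 0 = 0,
      (forall x, 0 < x -> 0 < Psi x),
      (forall x y, 0 <= x -> x <= y -> Psi x <= Psi y),
      (forall x y t, 0 <= x -> 0 <= y -> 0 <= t <= 1 ->
          Psi (t * x + (1 - t) * y) <= t * Psi x + (1 - t) * Psi y) &
      Psi x @[x --> +oo] --> +oo].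

Definition Psi_inv (Psi : R -> R) (y : R) : R :=
  sup [set x | 0 <= x /\ Psi x <= y].

Definition Psi_inv_e (Psi : R -> R) (y : \bar R) : \bar R :=
  match y with
  | r%:E => (Psi_inv Psi r)%:E
  | +oo%E => +oo%E
  | -oo%E => 0%E
  end.

(* normalized area measure dA = dx dy / pi is handled through the weight
   pi^-1 in front of the (two-dimensional Lebesgue) integral *)
Definition leb2 := (@lebesgue_measure R \x @lebesgue_measure R)%E.

Definition modular (m : set (R * R) -> \bar R) (c : R) (Psi : R -> R)
    (f : R[i] -> R[i]) (C : R) : \bar R :=
  (c%:E * \int[m]_(p in disk) (Psi (cabs (f (toC p)) / C))%:E)%E.

Definition inL (m : set (R * R) -> \bar R) (c : R) (Psi : R -> R)
    (f : R[i] -> R[i]) : Prop :=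
  exists C : R, 0 < C /\ (modular m c Psi f C <= 1)%E.

Definition lux (m : set (R * R) -> \bar R) (c : R) (Psi : R -> R)
    (f : R[i] -> R[i]) : R :=
  inf [set C : R | 0 < C /\ (modular m c Psi f C <= 1)%E].

Definition inB (Psi : R -> R) (f : R[i] -> R[i]) : Prop :=
  analytic_on_disk f /\ inL leb2 pi^-1 Psi f.

Definition normB (Psi : R -> R) (f : R[i] -> R[i]) : R := lux leb2 pi^-1 Psi f.

(* compactness of the canonical inclusion I_mu : B^Psi1 -> L^Psi2(mu):
   it is well defined (B^Psi1 is contained in L^Psi2(mu)) and maps bounded
   sets to relatively compact sets, i.e. every bounded sequence has a
   subsequence converging in L^Psi2(mu) *)
Definition compact_inclusion (mu : set (R * R) -> \bar R) (Psi1 Psi2 : R -> R)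
    : Prop :=
  (forall f, inB Psi1 f -> inL mu 1 Psi2 f) /\
  (forall (u : nat -> R[i] -> R[i]) (M : R),
      (forall n, inB Psi1 (u n)) -> (forall n, normB Psi1 (u n) <= M) ->
      exists (phi : nat -> nat) (g : R[i] -> R[i]),
        [/\ {homo phi : m n / (m < n)%N >-> (m < n)%N},
            measurable_fun disk (fun p => complex.Re (g (toC p))),
            measurable_fun disk (fun p => complex.Im (g (toC p))),
            inL mu 1 Psi2 g &
            lux mu 1 Psi2 (fun z => u (phi n) z - g z) @[n --> \oo] --> 0]).

(* Carleson windows W(xi,h) = {z in D : |z| >= 1-h, |arg(z conj xi)| <= pi h} *)
Definition window (xi : R[i]) (h : R) : set (R * R) :=
  [set p | disk p /\ 1 - h <= cabs (toC p) /\
     exists theta : R, `|theta| <= pi * h /\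
       (toC p * (conjc xi) = (cabs (toC p))%:C * (cos theta +i* sin theta))%C].

Definition rho (mu : set (R * R) -> \bar R) (h : R) : \bar R :=
  ereal_sup [set mu (window xi h) | xi in circle].

Definition K2 (mu : set (R * R) -> \bar R) (h : R) : \bar R :=
  ereal_sup [set (rho mu t * (t ^- 2)%:E)%E | t in `]0, h[].

End Defs.

Arguments disk {R}.
Arguments diskC {R}.
Arguments circle {R}.
Arguments leb2 {R}.

(* Main.v *)
Require Import Defs.
From HB Require Import structures.
From mathcomp Require Import all_boot all_order all_algebra.
From mathcomp Require Import all_classical all_reals all_analysis.
From mathcomp.real_closed Require Import complex.
From mathcomp Require Import measurable_realfun lebesgue_integrable lebesgue_Rintegral.
From mathcomp Require Import ring lra.
Import Order.TTheory GRing.Theory Num.Theory.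
Import numFieldNormedType.Exports.
Local Open Scope classical_set_scope.
Local Open Scope ring_scope.

(** Necessity. For [a = (1 - h) xi] and [Psi1 P <= 1/h^2], the functions
    [P h^4 / (1 - conj a z)^4] have bounded norm in [B^Psi1], since by convexity
    their modular is at most [h^-2] times a multiple of the area integral of
    [h^4 / |1 - conj a z|^4]. They tend to [0] pointwise as [h -> 0], so by Fatou
    compactness forces their norm in [L^Psi2(mu)] to tend to [0]; but they are
    at least a constant multiple of [P] on [W(xi, h)].

    Sufficiency. Cauchy's formula on squares and Jensen's inequality bound
    [Psi1 (|f(z)| / C)] by the area mean of [Psi1 (c |f| / C)] over the square
    of size comparable to [t = 1 - |z|] about [z]; in particular
    [t^2 Psi1 (|f(z)| / C)] is small near the circle. The hypothesis, used at the
    height [h] with [Psi1 s = 1/h^2], says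
    [Psi2 (s/delta) mu (W(xi, T)) <= T^2 Psi1 s] for large [s] with
    [T^2 Psi1 s < 1]. Integrating over [mu] and exchanging the order of
    integration, the part of the modular of [f / delta] near the circle is at
    most [3/4] uniformly on bounded sets. On compact subsets of the disk Montel's
    theorem gives uniformly convergent subsequences, and Fatou turns the
    resulting Cauchy property into convergence in norm. *)

Set Implicit Arguments.
Unset Strict Implicit.
Unset Printing Implicit Defensive.

(** Squares take the place of discs because plane area is a product measure: as the half side of a
    square contour varies, each side sweeps a region to which Tonelli's theorem applies, and a
    contour bound becomes an area bound.

    The obstacle in the sufficiency is that the window bound controls [mu] only on whole windows and
    at one level [s] at a time, whereas [f] varies inside a window. The remedy is to integrate over
    pairs [(p, q)] with [q] in the square about [p]. A weight in [p] is chosen so that the area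
    integral in [q] restores [Psi2]; for fixed [q], all contributing [p] lie in one window that
    depends on [q] alone, and the mass of this window cancels against the weight. The restriction
    [T^2 Psi1 s < 1] is met because the modular of [f] is at most 1 and convexity gains a large
    factor [M].

    No doubling condition is available for [Psi1] or [Psi2], so constants cannot be taken out of
    them freely: they stay inside the argument and are absorbed into the scale of the Luxemburg
    norm. *)

(** * Modulus, continuity and differentiability of complex functions *)

Section ComplexModulus.
Variable R : realType.
Implicit Types z w : R[i].

Lemma cabsE z : cabs z = ComplexField.Normc.normc z.
Proof. by case: z. Qed.

Lemma cabs_ge0 z : 0 <= cabs z. Proof. exact: sqrtr_ge0. Qed.

Lemma cabsM z w : cabs (z * w) = cabs z * cabs w.
Proof. by rewrite !cabsE ComplexField.Normc.normcM. Qed.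

Lemma cabsV z : cabs z^-1 = (cabs z)^-1.
Proof. by rewrite !cabsE ComplexField.Normc.normcV. Qed.

Lemma cabsN z : cabs (- z) = cabs z.
Proof. by rewrite /cabs !raddfN /= !sqrrN. Qed.

Lemma cabsD z w : cabs (z + w) <= cabs z + cabs w.
Proof. by rewrite !cabsE le_normcD. Qed.

Lemma cabsB z w : cabs (z - w) <= cabs z + cabs w.
Proof. by rewrite -(cabsN w) cabsD. Qed.

Lemma cabs_sym z w : cabs (z - w) = cabs (w - z).
Proof. by rewrite -cabsN opprB. Qed.

Lemma cabs_trian u z w : cabs (z - w) <= cabs (z - u) + cabs (u - w).
Proof. by rewrite -[z - w](subrKA u) cabsD. Qed.

Lemma cabs_dist z w : `|cabs z - cabs w| <= cabs (z - w).
Proof.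
rewrite ler_norml; apply/andP; split.
  by have := cabs_trian z w 0; rewrite !subr0 cabs_sym; lra.
by have := cabs_trian w z 0; rewrite !subr0; lra.
Qed.

Lemma cabs0 : cabs (0 : R[i]) = 0.
Proof. by rewrite /cabs /= expr0n /= addr0 sqrtr0. Qed.

Lemma cabs1 : cabs (1 : R[i]) = 1.
Proof. by rewrite /cabs /= expr0n /= expr1n addr0 sqrtr1. Qed.

Lemma cabs_eq0 z : cabs z = 0 -> z = 0.
Proof. by rewrite cabsE => /ComplexField.Normc.eq0_normc. Qed.

Lemma cabs_gt0 z : z != 0 -> 0 < cabs z.
Proof.
by move=> z0; rewrite lt_neqAle cabs_ge0 andbT eq_sym; apply: contra z0 => /eqP/cabs_eq0 ->.
Qed.

Lemma cabsX z n : cabs (z ^+ n) = cabs z ^+ n.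
Proof. by elim: n => [|n IH]; rewrite ?expr0 ?cabs1// !exprS cabsM IH. Qed.

Lemma sqr_cabs z : cabs z ^+ 2 = complex.Re z ^+ 2 + complex.Im z ^+ 2.
Proof. by rewrite sqr_sqrtr // addr_ge0 // sqr_ge0. Qed.

Lemma Re_le_cabs z : `|complex.Re z| <= cabs z.
Proof. by rewrite -sqrtr_sqr ler_wsqrtr // lerDl sqr_ge0. Qed.

Lemma Im_le_cabs z : `|complex.Im z| <= cabs z.
Proof. by rewrite -sqrtr_sqr ler_wsqrtr // lerDr sqr_ge0. Qed.

Lemma cabs_le_sum z : cabs z <= `|complex.Re z| + `|complex.Im z|.
Proof.
rewrite -(@ler_pXn2r _ 2) ?nnegrE ?cabs_ge0 ?addr_ge0 // sqr_cabs sqrrD.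
rewrite !real_normK ?num_real // -addrA lerD2l lerDr.
by rewrite mulrn_wge0 // mulr_ge0.
Qed.

Lemma cabsR (x : R) : cabs (x%:C)%C = `|x|.
Proof. by rewrite /cabs /= expr0n /= addr0 sqrtr_sqr. Qed.

Lemma cabs_conj z : cabs (conjc z) = cabs z.
Proof. by case: z => a b; rewrite /cabs /= sqrrN. Qed.

Lemma mul_conj z : z * conjc z = (cabs z ^+ 2)%:C%C.
Proof.
case: z => a b; rewrite sqr_cabs /=; apply/eqP; rewrite eq_complex /=.
by apply/andP; split; apply/eqP; ring.
Qed.

Definition ccont (f : R[i] -> R[i]) z := forall e : R, 0 < e ->
  exists d : R, 0 < d /\ forall w, cabs (w - z) < d -> cabs (f w - f z) <= e.

Lemma ccont_cst c z : ccont (fun=> c) z.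
Proof. by move=> e e0; exists 1; split=> // w _; rewrite subrr cabs0 ltW. Qed.

Lemma ccont_id z : ccont id z.
Proof. by move=> e e0; exists e; split=> // w /ltW. Qed.

Lemma ccontD f g z : ccont f z -> ccont g z -> ccont (fun w => f w + g w) z.
Proof.
move=> cf cg e e0; have e2 : 0 < e / 2 by lra.
have [d1 [d10 H1]] := cf _ e2; have [d2 [d20 H2]] := cg _ e2.
exists (Num.min d1 d2); rewrite lt_min d10 d20; split=> // w.
rewrite lt_min => /andP[/H1 h1 /H2 h2].
rewrite opprD addrACA; apply: le_trans (cabsD _ _) _; lra.
Qed.

Lemma ccontM f g z : ccont f z -> ccont g z -> ccont (fun w => f w * g w) z.
Proof.
move=> cf cg e e0.
set a := cabs (f z); set b := cabs (g z).
have a0 : 0 <= a := cabs_ge0 _; have b0 : 0 <= b := cabs_ge0 _.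
pose e1 := Num.min 1 (e / (a + b + 1)).
have e10 : 0 < e1 by rewrite lt_min ltr01 /=; apply: divr_gt0 => //; lra.
have [d1 [d10 H1]] := cf _ e10; have [d2 [d20 H2]] := cg _ e10.
exists (Num.min d1 d2); rewrite lt_min d10 d20; split=> // w.
rewrite lt_min => /andP[/H1 h1 /H2 h2].
have -> : f w * g w - f z * g z =
  (f w - f z) * (g w - g z) + (f w - f z) * g z + f z * (g w - g z) by ring.
apply: le_trans (cabsD _ _) _; apply: le_trans (lerD (cabsD _ _) (lexx _)) _.
rewrite !cabsM -/a -/b.
have e1e : e1 * (a + b + 1) <= e.
  by rewrite -ler_pdivlMr ?ge_min ?lexx ?orbT //; lra.
have e11 : e1 <= 1 by rewrite ge_min lexx.
set x := cabs (f w - f z) in h1 *; set y := cabs (g w - g z) in h2 *.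
have x0 : 0 <= x := cabs_ge0 _; have y0 : 0 <= y := cabs_ge0 _.
nra.
Qed.

Lemma ccontV f z : f z != 0 -> ccont f z -> ccont (fun w => (f w)^-1) z.
Proof.
move=> fz cf e e0; have a0 := cabs_gt0 fz; set a := cabs (f z) in a0.
pose e1 := Num.min (a / 2) (e * a ^+ 2 / 2).
have e10 : 0 < e1.
  by rewrite lt_min !divr_gt0 ?mulr_gt0 ?exprn_gt0.
have [d [d0 H]] := cf _ e10; exists d; split=> // w /H h.
have ea : e1 <= a / 2 by rewrite ge_min lexx.
have eb : e1 <= e * a ^+ 2 / 2 by rewrite ge_min lexx orbT.
have t : a <= cabs (f w) + cabs (f w - f z).
  by rewrite /a -{1}(subKr (f w) (f z)) cabsB.
have b0 : a / 2 <= cabs (f w) by lra.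
have fw : f w != 0.
  by apply: contraTneq b0 => ->; rewrite cabs0 -ltNge divr_gt0.
have -> : (f w)^-1 - (f z)^-1 = (f z - f w) * (f w * f z)^-1 by field; apply/andP.
rewrite cabsM cabsV cabsM cabs_sym ler_pdivrMr; last by rewrite mulr_gt0 // cabs_gt0.
rewrite -/a; apply: le_trans h _; apply: le_trans eb _.
set b := cabs (f w) in b0 *.
have -> : e * a ^+ 2 / 2 = e * (a / 2 * a) by ring.
by rewrite ler_pM2l // ler_pM2r.
Qed.

(** Carathéodory's criterion: the difference quotient, completed by the derivative at [z], is
    continuous there. The product and inverse rules then reduce to algebra on the factor [p]. *)
Lemma cdiffP f z : cdifferentiable f z <->
  exists p, ccont p z /\ forall w, f w - f z = p w * (w - z).
Proof.
split=> [[l H]|[p [cp E]]].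
  exists (fun w => if w == z then l else (f w - f z) / (w - z)); split.
    move=> e e0; have [d [d0 Hd]] := H e e0; exists d; split=> // w wd; rewrite eqxx.
    case: eqVneq => [_|wz]; first by rewrite subrr cabs0; exact: ltW.
    have wz' : w - z != 0 by rewrite subr_eq0.
    have -> : (f w - f z) / (w - z) - l = (f w - f z - l * (w - z)) / (w - z) by field.
    by rewrite cabsM cabsV ler_pdivrMr ?cabs_gt0 // Hd.
  move=> w; case: eqVneq => [->|wz]; first by rewrite !subrr mulr0.
  by rewrite divfK // subr_eq0.
exists (p z) => e /cp [d [d0 H]]; exists d; split=> // w /H h.
by rewrite E -mulrBl cabsM ler_wpM2r // cabs_ge0.
Qed.

Lemma cdiff_ccont f z : cdifferentiable f z -> ccont f z.
Proof.
move=> /cdiffP [p [cp E]] e e0.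
have : ccont (fun w => f z + p w * (w + - z)) z.
  apply: ccontD; first exact: ccont_cst.
  by apply: ccontM => //; apply: ccontD; [exact: ccont_id|exact: ccont_cst].
move=> /(_ e e0) [d [d0 H]]; exists d; split=> // w /H.
by rewrite subrr mulr0 addr0 -E; congr (cabs _ <= _); ring.
Qed.

Lemma cdiff_cst c z : cdifferentiable (fun=> c) z.
Proof. by apply/cdiffP; exists (fun=> 0); split=> [|w]; [exact: ccont_cst|rewrite subrr mul0r]. Qed.

Lemma cdiff_id z : cdifferentiable id z.
Proof. by apply/cdiffP; exists (fun=> 1); split=> [|w]; [exact: ccont_cst|rewrite mul1r]. Qed.

Lemma cdiffD f g z : cdifferentiable f z -> cdifferentiable g z ->
  cdifferentiable (fun w => f w + g w) z.
Proof.
move=> /cdiffP[p [cp Ep]] /cdiffP[q [cq Eq]]; apply/cdiffP.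
exists (fun w => p w + q w); split; first exact: ccontD.
by move=> w; rewrite mulrDl -Ep -Eq; ring.
Qed.

Lemma cdiffM f g z : cdifferentiable f z -> cdifferentiable g z ->
  cdifferentiable (fun w => f w * g w) z.
Proof.
move=> df dg; have cg := cdiff_ccont dg; move: df dg.
move=> /cdiffP[p [cp Ep]] /cdiffP[q [cq Eq]]; apply/cdiffP.
exists (fun w => p w * g w + f z * q w); split.
  by apply: ccontD; apply: ccontM => //; exact: ccont_cst.
move=> w; rewrite mulrDl mulrAC -Ep -mulrA -Eq; ring.
Qed.

Lemma cdiffV f z : f z != 0 -> cdifferentiable f z ->
  cdifferentiable (fun w => (f w)^-1) z.
Proof.
move=> fz df; have cf := cdiff_ccont df; move: df => /cdiffP[p [cp Ep]].
(* Where [f w = 0], the convention [0^-1 = 0] spoils the usual factor [- p w / (f w * f z)], so the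
   raw quotient is taken. Near [z] this case does not occur, as [f w] stays within [cabs (f z) / 2]
   of [f z]. *)
apply/cdiffP; exists (fun w => if f w == 0 then
    ((f w)^-1 - (f z)^-1) / (w - z) else - p w * (f w)^-1 * (f z)^-1); split.
  have H : ccont (fun w => (- 1 * p w) * (f w)^-1 * (f z)^-1) z.
    apply: ccontM; last exact: ccont_cst.
    apply: ccontM; last exact: ccontV.
    by apply: ccontM => //; exact: ccont_cst.
  move=> e e0; have [d1 [d10 H1]] := H e e0.
  have [d2 [d20 H2]] := cf (cabs (f z) / 2) (divr_gt0 (cabs_gt0 fz) (ltr0Sn _ _)).
  exists (Num.min d1 d2); rewrite lt_min d10 d20; split=> // w.
  rewrite lt_min => /andP[/H1 h1 /H2 h2]; rewrite (negbTE fz).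
  case: eqP => [fw|_]; last by move: h1; rewrite !mulN1r.
  by move: h2; rewrite fw sub0r cabsN; have := cabs_gt0 fz; lra.
move=> w; case: eqP => [fw|/eqP fw].
  have wz : w - z != 0.
    by rewrite subr_eq0; apply: contraNneq fz => <-; rewrite fw.
  by rewrite divfK.
have -> : - p w * (f w)^-1 / f z * (w - z) = - (p w * (w - z)) * ((f w)^-1 / f z) by ring.
by rewrite -Ep; field; apply/andP.
Qed.

End ComplexModulus.

(** * Goursat's theorem on rectangles *)

Section Goursat.
Variable R : realType.
Implicit Types (F : R[i] -> R[i]) (a b c d : R).
Notation mu := (@lebesgue_measure R).

Lemma ccont_path F (g : R -> R[i]) t :
  (forall s, cabs (g s - g t) <= `|s - t|) -> ccont F (g t) ->
  {for t, continuous (fun s => complex.Re (F (g s)))} /\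
  {for t, continuous (fun s => complex.Im (F (g s)))}.
Proof.
move=> gl cF; split; apply/cvgrPdist_le => e /cF [d [d0 H]]; near=> s;
  (apply: le_trans (H (g s) _); last first);
  rewrite 1?[`|complex.Re _ - _|]distrC 1?[`|complex.Im _ - _|]distrC -?raddfB ?Re_le_cabs ?Im_le_cabs //;
  apply: le_lt_trans (gl s) _; rewrite distrC; near: s;
  exact: cvgr_dist_lt.
Unshelve. all: by end_near. Qed.

Lemma cabs_hline y s t : cabs ((s +i* y)%C - (t +i* y)%C : R[i]) <= `|s - t|.
Proof. by apply: le_trans (cabs_le_sum _) _; rewrite /= subrr normr0 addr0. Qed.

Lemma cabs_vline x s t : cabs ((x +i* s)%C - (x +i* t)%C : R[i]) <= `|s - t|.
Proof. by apply: le_trans (cabs_le_sum _) _; rewrite /= subrr normr0 add0r. Qed.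

Lemma integrable_itv_cont (f : R -> R) a b :
  (forall x, a <= x <= b -> {for x, continuous f}) ->
  mu.-integrable `[a, b] (EFin \o f).
Proof.
move=> cf; apply: continuous_compact_integrable; first exact: segment_compact.
by apply: continuous_in_subspaceT => x; rewrite inE /= in_itv /=; exact: cf.
Qed.

Lemma Rintegral_dist_le (f : R -> R) a b k e : a <= b ->
  (forall x, a <= x <= b -> {for x, continuous f}) ->
  (forall x, a <= x <= b -> `|f x - k| <= e) ->
  `|\int[mu]_(x in `[a, b]) f x - k * (b - a)| <= e * (b - a).
Proof.
move=> ab cf H; have fi := integrable_itv_cont cf.
have ci (q : R) : mu.-integrable `[a, b] (EFin \o cst q).
  by apply: integrable_itv_cont => x _; exact: cst_continuous.
have Ic (q : R) : \int[mu]_(x in `[a, b]) (cst q x) = q * (b - a).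
  rewrite Rintegral_cst ?measurable_itv //=.
  by rewrite lebesgue_measure_itv /= lte_fin; case: ltgtP ab => // -> _; rewrite subrr.
have Lo : (k - e) * (b - a) <= \int[mu]_(x in `[a, b]) f x.
  rewrite -Ic; apply: le_Rintegral => // x; rewrite /= in_itv /= => /H.
  by rewrite ler_norml => /andP[h1 h2]; lra.
have Hi : \int[mu]_(x in `[a, b]) f x <= (k + e) * (b - a).
  rewrite -Ic; apply: le_Rintegral => // x; rewrite /= in_itv /= => /H.
  by rewrite ler_norml => /andP[h1 h2]; lra.
move: Lo Hi; move: (\int[mu]_(x in _) _) => I Lo Hi.
by rewrite ler_norml; apply/andP; split; lra.
Qed.

Lemma Rintegral_itv_split (f : R -> R) a m b : a <= m -> m <= b ->
  (forall x, a <= x <= b -> {for x, continuous f}) ->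
  \int[mu]_(x in `[a, b]) f x =
  \int[mu]_(x in `[a, m]) f x + \int[mu]_(x in `[m, b]) f x.
Proof.
move=> am mb cf; have fi := integrable_itv_cont cf.
have := @Rintegral_itvB _ f (BLeft a) (BRight b) m fi.
rewrite !bnd_simp => /(_ am mb) E; apply/eqP; rewrite addrC -subr_eq E; apply/eqP.
rewrite Rintegral_itv_obnd_cbnd //; apply: integrableS fi => //.
by move=> x /=; rewrite !in_itv /= => /andP[mx ->]; rewrite (le_trans am) ?ltW.
Qed.

Definition in_rect a b c d (z : R[i]) :=
  a <= complex.Re z <= b /\ c <= complex.Im z <= d.

(* Real part of the integral of [F dz] along the boundary of [a,b] x [c,d];
   the imaginary part is the real part for the function [- 'i * F]. *)
Definition re_contour F a b c d : R :=
  \int[mu]_(x in `[a, b]) (complex.Re (F (x +i* c)%C) - complex.Re (F (x +i* d)%C)) +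
  \int[mu]_(y in `[c, d]) (complex.Im (F (a +i* y)%C) - complex.Im (F (b +i* y)%C)).

Definition on_boundary a b c d (z : R[i]) :=
  in_rect a b c d z /\
  [|| complex.Re z == a, complex.Re z == b, complex.Im z == c | complex.Im z == d].

Lemma hdiff_cont F a b c d x : (forall z, on_boundary a b c d z -> ccont F z) ->
  c <= d -> a <= x <= b ->
  {for x, continuous (fun x => complex.Re (F (x +i* c)%C) - complex.Re (F (x +i* d)%C))}.
Proof.
move=> cF cd xab; apply: cvgB.
  have [] // := @ccont_path F (fun s => (s +i* c)%C) x _ _ => [s|]; first exact: cabs_hline.
  by apply: cF; rewrite /on_boundary /in_rect /= xab lexx cd eqxx ?orbT.
have [] // := @ccont_path F (fun s => (s +i* d)%C) x _ _ => [s|]; first exact: cabs_hline.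
by apply: cF; rewrite /on_boundary /in_rect /= xab lexx cd eqxx ?orbT.
Qed.

Lemma vdiff_cont F a b c d y : (forall z, on_boundary a b c d z -> ccont F z) ->
  a <= b -> c <= y <= d ->
  {for y, continuous (fun y => complex.Im (F (a +i* y)%C) - complex.Im (F (b +i* y)%C))}.
Proof.
move=> cF ab ycd; apply: cvgB.
  have [] // := @ccont_path F (fun s => (a +i* s)%C) y _ _ => [s|]; first exact: cabs_vline.
  by apply: cF; rewrite /on_boundary /in_rect /= ycd lexx ab eqxx ?orbT.
have [] // := @ccont_path F (fun s => (b +i* s)%C) y _ _ => [s|]; first exact: cabs_vline.
by apply: cF; rewrite /on_boundary /in_rect /= ycd lexx ab eqxx ?orbT.
Qed.

(** The two integrals along the common edge cancel. Continuity is asked on the edges only, so the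
    rectangle may surround a singularity. *)
Lemma re_contour_vsplit F a m b c d : a <= m -> m <= b -> c <= d ->
  (forall z, on_boundary a b c d z -> ccont F z) ->
  (forall y, c <= y <= d -> ccont F (m +i* y)%C) ->
  re_contour F a b c d = re_contour F a m c d + re_contour F m b c d.
Proof.
move=> am mb cd cF cm; rewrite /re_contour (Rintegral_itv_split am mb); last first.
  by move=> x; exact: hdiff_cont cF cd.
rewrite addrACA; congr (_ + _); rewrite -RintegralD //.
- by apply: eq_Rintegral => y _; rewrite addrA subrK.
- apply: integrable_itv_cont => y ycd; apply: (@vdiff_cont F a m c d) => // z.
  move=> [[/andP[h1 h2] h3]]; case/or4P => h4; last 2 first.
  + by apply: cF; rewrite /on_boundary /in_rect h1 (le_trans h2 mb) h3 h4 ?orbT.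
  + by apply: cF; rewrite /on_boundary /in_rect h1 (le_trans h2 mb) h3 h4 ?orbT.
  + by apply: cF; rewrite /on_boundary /in_rect h1 (le_trans h2 mb) h3 h4.
  + have -> : z = (m +i* complex.Im z)%C by case: z h4 {h1 h2 h3} => p q /= /eqP ->.
    exact: cm.
- apply: integrable_itv_cont => y ycd; apply: (@vdiff_cont F m b c d) => // z.
  move=> [[/andP[h1 h2] h3]]; case/or4P => h4; last 3 first.
  + by apply: cF; rewrite /on_boundary /in_rect h2 (le_trans am h1) h3 h4 ?orbT.
  + by apply: cF; rewrite /on_boundary /in_rect h2 (le_trans am h1) h3 h4 ?orbT.
  + by apply: cF; rewrite /on_boundary /in_rect h2 (le_trans am h1) h3 h4 ?orbT.
  + have -> : z = (m +i* complex.Im z)%C by case: z h4 {h1 h2 h3} => p q /= /eqP ->.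
    exact: cm.
Qed.

Lemma re_contour_hsplit F a b c m d : c <= m -> m <= d -> a <= b ->
  (forall z, on_boundary a b c d z -> ccont F z) ->
  (forall x, a <= x <= b -> ccont F (x +i* m)%C) ->
  re_contour F a b c d = re_contour F a b c m + re_contour F a b m d.
Proof.
move=> cm md ab cF cx; rewrite /re_contour (Rintegral_itv_split cm md); last first.
  by move=> x; exact: vdiff_cont cF ab.
rewrite addrACA; congr (_ + _); rewrite -RintegralD //.
- by apply: eq_Rintegral => y _; rewrite addrA subrK.
- apply: integrable_itv_cont => x xab; apply: (@hdiff_cont F a b c m) => // z.
  move=> [[h3 /andP[h1 h2]]]; case/or4P => h4.
  + by apply: cF; rewrite /on_boundary /in_rect h1 (le_trans h2 md) h3 h4 ?orbT.
  + by apply: cF; rewrite /on_boundary /in_rect h1 (le_trans h2 md) h3 h4 ?orbT.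
  + by apply: cF; rewrite /on_boundary /in_rect h1 (le_trans h2 md) h3 h4 ?orbT.
  + have -> : z = (complex.Re z +i* m)%C by case: z h4 {h1 h2 h3} => p q /= /eqP ->.
    exact: cx.
- apply: integrable_itv_cont => x xab; apply: (@hdiff_cont F a b m d) => // z.
  move=> [[h3 /andP[h1 h2]]]; case/or4P => h4.
  + by apply: cF; rewrite /on_boundary /in_rect h2 (le_trans cm h1) h3 h4 ?orbT.
  + by apply: cF; rewrite /on_boundary /in_rect h2 (le_trans cm h1) h3 h4 ?orbT.
  + have -> : z = (complex.Re z +i* m)%C by case: z h4 {h1 h2 h3} => p q /= /eqP ->.
    exact: cx.
  + by apply: cF; rewrite /on_boundary /in_rect h2 (le_trans cm h1) h3 h4 ?orbT.
Qed.

(** The affine part has zero contour integral: its horizontal edges contribute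
    [Im l * (d - c) * (b - a)] and its vertical edges the opposite. Each integrand pairs two
    opposite edges, whence [2 * e]. *)
Lemma re_contour_le F a b c d k l e : a <= b -> c <= d ->
  (forall z, on_boundary a b c d z -> ccont F z) ->
  (forall z, on_boundary a b c d z -> cabs (F z - (k + l * z)) <= e) ->
  `|re_contour F a b c d| <= 2 * e * ((b - a) + (d - c)).
Proof.
move=> ab cd cF H.
have h1 := @Rintegral_dist_le _ a b (complex.Im l * (d - c)) (2 * e) ab
   (fun x => @hdiff_cont F a b c d x cF cd).
have h2 := @Rintegral_dist_le _ c d (- complex.Im l * (b - a)) (2 * e) cd
   (fun x => @vdiff_cont F a b c d x cF ab).
rewrite /re_contour mulrDr -[X in `|X|]subr0.
have -> : 0 = (complex.Im l * (d - c)) * (b - a) + (- complex.Im l * (b - a)) * (d - c) by ring.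
rewrite opprD addrACA; apply: le_trans (ler_normD _ _) _; apply: lerD.
  apply: h1 => x xab.
  have /H p1 : on_boundary a b c d (x +i* c)%C.
    by rewrite /on_boundary /in_rect /= xab lexx cd eqxx ?orbT.
  have /H p2 : on_boundary a b c d (x +i* d)%C.
    by rewrite /on_boundary /in_rect /= xab lexx cd eqxx ?orbT.
  have q1 := le_trans (Re_le_cabs _) p1; have q2 := le_trans (Re_le_cabs _) p2.
  move: q1 q2; rewrite !raddfB /= !raddfD /=; case: k l {H h2 p1 p2} => k1 k2 [l1 l2] /=.
  by rewrite !ler_norml => /andP[q1 q2] /andP[q3 q4]; apply/andP; split; lra.
apply: h2 => y ycd.
have /H p1 : on_boundary a b c d (a +i* y)%C.
  by rewrite /on_boundary /in_rect /= ycd lexx ab eqxx ?orbT.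
have /H p2 : on_boundary a b c d (b +i* y)%C.
  by rewrite /on_boundary /in_rect /= ycd lexx ab eqxx ?orbT.
have q1 := le_trans (Im_le_cabs _) p1; have q2 := le_trans (Im_le_cabs _) p2.
move: q1 q2; rewrite !raddfB /= !raddfD /=; case: k l {H h1 p1 p2} => k1 k2 [l1 l2] /=.
by rewrite !ler_norml => /andP[q1 q2] /andP[q3 q4]; apply/andP; split; lra.
Qed.

(** If each quarter had less than a fourth of the modulus, their sum could not reach it. Sides are
    written [u + u] and [v + v] to keep the halving linear. *)
Lemma re_contour_quarter F x y u v : 0 <= u -> 0 <= v ->
  (forall z, in_rect x (x + (u + u)) y (y + (v + v)) z -> ccont F z) ->
  exists x' y', [/\ x <= x', x' + u <= x + (u + u), y <= y', y' + v <= y + (v + v) &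
    `|re_contour F x (x + (u + u)) y (y + (v + v))| <=
      4 * `|re_contour F x' (x' + u) y' (y' + v)|].
Proof.
move=> u0 v0 cF.
have cR x1 x2 y1 y2 z : x <= x1 -> x2 <= x + (u + u) -> y <= y1 -> y2 <= y + (v + v) ->
    on_boundary x1 x2 y1 y2 z -> ccont F z.
  by move=> ? ? ? ? [[/andP[z1 z2] /andP[z3 z4]] _]; apply: cF; split; apply/andP; split; lra.
have E : re_contour F x (x + (u + u)) y (y + (v + v)) =
    re_contour F x (x + u) y (y + v) + re_contour F x (x + u) (y + v) (y + v + v) +
    re_contour F (x + u) (x + u + u) y (y + v) +
    re_contour F (x + u) (x + u + u) (y + v) (y + v + v).
  rewrite !addrA (@re_contour_vsplit F x (x + u)); [|lra|lra|lra| |]; last 2 first.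
  - by move=> z; apply: cR; lra.
  - by move=> t /andP[t1 t2]; apply: cF; split=> /=; apply/andP; split; lra.
  rewrite (@re_contour_hsplit F x _ y (y + v)); [|lra|lra|lra| |]; last 2 first.
  - by move=> z; apply: cR; lra.
  - by move=> t /andP[t1 t2]; apply: cF; split=> /=; apply/andP; split; lra.
  rewrite (@re_contour_hsplit F _ (x + u + u) y (y + v)); [|lra|lra|lra| |]; last 2 first.
  - by move=> z; apply: cR; lra.
  - by move=> t /andP[t1 t2]; apply: cF; split=> /=; apply/andP; split; lra.
  by rewrite !addrA.
apply: contrapT => nq.
have hq x' y' : x <= x' -> x' + u <= x + (u + u) -> y <= y' -> y' + v <= y + (v + v) ->
    4 * `|re_contour F x' (x' + u) y' (y' + v)| < `|re_contour F x (x + (u + u)) y (y + (v + v))|.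
  by move=> *; rewrite ltNge; apply/negP => h; apply: nq; exists x', y'; split.
have h1 : 4 * `|re_contour F x (x + u) y (y + v)| < `|re_contour F x (x + (u + u)) y (y + (v + v))|.
  by apply: hq; lra.
have h2 : 4 * `|re_contour F x (x + u) (y + v) (y + v + v)| < `|re_contour F x (x + (u + u)) y (y + (v + v))|.
  by apply: hq; lra.
have h3 : 4 * `|re_contour F (x + u) (x + u + u) y (y + v)| < `|re_contour F x (x + (u + u)) y (y + (v + v))|.
  by apply: hq; lra.
have h4 : 4 * `|re_contour F (x + u) (x + u + u) (y + v) (y + v + v)| < `|re_contour F x (x + (u + u)) y (y + (v + v))|.
  by apply: hq; lra.
move: h1 h2 h3 h4; rewrite E; clear.
set p := re_contour F x (x + u) y (y + v).
set q := re_contour F x (x + u) (y + v) (y + v + v).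
set r := re_contour F (x + u) (x + u + u) y (y + v).
set s := re_contour F (x + u) (x + u + u) (y + v) (y + v + v).
move: p q r s => p q r s h1 h2 h3 h4.
have := ler_normD (p + q + r) s; have := ler_normD (p + q) r; have := ler_normD p q.
lra.
Qed.

(** Repeated quartering keeps the contour integral above a multiple of the squared side, while
    differentiability at the limit point makes it of smaller order: the remainder is [o(side)] on a
    boundary of length comparable to the side. *)
Theorem goursat_rect F a b c d : a <= b -> c <= d ->
  (forall z, in_rect a b c d z -> cdifferentiable F z) ->
  re_contour F a b c d = 0.
Proof.
move=> ab cd dF; apply/eqP; apply: contrapT => /negP Jn0.
have cF z : in_rect a b c d z -> ccont F z by move=> /dF/cdiff_ccont.
pose A := b - a; pose B := d - c.
have A0 : 0 <= A by rewrite subr_ge0.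
have B0 : 0 <= B by rewrite subr_ge0.
(* Half the modulus makes the initial rectangle satisfy [bad] strictly; passing to a quarter loses
   at most a factor 4, which is exactly the loss in [s n ^+ 2]. *)
pose e0 := `|re_contour F a b c d| / 2.
have e00 : 0 < e0 by rewrite divr_gt0 ?normr_gt0.
pose s n : R := 2^-1 ^+ n.
have s0 n : 0 < s n by rewrite exprn_gt0 ?invr_gt0.
have sS n : s n = 2 * s n.+1 by rewrite /s exprS; field.
pose J n (p : R * R) := re_contour F p.1 (p.1 + A * s n) p.2 (p.2 + B * s n).
pose bad n p := e0 * s n ^+ 2 < `|J n p|.
pose inr n (p : R * R) := [/\ a <= p.1, p.1 + A * s n <= b, c <= p.2 & p.2 + B * s n <= d].
pose child n (p q : R * R) := [/\ p.1 <= q.1, q.1 + A * s n.+1 <= p.1 + A * s n,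
  p.2 <= q.2 & q.2 + B * s n.+1 <= p.2 + B * s n].
have step n p : bad n p -> inr n p -> exists q, child n p q /\ bad n.+1 q.
  case: p => x y bp [/= i1 i2 i3 i4].
  have t0 := s0 n.+1; set t := s n.+1 in t0.
  have At0 : 0 <= A * t by rewrite mulr_ge0 // ltW.
  have Bt0 : 0 <= B * t by rewrite mulr_ge0 // ltW.
  have EA : A * s n = A * t + A * t by rewrite sS -/t; ring.
  have EB : B * s n = B * t + B * t by rewrite sS -/t; ring.
  move: i2 i4 bp; rewrite /bad /J /child /= -/t EA EB sS -/t => i2 i4 bp.
  have [|x' [y' [h1 h2 h3 h4 h5]]] := @re_contour_quarter F x y _ _ At0 Bt0.
    move=> z [/andP[z1 z2] /andP[z3 z4]]; apply: cF.
    by rewrite /in_rect (le_trans i1 z1) (le_trans z2 i2) (le_trans i3 z3) (le_trans z4 i4).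
  exists (x', y'); split; first by split.
  rewrite -(ltr_pM2l (_ : 0 < 4 :> R)) //; apply: lt_le_trans h5; apply: le_lt_trans bp.
  by rewrite exprMn mulrCA -natrX.
pose nxt n p := xget p [set q | child n p q /\ bad n.+1 q].
pose sq := fix sq n := if n is m.+1 then nxt m (sq m) else (a, c).
have inv n : [/\ bad n (sq n), inr n (sq n) & child n (sq n) (sq n.+1)].
  have step2 m : bad m (sq m) -> inr m (sq m) ->
      child m (sq m) (sq m.+1) /\ bad m.+1 (sq m.+1).
    move=> bm im /=; have [q hq] := step _ _ bm im.
    by rewrite /nxt; case: xgetP => [q' _ //|/(_ q)].
  elim: n => [|n [bn [i1 i2 i3 i4] [c1 c2 c3 c4]]].
    have b0 : bad 0%N (a, c).
      rewrite /bad /J /s expr0 expr1n !mulr1 /A /B /= !subrKC /e0.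
      by rewrite ltr_pdivrMr // ltr_pMr ?normr_gt0 // ltr1n.
    have i0 : inr 0%N (a, c).
      by split => //=; rewrite /s expr0 mulr1 /A /B subrKC.
    by have [] := step2 _ b0 i0.
  have [_ b'] := step2 _ bn (And4 i1 i2 i3 i4).
  have i' : inr n.+1 (sq n.+1) by split; lra.
  by have [] := step2 _ b' i'.
have mono n m : [/\ (sq n).1 <= (sq (n + m)%N).1,
    (sq (n + m)%N).1 + A * s (n + m)%N <= (sq n).1 + A * s n,
    (sq n).2 <= (sq (n + m)%N).2 &
    (sq (n + m)%N).2 + B * s (n + m)%N <= (sq n).2 + B * s n].
  elim: m => [|m [h1 h2 h3 h4]]; first by rewrite addn0; split.
  by rewrite addnS; have [_ _ [g1 g2 g3 g4]] := inv (n + m)%N; split; lra.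
have ub n m : (sq m).1 <= (sq n).1 + A * s n /\ (sq m).2 <= (sq n).2 + B * s n.
  have Am k : 0 <= A * s k by rewrite mulr_ge0 // ltW.
  have Bm k : 0 <= B * s k by rewrite mulr_ge0 // ltW.
  have [nm|/ltnW mn] := leqP n m.
    have [h1 h2 h3 h4] := mono n (m - n)%N; rewrite subnKC // in h1 h2 h3 h4.
    by have := Am m; have := Bm m; split; lra.
  have [h1 h2 h3 h4] := mono m (n - m)%N; rewrite subnKC // in h1 h2 h3 h4.
  by have := Am n; have := Bm n; split; lra.
(* The lower left corners increase and are bounded by every upper right corner, so [(X, Y)] lies in
   all the rectangles. *)
pose X := sup (range (fun n => (sq n).1)); pose Y := sup (range (fun n => (sq n).2)).
have Xb n : (sq n).1 <= X <= (sq n).1 + A * s n.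
  apply/andP; split.
    apply: ub_le_sup; last by exists n.
    by exists ((sq 0%N).1 + A * s 0%N) => _ [m _ <-]; have [] := ub 0%N m.
  by apply: ge_sup; [exists (sq 0%N).1, 0%N|move=> _ [m _ <-]; have [] := ub n m].
have Yb n : (sq n).2 <= Y <= (sq n).2 + B * s n.
  apply/andP; split.
    apply: ub_le_sup; last by exists n.
    by exists ((sq 0%N).2 + B * s 0%N) => _ [m _ <-]; have [] := ub 0%N m.
  by apply: ge_sup; [exists (sq 0%N).2, 0%N|move=> _ [m _ <-]; have [] := ub n m].
have XYin : in_rect a b c d (X +i* Y)%C.
  have [_ [i1 i2 i3 i4] _] := inv 0%N.
  by have /andP[? ?] := Xb 0%N; have /andP[? ?] := Yb 0%N; split; apply/andP; split=> /=; lra.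
have [l Hl] := dF _ XYin.
pose D := A + B.
have D0 : 0 <= D by rewrite addr_ge0.
(* With this [e] the contour bound [2 e (D s)^2] is at most [e0 s^2], which contradicts [bad]. *)
pose e := e0 / (2 * D ^+ 2 + 1).
have eD : 0 < 2 * D ^+ 2 + 1 by have := sqr_ge0 D; lra.
have e_gt0 : 0 < e by rewrite divr_gt0.
have [r [r0 Hr]] := Hl e e_gt0.
have [n Hn] : exists n, D * s n < r.
  have : (fun n => D * s n) n @[n --> \oo] --> D * 0.
    by apply: cvgM; [exact: cvg_cst|apply: cvg_expr; rewrite gtr0_norm ?invf_lt1 // ltr1n].
  rewrite mulr0 => /cvgr_lt /(_ r r0) [n _ Hn]; exists n; exact: Hn (leqnn n).
have [bn [i1 i2 i3 i4] _] := inv n.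
have /andP[X1 X2] := Xb n; have /andP[Y1 Y2] := Yb n.
have As : 0 <= A * s n by rewrite mulr_ge0 // ltW.
have Bs : 0 <= B * s n by rewrite mulr_ge0 // ltW.
have H := @re_contour_le F (sq n).1 ((sq n).1 + A * s n) (sq n).2 ((sq n).2 + B * s n)
  (F (X +i* Y)%C - l * (X +i* Y)%C) l (e * (D * s n)).
have /H {}H : (sq n).1 <= (sq n).1 + A * s n by lra.
have /H {}H : (sq n).2 <= (sq n).2 + B * s n by lra.
have : `|J n (sq n)| <= 2 * (e * (D * s n)) * ((A * s n) + (B * s n)).
  rewrite (_ : A * s n + B * s n =
    (sq n).1 + A * s n - (sq n).1 + ((sq n).2 + B * s n - (sq n).2)); last by ring.
  apply: H => z [[/andP[z1 z2] /andP[z3 z4]] _].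
    by apply: cF; rewrite /in_rect (le_trans i1 z1) (le_trans z2 i2) (le_trans i3 z3) (le_trans z4 i4).
  have zr : cabs (z - (X +i* Y)%C) <= D * s n.
    apply: le_trans (cabs_le_sum _) _; rewrite !raddfB /= /D mulrDl.
    by apply: lerD; rewrite ler_norml; apply/andP; clear -X1 X2 Y1 Y2 z1 z2 z3 z4; split; lra.
  have := Hr z (le_lt_trans zr Hn).
  set w := (X +i* Y)%C in zr *.
  rewrite (_ : F z - F w - l * (z - w) = F z - (F w - l * w + l * z)); last by ring.
  by move/le_trans; apply; rewrite ler_pM2l.
move: bn; rewrite /bad => /lt_le_trans /[apply]; apply/negP; rewrite -leNgt.
rewrite -mulrDl -/D (_ : 2 * _ * _ = (e * (2 * D ^+ 2)) * s n ^+ 2); last by ring.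
rewrite ler_pM2r ?exprn_gt0 // /e mulrAC ler_pdivrMr // ler_pM2l //.
by lra.
Qed.

End Goursat.

(** * Cauchy estimates on squares for a function and its derivative *)

Section CauchyEstimates.
Variable R : realType.
Implicit Types (F f : R[i] -> R[i]) (z : R[i]) (r : R).
Notation mu := (@lebesgue_measure R).

Definition in_square (z0 : R[i]) (r : R) (z : R[i]) :=
  `|complex.Re z - complex.Re z0| <= r /\ `|complex.Im z - complex.Im z0| <= r.

Definition square_contour F (z0 : R[i]) r :=
  re_contour F (complex.Re z0 - r) (complex.Re z0 + r)
               (complex.Im z0 - r) (complex.Im z0 + r).

Lemma in_squareE z0 r z : in_square z0 r z <->
  in_rect (complex.Re z0 - r) (complex.Re z0 + r)
          (complex.Im z0 - r) (complex.Im z0 + r) z.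
Proof.
by rewrite /in_square /in_rect !ler_distl.
Qed.

Lemma boundary_square_ge z0 r z : 0 < r ->
  on_boundary (complex.Re z0 - r) (complex.Re z0 + r)
              (complex.Im z0 - r) (complex.Im z0 + r) z -> r <= cabs (z - z0).
Proof.
move=> r0 [_ H].
have R1 := Re_le_cabs (z - z0); have I1 := Im_le_cabs (z - z0).
move: R1 I1; rewrite !raddfB /=.
move=> R1 I1; case/or4P: H => /eqP E;
  [apply: le_trans R1|apply: le_trans R1|apply: le_trans I1|apply: le_trans I1];
  by rewrite E addrAC subrr add0r ?normrN gtr0_norm.
Qed.

Lemma boundary_square_neq z0 r z : 0 < r ->
  on_boundary (complex.Re z0 - r) (complex.Re z0 + r)
              (complex.Im z0 - r) (complex.Im z0 + r) z -> z != z0.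
Proof.
move=> r0 /(boundary_square_ge r0); apply: contraTneq => ->.
by rewrite subrr cabs0 -ltNge.
Qed.

(* A singularity of order o(1/|z - z0|) does not contribute: the contour
   shrinks to an arbitrarily small square about [z0]. *)
Lemma square_contour_punctured F z0 r : 0 < r ->
  (forall z, in_square z0 r z -> z != z0 -> cdifferentiable F z) ->
  (forall e : R, 0 < e -> exists d : R, 0 < d /\ forall z, z != z0 ->
     cabs (z - z0) < d -> cabs (F z) * cabs (z - z0) <= e) ->
  square_contour F z0 r = 0.
Proof.
move=> r0 dF oF.
(* Cuts at [x0 - t], [x0 + t], [y0 - t] and [y0 + t] detach four rectangles that avoid [z0], to
   which Goursat's theorem applies. *)
have shrink t : 0 < t -> t < r -> square_contour F z0 r = square_contour F z0 t.
  move: z0 dF {oF} => [x0 y0] dF t0 tr; rewrite /square_contour /=.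
  have dF' x y : x0 - r <= x <= x0 + r -> y0 - r <= y <= y0 + r ->
      (x != x0) || (y != y0) -> cdifferentiable F (x +i* y)%C.
    move=> hx hy n; apply: dF; first by apply/in_squareE.
    by rewrite eq_complex /= negb_and.
  have cF' x y hx hy n := cdiff_ccont (dF' x y hx hy n).
  have eqn p q : p != q -> (p - q != 0 :> R) by rewrite subr_eq0.
  rewrite (@re_contour_vsplit _ F _ (x0 - t)); [|lra|lra|lra| |]; last 2 first.
  - move=> [x y] [[/= h1 h2] h]; apply: cF' => //.
    by case/or4P: h => /eqP ->; apply/orP; [left|left|right|right]; apply/eqP; lra.
  - by move=> y hy; apply: cF' => //; [lra|apply/orP; left; apply/eqP; lra].
  rewrite goursat_rect; [|lra|lra|]; last first.
    move=> [x y] [/= h1 h2]; apply: dF' => //; first lra.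
    by apply/orP; left; apply/eqP; lra.
  rewrite add0r (@re_contour_vsplit _ F _ (x0 + t)); [|lra|lra|lra| |]; last 2 first.
  - move=> [x y] [[/= h1 h2] h]; apply: cF' => //; first lra.
    by case/or4P: h => /eqP ->; apply/orP; [left|left|right|right]; apply/eqP; lra.
  - by move=> y hy; apply: cF' => //; [lra|apply/orP; left; apply/eqP; lra].
  rewrite [X in _ + X]goursat_rect; [|lra|lra|]; last first.
    move=> [x y] [/= h1 h2]; apply: dF' => //; first lra.
    by apply/orP; left; apply/eqP; lra.
  rewrite addr0 (@re_contour_hsplit _ F _ _ _ (y0 - t)); [|lra|lra|lra| |]; last 2 first.
  - move=> [x y] [[/= h1 h2] h]; apply: cF' => //; first lra.
    by case/or4P: h => /eqP ->; apply/orP; [left|left|right|right]; apply/eqP; lra.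
  - by move=> x hx; apply: cF' => //; [lra|lra|apply/orP; right; apply/eqP; lra].
  rewrite goursat_rect; [|lra|lra|]; last first.
    move=> [x y] [/= h1 h2]; apply: dF' => //; [lra|lra|].
    by apply/orP; right; apply/eqP; lra.
  rewrite add0r (@re_contour_hsplit _ F _ _ _ (y0 + t)); [|lra|lra|lra| |]; last 2 first.
  - move=> [x y] [[/= h1 h2] h]; apply: cF' => //; [lra|lra|].
    by case/or4P: h => /eqP ->; apply/orP; [left|left|right|right]; apply/eqP; lra.
  - by move=> x hx; apply: cF' => //; [lra|lra|apply/orP; right; apply/eqP; lra].
  rewrite [X in _ + X]goursat_rect ?addr0 //; [lra|lra|].
  move=> [x y] [/= h1 h2]; apply: dF' => //; [lra|lra|].
  by apply/orP; right; apply/eqP; lra.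
apply/eqP; rewrite -normr_le0; apply/ler_addgt0Pr => e e0; rewrite add0r.
have e8 : 0 < e / 8 by lra.
have [d [d0 H]] := oF _ e8.
(* Boundary points are within [2 t < d] of [z0] and at distance at least [t], so [cabs F] is at most
   [e / (8 t)] there; the contour bound [2 (e / (8 t)) (4 t)] is then [e]. *)
pose t := Num.min (d / 3) (r / 2).
have t0 : 0 < t by rewrite lt_min !divr_gt0.
have td : t <= d / 3 by rewrite ge_min lexx.
have tr : t <= r / 2 by rewrite ge_min lexx orbT.
rewrite (shrink t) //; last lra.
apply: le_trans (@re_contour_le _ F _ _ _ _ 0 0 (e / 8 / t) _ _ _ _) _; try lra.
- move=> z zb; apply/cdiff_ccont/dF; last exact: boundary_square_neq zb.
  by have [/in_squareE[h1 h2] _] := zb; split; lra.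
- move=> z zb; rewrite mul0r addr0 subr0 ler_pdivlMr //.
  apply: le_trans (H z (boundary_square_neq t0 zb) _).
    by rewrite ler_wpM2l ?cabs_ge0 // (boundary_square_ge t0 zb).
  apply: le_lt_trans (cabs_le_sum _) _; rewrite !raddfB.
  by have [/in_squareE[h1 h2] _] := zb; lra.
- rewrite [leLHS](_ : _ = e) //; field; exact: lt0r_neq0.
Qed.

(* [0 <= q] is compared with the boundary integral of the majorant [N] of the
   regular part; [4 * q] bounds the imaginary part of the contour integral of
   [q / (z - z0)] from below, whose exact value is [2 * pi * q]. *)
Lemma cauchy_estimate F z0 r q (N : R[i] -> R) : 0 < r -> 0 <= q ->
  (forall z, in_square z0 r z -> z != z0 -> cdifferentiable F z) ->
  square_contour F z0 r = 0 ->
  let x0 := complex.Re z0 in let y0 := complex.Im z0 in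
  (forall x, x0 - r <= x <= x0 + r ->
     {for x, continuous (fun x => N (x +i* (y0 - r))%C + N (x +i* (y0 + r))%C)}) ->
  (forall y, y0 - r <= y <= y0 + r ->
     {for y, continuous (fun y => N ((x0 - r) +i* y)%C + N ((x0 + r) +i* y)%C)}) ->
  (forall z, on_boundary (x0 - r) (x0 + r) (y0 - r) (y0 + r) z ->
     cabs (F z - (0 +i* q)%C / (z - z0)) <= N z) ->
  4 * q <= \int[mu]_(x in `[x0 - r, x0 + r]) (N (x +i* (y0 - r))%C + N (x +i* (y0 + r))%C) +
    \int[mu]_(y in `[y0 - r, y0 + r]) (N ((x0 - r) +i* y)%C + N ((x0 + r) +i* y)%C).
Proof.
move=> r0 q0 dF J0 x0 y0 ch cv HN.
have cF z : on_boundary (x0 - r) (x0 + r) (y0 - r) (y0 + r) z -> ccont F z.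
  move=> zb; apply/cdiff_ccont/dF; last exact: boundary_square_neq zb.
  by case: zb => /in_squareE.
(* Up to sign, [q r / (s^2 + r^2)] is the component of the singular term that a side sees. Two
   opposite sides give at least [q / r], hence [2 q] over the length [2 r]; both pairs give
   [4 q]. *)
have key s : `|s| <= r -> q / r <= 2 * (q * r / (s ^+ 2 + r ^+ 2)).
  move=> sr; have s2 : s ^+ 2 <= r ^+ 2 by rewrite -(real_normK (num_real s)) lerXn2r ?nnegrE // ltW.
  have p0 : 0 < s ^+ 2 + r ^+ 2 by rewrite ltr_wpDl ?sqr_ge0 // exprn_gt0.
  rewrite mulrA ler_pdivlMr // mulrAC ler_pdivrMr //; have := ler_wpM2l q0 s2.
  rewrite expr2; lra.
have cst_int s t (k : R) : s <= t ->
    mu.-integrable `[s, t] (EFin \o cst k) /\ \int[mu]_(x in `[s, t]) (cst k x) = k * (t - s).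
  move=> st; split; first by apply: integrable_itv_cont => x _; exact: cst_continuous.
  rewrite Rintegral_cst ?measurable_itv //=.
  by rewrite lebesgue_measure_itv /= lte_fin; case: ltgtP st => // -> _; rewrite subrr.
have hx : x0 - r <= x0 + r by lra.
have hy : y0 - r <= y0 + r by lra.
have subz0 x y : (x +i* y)%C - z0 = ((x - x0) +i* (y - y0))%C by rewrite /x0 /y0; case: (z0).
have B1 : \int[mu]_(x in `[x0 - r, x0 + r]) (complex.Re (F (x +i* (y0 - r))%C) - complex.Re (F (x +i* (y0 + r))%C))
   + 2 * q <= \int[mu]_(x in `[x0 - r, x0 + r]) (N (x +i* (y0 - r))%C + N (x +i* (y0 + r))%C).
  have [ci cE] := cst_int _ _ (q / r) hx.
  have -> : 2 * q = \int[mu]_(x in `[x0 - r, x0 + r]) (cst (q / r) x).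
    by rewrite cE; field; exact: lt0r_neq0.
  have fi : mu.-integrable `[x0 - r, x0 + r] (EFin \o (fun x =>
       (complex.Re (F (x +i* (y0 - r))%C) - complex.Re (F (x +i* (y0 + r))%C)))).
    by apply: integrable_itv_cont => x hx'; apply: hdiff_cont cF hy hx'.
  rewrite -RintegralD //; apply: le_Rintegral => //.
  - apply: integrable_itv_cont => t ht; apply: cvgD; last exact: cvg_cst.
    exact: hdiff_cont cF hy ht.
  - exact: integrable_itv_cont.
  - move=> x; rewrite /= in_itv /= => xi.
    have /HN p1 : on_boundary (x0 - r) (x0 + r) (y0 - r) (y0 + r) (x +i* (y0 - r))%C.
      by rewrite /on_boundary /in_rect /= xi lexx hy eqxx ?orbT.
    have /HN p2 : on_boundary (x0 - r) (x0 + r) (y0 - r) (y0 + r) (x +i* (y0 + r))%C.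
      by rewrite /on_boundary /in_rect /= xi lexx hy eqxx ?orbT.
    move: p1 p2; rewrite !subz0 => p1 p2.
    have := le_trans (Re_le_cabs _) p1; have := le_trans (Re_le_cabs _) p2.
    have : `|x - x0| <= r by rewrite ler_distl.
    move/key; rewrite !raddfB /=; move: (x - x0) => s.
    have -> : y0 - r - y0 = - r by lra.
    have -> : y0 + r - y0 = r by lra.
    rewrite !mul0r ?sub0r ?add0r ?sqrrN ?opprK !ler_norml => k /andP[k1 k2] /andP[k3 k4]; lra.
have B2 : \int[mu]_(y in `[y0 - r, y0 + r]) (complex.Im (F ((x0 - r) +i* y)%C) - complex.Im (F ((x0 + r) +i* y)%C))
   + 2 * q <= \int[mu]_(y in `[y0 - r, y0 + r]) (N ((x0 - r) +i* y)%C + N ((x0 + r) +i* y)%C).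
  have [ci cE] := cst_int _ _ (q / r) hy.
  have -> : 2 * q = \int[mu]_(x in `[y0 - r, y0 + r]) (cst (q / r) x).
    by rewrite cE; field; exact: lt0r_neq0.
  have fi : mu.-integrable `[y0 - r, y0 + r] (EFin \o (fun y =>
       (complex.Im (F ((x0 - r) +i* y)%C) - complex.Im (F ((x0 + r) +i* y)%C)))).
    by apply: integrable_itv_cont => x hx'; apply: vdiff_cont cF hx hx'.
  rewrite -RintegralD //; apply: le_Rintegral => //.
  - apply: integrable_itv_cont => t ht; apply: cvgD; last exact: cvg_cst.
    exact: vdiff_cont cF hx ht.
  - exact: integrable_itv_cont.
  - move=> y; rewrite /= in_itv /= => yi.
    have /HN p1 : on_boundary (x0 - r) (x0 + r) (y0 - r) (y0 + r) ((x0 - r) +i* y)%C.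
      by rewrite /on_boundary /in_rect /= yi lexx hx eqxx ?orbT.
    have /HN p2 : on_boundary (x0 - r) (x0 + r) (y0 - r) (y0 + r) ((x0 + r) +i* y)%C.
      by rewrite /on_boundary /in_rect /= yi lexx hx eqxx ?orbT.
    move: p1 p2; rewrite !subz0 => p1 p2.
    have := le_trans (Im_le_cabs _) p1; have := le_trans (Im_le_cabs _) p2.
    have : `|y - y0| <= r by rewrite ler_distl.
    move/key; rewrite !raddfB /=; move: (y - y0) => s.
    have -> : x0 - r - x0 = - r by lra.
    have -> : x0 + r - x0 = r by lra.
    rewrite !mul0r ?sub0r ?add0r ?sqrrN [r ^+ 2 + s ^+ 2]addrC ?opprK !ler_norml => k /andP[k1 k2] /andP[k3 k4]; lra.
move: J0; rewrite /square_contour /re_contour -/x0 -/y0; move: B1 B2.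
move: (Rintegral _ _ _) (Rintegral _ _ _) (Rintegral _ _ _) (Rintegral _ _ _) => *.
lra.
Qed.

(** The rotation onto the negative imaginary axis: [re_contour] keeps only real parts, and the
    contour integral of an imaginary multiple of [1 / (z - z0)] is real. At [v = 0] it vanishes by
    the convention on inverses, so its modulus is only at most 1. *)
Definition unimod (v : R[i]) : R[i] := (0 +i* -1)%C * conjc v / ((cabs v)%:C)%C.

Lemma unimodM v : unimod v * v = (0 +i* - cabs v)%C.
Proof.
rewrite /unimod; have [->|v0] := eqVneq v 0; first by rewrite mulr0 cabs0 oppr0.
have c0 : cabs v != 0 by rewrite gt_eqF ?cabs_gt0.
have cc0 : ((cabs v)%:C)%C != 0 :> R[i] by rewrite eq_complex /= eqxx andbT.
rewrite mulrAC -[X in X / _]mulrA [conjc v * v]mulrC mul_conj rmorphXn /= expr2 mulrA mulfK //.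
by apply/eqP; rewrite eq_complex /=; apply/andP; split; apply/eqP; ring.
Qed.

Lemma cabs_unimod v : cabs (unimod v) <= 1.
Proof.
rewrite /unimod !cabsM cabsV cabs_conj cabsR ger0_norm ?cabs_ge0 //.
have -> : cabs (0 +i* -1)%C = 1 :> R.
  by rewrite /cabs /= expr0n /= sqrrN expr1n add0r sqrtr1.
by rewrite mul1r; have [->|c0] := eqVneq (cabs v) 0; rewrite ?mul0r // divff.
Qed.

(** Subtracting [f z0] makes the singularity of the quotient by [z - z0] harmless, so its contour
    integral vanishes. The extra factor [r] makes [cabs f] itself the majorant of the regular part,
    because [cabs (z - z0) >= r] on the boundary. *)
Lemma cauchy_value f x0 y0 r : 0 < r ->
  (forall z, in_square (x0 +i* y0)%C r z -> cdifferentiable f z) ->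
  4 * r * cabs (f (x0 +i* y0)%C) <=
  \int[mu]_(x in `[x0 - r, x0 + r])
     (cabs (f (x +i* (y0 - r))%C) + cabs (f (x +i* (y0 + r))%C)) +
  \int[mu]_(y in `[y0 - r, y0 + r])
     (cabs (f ((x0 - r) +i* y)%C) + cabs (f ((x0 + r) +i* y)%C)).
Proof.
move=> r0; set z0 := (x0 +i* y0)%C => df.
have cf z : in_square z0 r z -> ccont (fun w => ((cabs (f w))%:C)%C) z.
  move=> /df/cdiff_ccont cf e /cf[d [d0 H]]; exists d; split=> // w /H.
  by rewrite -rmorphB /= cabsR; apply: le_trans; exact: cabs_dist.
have hx : x0 - r <= x0 + r by lra.
have hy : y0 - r <= y0 + r by lra.
have ch x : x0 - r <= x <= x0 + r -> {for x, continuous (fun x =>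
    cabs (f (x +i* (y0 - r))%C) + cabs (f (x +i* (y0 + r))%C))}.
  move=> xi; apply: cvgD.
    have [] // := @ccont_path _ (fun w => ((cabs (f w))%:C)%C) (fun s => (s +i* (y0 - r))%C) x.
      by move=> s; exact: cabs_hline.
    by apply: cf; apply/in_squareE; rewrite /in_rect /= xi lexx hy.
  have [] // := @ccont_path _ (fun w => ((cabs (f w))%:C)%C) (fun s => (s +i* (y0 + r))%C) x.
    by move=> s; exact: cabs_hline.
  by apply: cf; apply/in_squareE; rewrite /in_rect /= xi lexx hy.
have cv y : y0 - r <= y <= y0 + r -> {for y, continuous (fun y =>
    cabs (f ((x0 - r) +i* y)%C) + cabs (f ((x0 + r) +i* y)%C))}.
  move=> xi; apply: cvgD.
    have [] // := @ccont_path _ (fun w => ((cabs (f w))%:C)%C) (fun s => ((x0 - r) +i* s)%C) y.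
      by move=> s; exact: cabs_vline.
    by apply: cf; apply/in_squareE; rewrite /in_rect /= xi lexx hx.
  have [] // := @ccont_path _ (fun w => ((cabs (f w))%:C)%C) (fun s => ((x0 + r) +i* s)%C) y.
    by move=> s; exact: cabs_vline.
  by apply: cf; apply/in_squareE; rewrite /in_rect /= xi lexx hx.
pose F z := unimod (f z0) * (f z - f z0) / (z - z0).
have dF z : in_square z0 r z -> z != z0 -> cdifferentiable F z.
  move=> /df dfz zz; apply: cdiffM; first apply: cdiffM; first exact: cdiff_cst.
    by apply: cdiffD => //; exact: cdiff_cst.
  apply: cdiffV; first by rewrite subr_eq0.
  by apply: cdiffD; [exact: cdiff_id|exact: cdiff_cst].
have c0 : ccont f z0 by apply/cdiff_ccont/df; split; rewrite subrr normr0 ltW.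
have JF : square_contour F z0 r = 0.
  apply: square_contour_punctured => // e /c0 [d [d0 H]]; exists d; split=> // z zz /H h.
  rewrite -cabsM /F divfK ?subr_eq0 // cabsM; apply: le_trans h.
  by rewrite ler_piMl ?cabs_ge0 ?cabs_unimod.
have q0 : 0 <= r * cabs (f z0) by rewrite mulr_ge0 ?cabs_ge0 // ltW.
have dG z : in_square z0 r z -> z != z0 -> cdifferentiable (fun z => (r%:C)%C * F z) z.
  by move=> h1 h2; apply: cdiffM; [exact: cdiff_cst|exact: dF].
have JG : square_contour (fun z => (r%:C)%C * F z) z0 r = 0.
  apply: square_contour_punctured => // e e0.
  have e1 : 0 < e / r by rewrite divr_gt0.
  have [d [d0 H]] := c0 _ e1; exists d; split=> // z zz /H h.
  rewrite -cabsM /F -mulrA divfK ?subr_eq0 //.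
  have k1 := cabs_unimod (f z0); move: (unimod (f z0)) k1 => k k1.
  rewrite !cabsM cabsR gtr0_norm //.
  rewrite mulrC -ler_pdivlMr //; apply: le_trans h.
  by rewrite ler_piMl ?cabs_ge0.
rewrite -mulrA; apply: (@cauchy_estimate _ z0 r _ (fun w => cabs (f w)) r0 q0 dG JG) => // z zb.
have rz := boundary_square_ge r0 zb; have zz := boundary_square_neq r0 zb.
have zz' : z - z0 != 0 by rewrite subr_eq0.
have -> : (0 +i* (r * cabs (f z0)))%C = - ((r%:C)%C * (unimod (f z0) * f z0)) :> R[i].
  by rewrite unimodM; apply/eqP; rewrite eq_complex /=; apply/andP; split; apply/eqP; ring.
rewrite /F; move: (unimod (f z0)) (cabs_unimod (f z0)) => k k1.
have -> : (r%:C)%C * (k * (f z - f z0) / (z - z0)) - - ((r%:C)%C * (k * f z0)) / (z - z0) =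
  (r%:C)%C * k * f z / (z - z0) by field.
rewrite !cabsM cabsV cabsR gtr0_norm // ler_pdivrMr ?cabs_gt0 //.
have k0 := cabs_ge0 k; have f0 := cabs_ge0 (f z).
rewrite [leLHS]mulrC ler_wpM2l // (le_trans _ rz) // ler_piMr //; exact: ltW.
Qed.

(** Dividing the first-order remainder by [(z - z0)^2] leaves a singularity of order
    [o(1 / |z - z0|)], so the contour integral vanishes. After rotation by [unimod l], the term in
    [l] is ['i * cabs l / (z - z0)] and the rest is at most [2 B / r^2] on the boundary. *)
Lemma cauchy_deriv f z0 r l B : 0 < r ->
  (forall z, in_square z0 r z -> cdifferentiable f z) ->
  (forall z, in_square z0 r z -> cabs (f z) <= B) ->
  (forall e : R, 0 < e -> exists d : R, 0 < d /\ forall w, cabs (w - z0) < d ->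
      cabs (f w - f z0 - l * (w - z0)) <= e * cabs (w - z0)) ->
  cabs l <= 4 * B / r.
Proof.
move=> r0 df fB Hl.
pose F z := unimod l * (f z - f z0 - l * (z - z0)) / (z - z0) ^+ 2.
have dz z : cdifferentiable (fun z => z - z0) z.
  by apply: cdiffD; [exact: cdiff_id|exact: cdiff_cst].
have dF z : in_square z0 r z -> z != z0 -> cdifferentiable F z.
  move=> /df dfz zz; apply: cdiffM; first apply: cdiffM; first exact: cdiff_cst.
    apply: cdiffD; first by apply: cdiffD => //; exact: cdiff_cst.
    have -> : (fun w => - (l * (w - z0))) = (fun w => (- l) * (w - z0)).
      by apply/funext => w; rewrite mulNr.
    by apply: cdiffM => //; exact: cdiff_cst.
  apply: cdiffV; first by rewrite expf_neq0 // subr_eq0.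
  exact: cdiffM.
have JF : square_contour F z0 r = 0.
  apply: square_contour_punctured => // e /Hl [d [d0 H]]; exists d; split=> // z zz /H h.
  have zz' : z - z0 != 0 by rewrite subr_eq0.
  rewrite -(ler_pM2r (cabs_gt0 zz')); apply: le_trans h.
  rewrite -!cabsM /F -mulrA -expr2 divfK ?expf_neq0 // cabsM.
  by rewrite ler_piMl ?cabs_ge0 ?cabs_unimod.
have B0 : 0 <= B.
  by apply: le_trans (cabs_ge0 (f z0)) (fB _ _); split; rewrite subrr normr0 ltW.
have key := @cauchy_estimate F z0 r (cabs l) (fun=> 2 * B / r ^+ 2) r0 (cabs_ge0 l) dF JF.
have cst_int s t (k : R) : s <= t -> \int[mu]_(x in `[s, t]) k = k * (t - s).
  move=> st; rewrite Rintegral_cst ?measurable_itv //=.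
  by rewrite lebesgue_measure_itv /= lte_fin; case: ltgtP st => // -> _; rewrite subrr.
move: key; rewrite /= !cst_int; [|lra|lra] => key.
have : 4 * cabs l <= 16 * B / r.
  rewrite [leRHS](_ : _ = (2 * B / r ^+ 2 + 2 * B / r ^+ 2) * (complex.Re z0 + r - (complex.Re z0 - r)) +
    (2 * B / r ^+ 2 + 2 * B / r ^+ 2) * (complex.Im z0 + r - (complex.Im z0 - r))); last first.
    by field; exact: lt0r_neq0.
  apply: key => [x _|y _|z zb]; [exact: cvg_cst|exact: cvg_cst|].
  have rz := boundary_square_ge r0 zb; have zz := boundary_square_neq r0 zb.
  have zz' : z - z0 != 0 by rewrite subr_eq0.
  have -> : (0 +i* cabs l)%C = - (unimod l * l) :> R[i].
    by rewrite unimodM; apply/eqP; rewrite eq_complex /=; apply/andP; split; apply/eqP; ring.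
  have -> : F z - - (unimod l * l) / (z - z0) = unimod l * (f z - f z0) / (z - z0) ^+ 2.
    by rewrite /F; field.
  have [/in_squareE zs _] := zb.
  rewrite cabsM cabsV cabsX [cabs (unimod l * _)]cabsM ler_pM ?mulr_ge0 ?invr_ge0 ?exprn_ge0 ?cabs_ge0 //; last first.
    by rewrite lef_pV2 ?posrE ?exprn_gt0 ?cabs_gt0 // lerXn2r ?nnegrE ?cabs_ge0 // ltW.
  apply: le_trans (_ : cabs (f z - f z0) <= _); first by rewrite ler_piMl ?cabs_ge0 ?cabs_unimod.
  apply: le_trans (cabsB _ _) _.
  have := fB _ zs; have : cabs (f z0) <= B by apply: fB; split; rewrite subrr normr0 ltW.
  lra.
rewrite (_ : 16 * B / r = 4 * (4 * B / r)); last by ring.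
by rewrite ler_pM2l.
Qed.

End CauchyEstimates.

(** * Measurability in the plane; translation and reflection of integrals on the line *)

Section PlaneMeasurability.
Variable R : realType.
Notation mu := (@lebesgue_measure R).

Definition cont_at (g : R * R -> R) (p : R * R) := forall e : R, 0 < e ->
  exists d : R, 0 < d /\ forall q : R * R,
    `|q.1 - p.1| < d -> `|q.2 - p.2| < d -> `|g q - g p| <= e.

Lemma measurable_floor_fiber (n : R) (i : int) : 0 < n ->
  measurable [set x : R | Num.floor (n * x) = i].
Proof.
move=> n0; rewrite (_ : mkset _ = `[i%:~R / n, (i + 1)%:~R / n[%classic) //.
apply/seteqP; split=> x /=; rewrite in_itv /= ler_pdivrMr // ltr_pdivlMr // [x * n]mulrC.
  by move=> <-; rewrite floor_le_tmp floorD1_gt.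
by move=> h; apply/eqP; rewrite floor_eq.
Qed.

Lemma measurable_floor_fun (n : R) (G : int -> int -> R) : 0 < n ->
  measurable_fun setT (fun p : R * R => G (Num.floor (n * p.1)) (Num.floor (n * p.2))).
Proof.
move=> n0 _ B mB; rewrite setTI.
rewrite (_ : _ @^-1` B = \bigcup_(ij : int * int)
   if `[< B (G ij.1 ij.2) >] then [set x : R | Num.floor (n * x) = ij.1] `*` [set x : R | Num.floor (n * x) = ij.2] else set0).
  apply: countable_bigcupT_measurable => // -[i j] /=; case: ifP => // _.
  by apply: measurableX; exact: measurable_floor_fiber.
apply/seteqP; split=> [p /= Bp|p [[i j] _ /=]].
  exists (Num.floor (n * p.1), Num.floor (n * p.2)) => //=.
  by case: asboolP.
by case: asboolP => // Bij [/= h1 h2]; rewrite h1 h2.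
Qed.

Lemma floor_grid_dist (n x : R) : 0 < n ->
  `|(Num.floor (n * x))%:~R / n - x| < n^-1.
Proof.
move=> n0; have h1 := floor_le (n * x); have h2 := floorD1_gt (n * x).
rewrite intrD in h2; have nx : x = n * x / n by rewrite mulrAC divff ?mul1r // gt_eqF.
rewrite [X in _ - X]nx -mulrBl normrM [`|n^-1|]gtr0_norm ?invr_gt0 //.
rewrite -[ltRHS]mul1r ltr_pM2r ?invr_gt0 // distrC ger0_norm ?subr_ge0 //.
by rewrite ltrBlDl.
Qed.

(* The product sigma-algebra is not the Borel one by construction: [g] is the
   pointwise limit of the functions frozen on the cells of a square grid. *)
Lemma measurable_cont (D : set (R * R)) (g : R * R -> R) :
  measurable D -> (forall p, D p -> cont_at g p) -> measurable_fun D g.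
Proof.
move=> mD cg.
pose h m (p : R * R) := g ((Num.floor (m.+1%:R * p.1))%:~R / m.+1%:R,
                           (Num.floor (m.+1%:R * p.2))%:~R / m.+1%:R).
apply: (@measurable_fun_cvg _ _ _ _ h) => // [m|p Dp].
  apply: measurable_funTS.
  exact: (@measurable_floor_fun m.+1%:R (fun i j => g (i%:~R / m.+1%:R, j%:~R / m.+1%:R))).
apply/cvgrPdist_le => e e0; have [d [d0 H]] := cg p Dp e e0.
near=> m; rewrite distrC; apply: H => /=;
  apply: lt_le_trans (floor_grid_dist _ _) _ => //;
  rewrite ltW //; near: m; exact: (near_infty_natSinv_lt (PosNum d0)).
Unshelve. all: by end_near. Qed.

Lemma ccont_cont_at (f : R[i] -> R[i]) (p : R * R) : ccont f (toC p) ->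
  [/\ cont_at (fun q => complex.Re (f (toC q))) p, cont_at (fun q => complex.Im (f (toC q))) p &
   cont_at (fun q => cabs (f (toC q))) p].
Proof.
move=> cf; have H e : 0 < e -> exists d : R, 0 < d /\ forall q : R * R,
    `|q.1 - p.1| < d -> `|q.2 - p.2| < d -> cabs (f (toC q) - f (toC p)) <= e.
  move=> /cf[d [d0 H]]; exists (d / 2); split=> [|q h1 h2]; first by rewrite divr_gt0.
  by apply: H; apply: le_lt_trans (cabs_le_sum _) _; rewrite /toC !raddfB /=; lra.
split=> e /H [d [d0 {}H]]; exists d; split=> // q h1 h2; apply: le_trans (H q h1 h2).
- by rewrite -raddfB Re_le_cabs.
- by rewrite -raddfB Im_le_cabs.
- exact: cabs_dist.
Qed.

Lemma measurable_cabs : measurable_fun [set: R * R] (fun p => cabs (toC p)).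
Proof.
apply: measurable_cont => // p _; have [_ _] := @ccont_cont_at id p (ccont_id _).
exact.
Qed.

Lemma measurable_disk : measurable (@disk R).
Proof.
rewrite (_ : disk = setT `&` (fun p => cabs (toC p)) @^-1` `]-oo, 1[%classic).
  by apply: measurable_cabs => //; exact: measurable_itv.
by rewrite setTI; apply/seteqP; split=> p /=; rewrite in_itv.
Qed.

Lemma analytic_measurable (f : R[i] -> R[i]) : analytic_on_disk f ->
  [/\ measurable_fun disk (fun p => complex.Re (f (toC p))),
      measurable_fun disk (fun p => complex.Im (f (toC p))) &
      measurable_fun disk (fun p => cabs (f (toC p)))].
Proof.
move=> af; split; apply: measurable_cont => [|p Dp]; try exact: measurable_disk;
by have [] := ccont_cont_at (cdiff_ccont (af _ Dp)).
Qed.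

Lemma measurable_cabs_comp (g : R[i] -> R[i]) :
  measurable_fun disk (fun p => complex.Re (g (toC p))) ->
  measurable_fun disk (fun p => complex.Im (g (toC p))) ->
  measurable_fun disk (fun p => cabs (g (toC p))).
Proof.
move=> m1 m2; apply: (@measurableT_comp _ _ _ _ _ _ (@Num.sqrt R) disk (fun p => complex.Re (g (toC p)) ^+ 2 + complex.Im (g (toC p)) ^+ 2)).
  by apply: continuous_measurable_fun; exact: sqrt_continuous.
by apply: measurable_funD; apply: measurable_funX.
Qed.

(* [Psi] is arbitrary on the negative axis. *)
Lemma measurable_Psi (Psi : R -> R) d (T : measurableType d) (D : set T) (g : T -> R) :
  orlicz Psi -> (forall x, D x -> 0 <= g x) -> measurable D ->
  measurable_fun D g -> measurable_fun D (fun x => Psi (g x)).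
Proof.
move=> [P0 Ppos Pmon _ _] g0 mD mg.
apply: (eq_measurable_fun ((fun x => Psi (Num.max x 0)) \o g)).
  by move=> x /set_mem /g0 ge0 /=; rewrite max_l.
apply: measurableT_comp => //; apply: nondecreasing_measurable => // x y xy.
by apply: Pmon; [rewrite le_max lexx orbT|rewrite ge_max !le_max xy lexx orbT].
Qed.

Lemma lebesgue_measure_translate (a : R) (A : set R) : measurable A ->
  pushforward mu (+%R a : _ -> measurableTypeR R) A = mu A.
Proof.
move=> mA; have mt : @measurable_fun _ _ (measurableTypeR R) (measurableTypeR R) setT (+%R a).
  exact: measurable_funD.
apply/esym/lebesgue_measure_unique => //= _ [[x y]] _ <-.
rewrite /pushforward (_ : _ @^-1` _ = `]x - a, y - a]%classic); last first.
  by apply/seteqP; split=> t /=; rewrite !in_itv /= ltrBlDl lerBrDl.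
rewrite !lebesgue_measure_itv /= !lte_fin ltrD2r -!EFinB.
by rewrite opprD addrACA opprK addNr addr0.
Qed.

Lemma ge0_integral_translate (a : R) (g : R -> \bar R) :
  measurable_fun setT g -> (forall x, 0 <= g x)%E ->
  (\int[mu]_x g (a + x)%R = \int[mu]_x g x)%E.
Proof.
move=> mg g0; have mt : @measurable_fun _ _ (measurableTypeR R) (measurableTypeR R) setT (+%R a).
  exact: measurable_funD.
have E := @ge0_integral_pushforward _ _ _ _ _ _ mt mu setT g measurableT mg (fun y _ => g0 y).
apply: eq_trans (esym E) _.
by apply: eq_measure_integral => A mA _; exact: lebesgue_measure_translate.
Qed.

Lemma ge0_integral_reflect (a : R) (g : R -> \bar R) :
  measurable_fun setT g -> (forall x, 0 <= g x)%E ->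
  (\int[mu]_x g (a - x)%R = \int[mu]_x g x)%E.
Proof.
move=> mg g0; rewrite -[RHS](ge0_integral_translate a) //.
have mt : @measurable_fun _ _ (measurableTypeR R) (measurableTypeR R) setT -%R by exact: oppr_measurable.
have mg' : measurable_fun setT (fun x => g (a + x)).
  by apply: (measurableT_comp mg); exact: measurable_funD.
have E := @ge0_integral_pushforward _ _ _ _ _ _ mt mu setT (fun x => g (a + x)) measurableT mg' (fun y _ => g0 _).
apply: eq_trans (esym E) _.
by apply: eq_measure_integral => A mA _; exact: lebesgue_measureN.
Qed.

End PlaneMeasurability.

(** * From contour bounds to area bounds *)

Section AreaEstimate.
Variable R : realType.
Notation mu := (@lebesgue_measure R).
Local Open Scope ereal_scope.

Definition sq (p : R * R) (t : R) : set (R * R) := [set q | (`|q.1 - p.1| <= t)%R /\ (`|q.2 - p.2| <= t)%R].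

Lemma sqE p t : sq p t = `[(p.1 - t)%R, (p.1 + t)%R]%classic `*` `[(p.2 - t)%R, (p.2 + t)%R]%classic.
Proof.
by apply/seteqP; split=> q; rewrite /sq /= !in_itv /= !ler_distl.
Qed.

Lemma measurable_sq p t : measurable (sq p t).
Proof. by rewrite sqE; apply: measurableX; exact: measurable_itv. Qed.

Lemma leb2_sq p t : (0 < t)%R -> leb2 (sq p t) = (4 * t ^+ 2)%:E.
Proof.
move=> t0; have E (a : R) : mu `[(a - t)%R, (a + t)%R] = (2 * t)%:E.
  rewrite lebesgue_measure_itv /= lte_fin (_ : a - t < a + t)%R; last by lra.
  by rewrite -EFinB; congr (_%:E); ring.
rewrite sqE; apply: eq_trans (product_measure1E _ _ _ _) _; try exact: measurable_itv.
apply: eq_trans (f_equal2 mule (E p.1) (E p.2)) _.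
by rewrite -EFinM; congr (_%:E); ring.
Qed.

Lemma measurable_funE d (T : measurableType d) (D : set T) (g : T -> R) :
  measurable_fun D g -> measurable_fun D (fun x => (g x)%:E).
Proof. by move=> mg; apply/measurable_EFinP. Qed.

Lemma EFin_Rintegral_cont (h : R -> R) (a b : R) :
  (forall x, (a <= x <= b)%R -> {for x, continuous h}) ->
  (\int[mu]_(x in `[a, b]) h x)%:E = \int[mu]_(x in `[a, b]) (h x)%:E.
Proof.
move=> ch; rewrite fineK //; apply: integrable_fin_num => //.
exact: integrable_itv_cont.
Qed.

(** [cauchy_value] is integrated over the half side [r] in [[t / 2, t]]. There [4 r >= 2 t] and the
    length is [t / 2], which gives [t ^+ 2] on the left; each of the four sides sweeps part of the
    square and contributes at most its area integral. *)
Lemma area_estimate (f : R[i] -> R[i]) (p : R * R) (t : R) : (0 < t)%R ->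
  (forall q, sq p t q -> cdifferentiable f (toC q)) ->
  (t ^+ 2 * cabs (f (toC p)))%:E <= 4%:E * \int[leb2]_(q in sq p t) (cabs (f (toC q)))%:E.
Proof.
case: p => x0 y0 t0 df.
(* Extension by zero lets slice integrals run over whole lines, where translation and reflection in
   [r] change nothing. *)
pose G := (fun q => (cabs (f (toC q)))%:E) \_ (sq (x0, y0) t).
have mG : measurable_fun setT G.
  apply/(@measurable_restrictT _ _ _ _ _ (fun q => (cabs (f (toC q)))%:E) (measurable_sq (x0, y0) t)).
  apply: measurable_funE; apply: measurable_cont; first exact: measurable_sq.
  by move=> q /df/cdiff_ccont/ccont_cont_at[].
have G0 q : 0 <= G q by rewrite /G patchE; case: ifP => // _; rewrite lee_fin cabs_ge0.
have GE q : sq (x0, y0) t q -> G q = (cabs (f (toC q)))%:E by move=> h; rewrite /G patchE mem_set.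
set S := \int[leb2]_(q in _) _.
have SE : S = \int[leb2]_q G q by rewrite /S integral_mkcond.
pose A1 y := \int[mu]_x G (x, y); pose A2 x := \int[mu]_y G (x, y).
have SA1 : \int[mu]_y A1 y = S by rewrite SE; exact: (esym (@fubini_tonelli2 _ _ (measurableTypeR R) (measurableTypeR R) R mu mu G mG G0)).
have SA2 : \int[mu]_x A2 x = S by rewrite SE; exact: (esym (@fubini_tonelli1 _ _ (measurableTypeR R) (measurableTypeR R) R mu mu G mG G0)).
have mA1 : measurable_fun setT A1 by exact: (@measurable_fun_fubini_tonelli_G _ _ (measurableTypeR R) (measurableTypeR R) R mu G mG G0).
have mA2 : measurable_fun setT A2 by exact: (@measurable_fun_fubini_tonelli_F _ _ (measurableTypeR R) (measurableTypeR R) R mu G mG G0).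
have A10 y : 0 <= A1 y by apply: integral_ge0.
have A20 x : 0 <= A2 x by apply: integral_ge0.
have mG1 y : measurable_fun setT (fun x => G (x, y)) by apply: (measurableT_comp mG); exact: pair2_measurable.
have mG2 x : measurable_fun setT (fun y => G (x, y)) by apply: (measurableT_comp mG); exact: pair1_measurable.
have df' r : (0 < r <= t)%R -> forall z, in_square (x0 +i* y0)%C r z -> cdifferentiable f z.
  move=> /andP[r0 rt] [x y] [/= h1 h2]; apply: (df (x, y)); rewrite /sq /=; split; exact: le_trans rt.
have cabs_cont q : sq (x0, y0) t q -> ccont (fun w => ((cabs (f w))%:C)%C) (toC q).
  move=> /df/cdiff_ccont cf e /cf[d [d0 H]]; exists d; split=> // w /H.
  by rewrite -rmorphB /= cabsR; apply: le_trans; exact: cabs_dist.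
have H1 r y : (0 < r <= t)%R -> (`|y - y0| <= t)%R ->
   [/\ (forall x, (x0 - r <= x <= x0 + r)%R -> {for x, continuous (fun x => cabs (f (x +i* y)%C))}) &
   \int[mu]_(x in `[(x0 - r)%R, (x0 + r)%R]) (cabs (f (x +i* y)%C))%:E <= A1 y].
  move=> /andP[r0 rt] yt.
  have inS x : (x0 - r <= x <= x0 + r)%R -> sq (x0, y0) t (x, y).
    by rewrite -ler_distl => h; split=> //=; exact: le_trans rt.
  split=> [x /inS xi|].
    have [] // := @ccont_path _ (fun w => ((cabs (f w))%:C)%C) (fun s => (s +i* y)%C) x.
      by move=> s; exact: cabs_hline.
    exact: (cabs_cont _ xi).
  apply: (@le_trans _ _ (\int[mu]_(x in `[(x0 - r)%R, (x0 + r)%R]) G (x, y))).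
    rewrite le_eqVlt; apply/orP; left; apply/eqP; apply: eq_integral => x.
    by rewrite inE /= in_itv /= => /inS/GE ->.
  apply: (@ge0_subset_integral _ (measurableTypeR R) R mu _ setT) => //; exact: mG1.
have H2 r x : (0 < r <= t)%R -> (`|x - x0| <= t)%R ->
   [/\ (forall y, (y0 - r <= y <= y0 + r)%R -> {for y, continuous (fun y => cabs (f (x +i* y)%C))}) &
   \int[mu]_(y in `[(y0 - r)%R, (y0 + r)%R]) (cabs (f (x +i* y)%C))%:E <= A2 x].
  move=> /andP[r0 rt] yt.
  have inS y : (y0 - r <= y <= y0 + r)%R -> sq (x0, y0) t (x, y).
    by rewrite -ler_distl => h; split=> //=; exact: le_trans rt.
  split=> [y /inS xi|].
    have [] // := @ccont_path _ (fun w => ((cabs (f w))%:C)%C) (fun s => (x +i* s)%C) y.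
      by move=> s; exact: cabs_vline.
    exact: (cabs_cont _ xi).
  apply: (@le_trans _ _ (\int[mu]_(y in `[(y0 - r)%R, (y0 + r)%R]) G (x, y))).
    rewrite le_eqVlt; apply/orP; left; apply/eqP; apply: eq_integral => y.
    by rewrite inE /= in_itv /= => /inS/GE ->.
  apply: (@ge0_subset_integral _ (measurableTypeR R) R mu _ setT) => //; exact: mG2.
have key r : (0 < r <= t)%R -> (4 * r * cabs (f (x0 +i* y0)%C))%:E <=
    (A1 (y0 - r)%R + A1 (y0 + r)%R) + (A2 (x0 - r)%R + A2 (x0 + r)%R).
  move=> rt; have /andP[r0 rt'] := rt.
  have := cauchy_value r0 (df' r rt); rewrite -lee_fin => /le_trans; apply.
  have a1 : (`|y0 - r - y0| <= t)%R by rewrite addrAC subrr add0r normrN gtr0_norm.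
  have a2 : (`|y0 + r - y0| <= t)%R by rewrite addrAC subrr add0r gtr0_norm.
  have a3 : (`|x0 - r - x0| <= t)%R by rewrite addrAC subrr add0r normrN gtr0_norm.
  have a4 : (`|x0 + r - x0| <= t)%R by rewrite addrAC subrr add0r gtr0_norm.
  have [c1 b1] := H1 r _ rt a1; have [c2 b2] := H1 r _ rt a2.
  have [c3 b3] := H2 r _ rt a3; have [c4 b4] := H2 r _ rt a4.
  have ii (h : R -> R) (a b : R) : (forall x, (a <= x <= b)%R -> {for x, continuous h}) ->
      measurable_fun `[a, b] (fun x => (h x)%:E).
    by move=> ch; have /integrableP[] := integrable_itv_cont ch.
  rewrite EFinD !EFin_Rintegral_cont; first last.
  - by move=> x hx; apply: cvgD; [exact: c1|exact: c2].
  - by move=> x hx; apply: cvgD; [exact: c3|exact: c4].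
  under eq_integral do rewrite EFinD.
  under [X in _ + X <= _]eq_integral do rewrite EFinD.
  rewrite !ge0_integralD //; try (by move=> *; rewrite lee_fin cabs_ge0); try exact: ii.
  by apply: leeD; apply: leeD.
rewrite /toC /=; set v := cabs _ in key *.
have v0 : (0 <= v)%R := cabs_ge0 _.
have mI : measurable (`[(t / 2)%R, t]%classic : set R) by exact: measurable_itv.
have step : (t ^+ 2 * v)%:E <= \int[mu]_(r in `[(t / 2)%R, t])
   ((A1 (y0 - r)%R + A1 (y0 + r)%R) + (A2 (x0 - r)%R + A2 (x0 + r)%R)).
  have -> : (t ^+ 2 * v)%:E = \int[mu]_(r in `[(t / 2)%R, t]) (cst (2 * t * v)%:E r).
    apply: (@eq_trans _ _ ((2 * t * v)%:E * mu `[(t / 2)%R, t])); last first.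
      by symmetry; exact: integral_cst.
    rewrite lebesgue_measure_itv /= lte_fin (_ : t / 2 < t)%R; last by lra.
    by rewrite -EFinB -EFinM; congr (_%:E); field.
  apply: (@ge0_le_integral _ (measurableTypeR R) R mu) => //.
  - by move=> r _; rewrite lee_fin !mulr_ge0 // ltW.
  - by apply: measurable_funTS; apply: emeasurable_funD; apply: emeasurable_funD;
      apply: measurableT_comp => //; [exact: measurable_funB|exact: measurable_funD|exact: measurable_funB|exact: measurable_funD].
  - move=> r; rewrite /= in_itv /= => /andP[r1 r2].
    have rt : (0 < r <= t)%R by apply/andP; split; lra.
    apply: le_trans (key r rt); rewrite lee_fin ler_wpM2r //; lra.
apply: le_trans step _.
have mB (g : R -> \bar R) (a : R) : measurable_fun setT g -> measurable_fun setT (fun r : R => g (a - r)%R).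
  by move=> mg; apply: (measurableT_comp mg); exact: measurable_funB.
have mD (g : R -> \bar R) (a : R) : measurable_fun setT g -> measurable_fun setT (fun r : R => g (a + r)%R).
  by move=> mg; apply: (measurableT_comp mg); exact: measurable_funD.
have E1 : \int[mu]_r A1 (y0 - r)%R = S by rewrite ge0_integral_reflect.
have E2 : \int[mu]_r A1 (y0 + r)%R = S by rewrite ge0_integral_translate.
have E3 : \int[mu]_r A2 (x0 - r)%R = S by rewrite ge0_integral_reflect.
have E4 : \int[mu]_r A2 (x0 + r)%R = S by rewrite ge0_integral_translate.
have m1 := mB _ y0 mA1; have m2 := mD _ y0 mA1.
have m3 := mB _ x0 mA2; have m4 := mD _ x0 mA2.
have p1 r : 0 <= A1 (y0 - r)%R := A10 _.
have p2 r : 0 <= A1 (y0 + r)%R := A10 _.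
have p3 r : 0 <= A2 (x0 - r)%R := A20 _.
have p4 r : 0 <= A2 (x0 + r)%R := A20 _.
suff gen (B1 B2 B3 B4 : R -> \bar R) :
    measurable_fun setT B1 -> measurable_fun setT B2 ->
    measurable_fun setT B3 -> measurable_fun setT B4 ->
    (forall r, 0 <= B1 r) -> (forall r, 0 <= B2 r) ->
    (forall r, 0 <= B3 r) -> (forall r, 0 <= B4 r) ->
    \int[mu]_r B1 r = S -> \int[mu]_r B2 r = S ->
    \int[mu]_r B3 r = S -> \int[mu]_r B4 r = S ->
    \int[mu]_(r in `[(t / 2)%R, t]) ((B1 r + B2 r) + (B3 r + B4 r)) <= 4%:E * S.
  exact: (gen _ _ _ _ m1 m2 m3 m4 p1 p2 p3 p4 E1 E2 E3 E4).
move=> {m1 m2 m3 m4 p1 p2 p3 p4 E1 E2 E3 E4} m1 m2 m3 m4 p1 p2 p3 p4 E1 E2 E3 E4.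
have m12 : measurable_fun setT (fun r => B1 r + B2 r) by exact: emeasurable_funD.
have m34 : measurable_fun setT (fun r => B3 r + B4 r) by exact: emeasurable_funD.
have p12 r : 0 <= B1 r + B2 r by exact: adde_ge0.
have p34 r : 0 <= B3 r + B4 r by exact: adde_ge0.
apply: (@le_trans _ _ (\int[mu]_r ((B1 r + B2 r) + (B3 r + B4 r)))).
  apply: (@ge0_subset_integral _ (measurableTypeR R) R mu _ setT) => //.
  - exact: emeasurable_funD.
  - by move=> r _; exact: adde_ge0.
rewrite ge0_integralD // !ge0_integralD // E1 E2 E3 E4.
have S0 : 0 <= S by rewrite -SA1; apply: integral_ge0.
rewrite (_ : 4 = 1 + 1 + (1 + 1))%R; last by ring.
by rewrite !EFinD !ge0_muleDl ?adde_ge0 ?lee_fin // !mul1e.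
Qed.

End AreaEstimate.

(** * Supporting lines and Jensen's inequality *)

Section Jensen.
Variable R : realType.

Lemma orlicz_ge0 (Psi : R -> R) x : orlicz Psi -> 0 <= x -> 0 <= Psi x.
Proof. by move=> [P0 _ Pm _ _] x0; rewrite -P0 Pm. Qed.

(** The slope is the supremum of the slopes of chords arriving at [s] from the left, which by
    convexity is at most that of any chord leaving to the right. At [s = 0] there is no chord on the
    left, and the slope 0 serves since [Psi >= 0]. *)
Lemma orlicz_support (Psi : R -> R) s : orlicz Psi -> 0 <= s ->
  exists k, 0 <= k /\ forall x, 0 <= x -> Psi s + k * (x - s) <= Psi x.
Proof.
move=> oP; have [P0 Pp Pm Pc _] := oP; rewrite le_eqVlt => /predU1P[<-|s0].
  by exists 0; split=> // x x0; rewrite P0 mul0r addr0 orlicz_ge0.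
pose E := [set (Psi s - Psi x) / (s - x) | x in `[0, s[%classic].
have ub y : s < y -> ubound E ((Psi y - Psi s) / (y - s)).
  move=> sy _ [x /= ] /[swap] <-; rewrite in_itv /= => /andP[x0 xs].
  have sx0 : 0 < s - x by lra.
  have sy0 : 0 < y - s by lra.
  have yx0 : 0 < y - x by lra.
  rewrite ler_pdivrMr // mulrAC ler_pdivlMr //.
  pose t := (y - s) / (y - x).
  have t01 : 0 <= t <= 1.
    by rewrite /t divr_ge0 ?(ltW sy0) ?(ltW yx0) //= ler_pdivrMr //; lra.
  have y0 : 0 <= y by lra.
  have := Pc x y t x0 y0 t01.
  have -> : t * x + (1 - t) * y = s by rewrite /t; field; rewrite gt_eqF.
  have -> : t * Psi x + (1 - t) * Psi y = ((y - s) * Psi x + (s - x) * Psi y) / (y - x).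
    by rewrite /t; field; rewrite gt_eqF.
  by rewrite ler_pdivlMr //; nra.
have E0 : E (Psi s / s).
  by exists 0; rewrite /= ?in_itv /= ?lexx ?s0 // P0 !subr0.
have hE : has_sup E by split; [exists (Psi s / s)|exists ((Psi (s + 1) - Psi s) / (s + 1 - s)); apply: ub; lra].
exists (sup E); split.
  apply: le_trans (ub_le_sup hE.2 E0); rewrite divr_ge0 ?(ltW s0) //.
  by rewrite orlicz_ge0 // ltW.
move=> x x0; have [xs|sx|->] := ltgtP x s; last by rewrite subrr mulr0 addr0.
  have : (Psi s - Psi x) / (s - x) <= sup E.
    by apply: (ub_le_sup hE.2); exists x => //=; rewrite in_itv /= x0.
  rewrite ler_pdivrMr; last lra.
  move: (sup E) => k; lra.
have : sup E <= (Psi x - Psi s) / (x - s) by apply: (ge_sup hE.1); exact: ub.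
rewrite ler_pdivlMr; last lra.
move: (sup E) => k; lra.
Qed.

(** Jensen's inequality through a supporting line. The square has area [4 t^2], so [area_estimate]
    bounds [cabs (f (toC p))] by 16 times the mean of [cabs f]: this is the 16 inside [Psi]. *)
Lemma orlicz_area (Psi : R -> R) (f : R[i] -> R[i]) (p : R * R) (t C : R) :
  orlicz Psi -> 0 < t -> 0 < C ->
  (forall q, sq p t q -> cdifferentiable f (toC q)) ->
  ((4 * t ^+ 2 * Psi (cabs (f (toC p)) / (16 * C)))%:E <=
    \int[leb2]_(q in sq p t) (Psi (cabs (f (toC q)) / C))%:E)%E.
Proof.
move=> oP t0 C0 df.
have mf : measurable_fun (sq p t) (fun q => cabs (f (toC q)) / C).
  apply: measurable_funM => //; apply: measurable_cont; first exact: measurable_sq.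
  by move=> q /df/cdiff_ccont/ccont_cont_at[].
have fC0 q : 0 <= cabs (f (toC q)) / C by rewrite divr_ge0 ?cabs_ge0 // ltW.
have mP : measurable_fun (sq p t) (fun q => Psi (cabs (f (toC q)) / C)).
  by apply: measurable_Psi => //; exact: measurable_sq.
have ms := measurable_sq p t.
set s := cabs (f (toC p)) / (16 * C).
have s0 : 0 <= s by rewrite divr_ge0 ?cabs_ge0 // mulr_ge0 // ltW.
have [k [k0 Hk]] := orlicz_support oP s0.
have A := area_estimate t0 df.
set I := (\int[leb2]_(q in _) _)%E.
have ks0 : 0 <= k * s by rewrite mulr_ge0.
have Ps0 : 0 <= Psi s by rewrite orlicz_ge0.
have cstE (c : R) : (\int[leb2]_(q in sq p t) c%:E = (c * (4 * t ^+ 2))%:E)%E.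
  transitivity (c%:E * leb2 (sq p t))%E; first exact: integral_cst.
  by rewrite leb2_sq.
have mf1 : measurable_fun (sq p t) (fun q => cabs (f (toC q))).
  by apply: measurable_cont => // q /df/cdiff_ccont/ccont_cont_at[].
have m1 : measurable_fun (sq p t) (fun q => (cabs (f (toC q)))%:E) := measurable_funE mf1.
have m2 : measurable_fun (sq p t) (fun q => (k / C)%:E * (cabs (f (toC q)))%:E)%E.
  by apply: measurable_funE; exact: measurable_funM.
have m3 : measurable_fun (sq p t) (fun q => (Psi (cabs (f (toC q)) / C))%:E) := measurable_funE mP.
have kC : 0 <= k / C by rewrite divr_ge0 // ltW.
have p2 q : sq p t q -> (0 <= (k / C)%:E * (cabs (f (toC q)))%:E)%E.
  by move=> _; rewrite lee_fin mulr_ge0 ?cabs_ge0.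
have p3 q : sq p t q -> (0 <= (Psi (cabs (f (toC q)) / C))%:E)%E.
  by move=> _; rewrite lee_fin orlicz_ge0.
(* The term [- k s] is moved to the right so that only nonnegative functions are integrated; the
   area bound then lets this finite quantity cancel. *)
have : ((Psi s * (4 * t ^+ 2))%:E + (k / C)%:E * \int[leb2]_(q in sq p t) (cabs (f (toC q)))%:E <=
   I + (k * s * (4 * t ^+ 2))%:E)%E.
  rewrite -!cstE -ge0_integralZl_EFin //; last by move=> q _; rewrite lee_fin cabs_ge0.
  rewrite /I -!ge0_integralD //.
  apply: ge0_le_integral => //.
  - by move=> q h; rewrite adde_ge0 // ?p2.
  - by apply: emeasurable_funD.
  - by apply: emeasurable_funD.
  - move=> q _; rewrite -EFinM -!EFinD lee_fin.
    have := Hk _ (fC0 q); rewrite mulrAC -mulrA; lra.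
move: A; set S := (\int[leb2]_(q in _) (cabs _)%:E)%E => A.
have S0 : (0 <= S)%E by apply: integral_ge0 => q _; rewrite lee_fin cabs_ge0.
have I0 : (0 <= I)%E by apply: integral_ge0 => q _; rewrite lee_fin orlicz_ge0.
have B : ((k * s * (4 * t ^+ 2))%:E <= (k / C)%:E * S)%E.
  have -> : k * s * (4 * t ^+ 2) = (k / C / 4) * (t ^+ 2 * cabs (f (toC p))).
    by rewrite /s; field; rewrite gt_eqF.
  rewrite EFinM; apply: le_trans (lee_wpmul2l _ A) _; first by rewrite lee_fin divr_ge0.
  rewrite muleA -EFinM [k / C / 4 * 4]divfK ?pnatr_eq0 //.
move=> H; have {}H := le_trans (leeD (lexx _) B) H.
by move: H; rewrite leeD2rE // [4 * _ * Psi s]mulrC.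
Qed.

End Jensen.

(** * Plane area as a measure on [R * R] *)

Section PlaneMeasure.
Variable R : realType.

(* [leb2] lives on the product of two copies of the sigma-algebra generated by
   intervals, whose display differs from the one of [R * R]. *)
Definition plane_measure : set (R * R) -> \bar R := leb2.

Let plane0 : plane_measure set0 = 0%E.
Proof. exact: (measure0 (lebesgue_measure \x lebesgue_measure)%E). Qed.

Let plane_ge0 A : (0 <= plane_measure A)%E.
Proof. exact: (measure_ge0 (lebesgue_measure \x lebesgue_measure)%E). Qed.

Let plane_sigma : semi_sigma_additive plane_measure.
Proof. exact: (@measure_semi_sigma_additive _ _ _ (lebesgue_measure \x lebesgue_measure)%E). Qed.

HB.instance Definition _ := isMeasure.Build _ (R * R)%type R plane_measure
  plane0 plane_ge0 plane_sigma.

Let plane_sigma_finite : sigma_finite setT plane_measure.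
Proof.
exists (fun n => sq (0, 0) n.+1%:R).
  apply/esym/seteqP; split=> // p _; pose x := Num.max `|p.1| `|p.2|.
  have x0 : 0 <= x by rewrite le_max normr_ge0.
  have : x < (Num.bound x).+1%:R.
    by apply: lt_trans (archi_boundP x0) _; rewrite ltr_nat.
  rewrite gt_max => /andP[h1 h2].
  by exists (Num.bound x) => //; split; rewrite /= subr0 ltW.
move=> n; split; first exact: measurable_sq.
by rewrite /plane_measure leb2_sq // ltry.
Qed.

HB.instance Definition _ := Measure_isSigmaFinite.Build _ (R * R)%type R plane_measure
  plane_sigma_finite.

Lemma integral_plane (D : set (R * R)) (f : R * R -> \bar R) : measurable D ->
  measurable_fun D f -> (forall p, D p -> (0 <= f p)%E) ->
  (\int[leb2]_(p in D) f p)%E = (\int[plane_measure]_(p in D) f p)%E.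
Proof.
move=> mD mf f0; symmetry.
have mid : @measurable_fun _ _ (measurableTypeR R * measurableTypeR R)%type (R * R)%type
  setT idfun by move=> _ B mB; rewrite setTI.
have E := @ge0_integral_pushforward _ _ _ _ _ _ mid (lebesgue_measure \x lebesgue_measure)%E D f mD mf
  (fun p Dp => f0 p (set_mem Dp)).
exact: eq_trans (eq_measure_integral _ (fun A _ _ => erefl)) E.
Qed.

Lemma orlicz_plane (Psi : R -> R) (f : R[i] -> R[i]) (p : R * R) (t C : R) :
  orlicz Psi -> 0 < t -> 0 < C ->
  (forall q, sq p t q -> cdifferentiable f (toC q)) ->
  ((4 * t ^+ 2 * Psi (cabs (f (toC p)) / (16 * C)))%:E <=
    \int[plane_measure]_(q in sq p t) (Psi (cabs (f (toC q)) / C))%:E)%E.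
Proof.
move=> oP t0 C0 df; rewrite -integral_plane; first exact: (orlicz_area oP t0 C0 df).
- exact: measurable_sq.
- apply: measurable_funE; apply: measurable_Psi => //.
  + by move=> q _; rewrite divr_ge0 ?cabs_ge0 // ltW.
  + exact: measurable_sq.
  apply: measurable_funM => //; apply: measurable_cont; first exact: measurable_sq.
  by move=> q /df/cdiff_ccont/ccont_cont_at[].
- by move=> q _; rewrite lee_fin orlicz_ge0 // divr_ge0 ?cabs_ge0 // ltW.
Qed.

End PlaneMeasure.

(** * Modulars and Luxemburg norms *)

Section Modular.
Variables (R : realType) (m : {measure set (R * R)%type -> \bar R}) (c : R).
Hypothesis c0 : 0 <= c.
Variable Psi : R -> R.
Hypothesis oP : orlicz Psi.
Implicit Types (f g : R[i] -> R[i]) (C : R).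

Definition mabs f := measurable_fun (@disk R) (fun p => cabs (f (toC p))).

Lemma mabs_Psi f C : mabs f -> 0 < C ->
  measurable_fun disk (fun p => (Psi (cabs (f (toC p)) / C))%:E).
Proof.
move=> mf C0; apply: measurable_funE; apply: measurable_Psi => //.
- by move=> p _; rewrite divr_ge0 ?cabs_ge0 // ltW.
- exact: measurable_disk.
- exact: measurable_funM.
Qed.

Lemma Psi_cabs_ge0 f C p : 0 < C -> 0 <= Psi (cabs (f (toC p)) / C).
Proof. by move=> C0; rewrite orlicz_ge0 // divr_ge0 ?cabs_ge0 // ltW. Qed.

Lemma modular_le f g C C' : mabs f -> mabs g -> 0 < C -> 0 < C' ->
  (forall p, disk p -> cabs (f (toC p)) / C <= cabs (g (toC p)) / C') ->
  (modular m c Psi f C <= modular m c Psi g C')%E.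
Proof.
move=> mf mg C0 C'0 H; apply: lee_wpmul2l; first by rewrite lee_fin.
have md := @measurable_disk R; apply: ge0_le_integral => //.
- by move=> p _; rewrite lee_fin Psi_cabs_ge0.
- exact: mabs_Psi.
- exact: mabs_Psi.
- move=> p Dp; rewrite lee_fin; have [_ _ Pm _ _] := oP; apply: Pm; last exact: H.
  by rewrite divr_ge0 ?cabs_ge0 // ltW.
Qed.

Lemma modular_mono f C C' : mabs f -> 0 < C -> C <= C' ->
  (modular m c Psi f C' <= modular m c Psi f C)%E.
Proof.
move=> mf C0 CC; have C'0 := lt_le_trans C0 CC; apply: modular_le => // p _.
by rewrite ler_wpM2l ?cabs_ge0 // lef_pV2.
Qed.

(** The triangle inequality of the Luxemburg norm: [(x + y) / (C1 + C2)] is the convex combination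
    of [x / C1] and [y / C2] with weight [C1 / (C1 + C2)]. Pointwise domination of [h] serves sums
    and differences alike. *)
Lemma modular_add f g h C1 C2 : mabs f -> mabs g -> mabs h -> 0 < C1 -> 0 < C2 ->
  (forall p, disk p -> cabs (h (toC p)) <= cabs (f (toC p)) + cabs (g (toC p))) ->
  (modular m c Psi f C1 <= 1 -> modular m c Psi g C2 <= 1 ->
   modular m c Psi h (C1 + C2) <= 1)%E.
Proof.
move=> mf mg mh C10 C20 H M1 M2.
have C0 : 0 < C1 + C2 by rewrite addr_gt0.
set t := C1 / (C1 + C2).
have t01 : 0 <= t <= 1.
  apply/andP; split; first by rewrite divr_ge0 // ltW.
  by rewrite ler_pdivrMr // mul1r lerDl ltW.
have /andP[t0 t1] := t01.
have t1' : 0 <= 1 - t by lra.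
have [_ _ Pm Pc _] := oP; have md := @measurable_disk R.
have mF := mabs_Psi mf C10; have mG := mabs_Psi mg C20; have mH := mabs_Psi mh C0.
apply: (@le_trans _ _ (t%:E * modular m c Psi f C1 + (1 - t)%:E * modular m c Psi g C2)%E); last first.
  apply: (@le_trans _ _ (t%:E * 1 + (1 - t)%:E * 1)%E).
    by apply: leeD; apply: lee_wpmul2l; rewrite ?lee_fin.
  by rewrite !mule1 -EFinD addrC subrK.
rewrite /modular !muleA [(t%:E * _)%E]muleC [((1 - t)%:E * _)%E]muleC -!muleA.
have c0' : (0 <= c%:E)%E by rewrite lee_fin.
have f0 p : (0 <= (Psi (cabs (f (toC p)) / C1))%:E)%E by rewrite lee_fin Psi_cabs_ge0.
have g0 p : (0 <= (Psi (cabs (g (toC p)) / C2))%:E)%E by rewrite lee_fin Psi_cabs_ge0.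
rewrite -ge0_muleDr; last 2 first.
- by rewrite mule_ge0 ?lee_fin // integral_ge0.
- by rewrite mule_ge0 ?lee_fin // integral_ge0.
apply: lee_wpmul2l => //.
rewrite -!ge0_integralZl_EFin // -ge0_integralD //; first last.
- by apply: measurable_funeM.
- by move=> p _; rewrite mule_ge0 ?lee_fin ?Psi_cabs_ge0.
- by apply: measurable_funeM.
- by move=> p _; rewrite mule_ge0 ?lee_fin ?Psi_cabs_ge0.
apply: ge0_le_integral => //.
- by move=> p _; rewrite lee_fin Psi_cabs_ge0.
- by apply: emeasurable_funD; apply: measurable_funeM.
- move=> p Dp; rewrite -!EFinM -EFinD lee_fin.
  have a0 : 0 <= cabs (f (toC p)) / C1 by rewrite divr_ge0 ?cabs_ge0 // ltW.
  have b0 : 0 <= cabs (g (toC p)) / C2 by rewrite divr_ge0 ?cabs_ge0 // ltW.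
  apply: le_trans (Pc _ _ t a0 b0 t01); apply: Pm.
    by rewrite divr_ge0 ?cabs_ge0 // ltW.
  rewrite (_ : t * _ + _ = (cabs (f (toC p)) + cabs (g (toC p))) / (C1 + C2)).
    by rewrite ler_wpM2r ?H // invr_ge0 ltW.
  by rewrite /t; field; rewrite !gt_eqF.
Qed.

Lemma orlicz_scale k x : 1 <= k -> 0 <= x -> Psi (x / k) <= Psi x / k.
Proof.
move=> k1 x0; have [P0 _ _ Pc _] := oP; have k0 : 0 < k by lra.
have := Pc x 0 k^-1 x0 (lexx _).
by rewrite invr_ge0 ltW //= invf_le1 // k1 mulr0 addr0 P0 mulr0 addr0 !(mulrC k^-1); apply.
Qed.

Lemma modular_scale f C k : mabs f -> 0 < C -> 1 <= k ->
  (modular m c Psi f (k * C) <= k^-1%:E * modular m c Psi f C)%E.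
Proof.
move=> mf C0 k1; have k0 : 0 < k by lra.
have kC : 0 < k * C by rewrite mulr_gt0.
have md := @measurable_disk R; have mF := mabs_Psi mf C0; have mG := mabs_Psi mf kC.
rewrite /modular muleCA; apply: lee_wpmul2l; first by rewrite lee_fin.
rewrite -ge0_integralZl_EFin //; last 2 first.
- by move=> p _; rewrite lee_fin Psi_cabs_ge0.
- by rewrite invr_ge0 ltW.
apply: ge0_le_integral => //.
- by move=> p _; rewrite lee_fin Psi_cabs_ge0.
- exact: measurable_funeM.
- move=> p _; rewrite -EFinM lee_fin [leRHS]mulrC.
  have -> : cabs (f (toC p)) / (k * C) = cabs (f (toC p)) / C / k by field; rewrite !gt_eqF.
  by apply: orlicz_scale => //; rewrite divr_ge0 ?cabs_ge0 // ltW.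
Qed.

(** Dilating the scale by [k >= 1] divides the modular by at least [k], so any finite bound can be
    brought down to 1. *)
Lemma inL_bounded f C (K : R) : mabs f -> 0 < C ->
  (modular m c Psi f C <= K%:E)%E -> inL m c Psi f.
Proof.
move=> mf C0 H; pose k := Num.max 1 K.
have k1 : 1 <= k by rewrite le_max lexx.
have k0 : 0 < k by lra.
exists (k * C); split; first by rewrite mulr_gt0.
apply: le_trans (modular_scale mf C0 k1) _.
apply: (@le_trans _ _ (k^-1%:E * k%:E)%E).
  apply: lee_wpmul2l; first by rewrite lee_fin invr_ge0 ltW.
  by apply: le_trans H _; rewrite lee_fin le_max lexx orbT.
by rewrite -EFinM mulVf ?gt_eqF.
Qed.

Lemma lux_le f C : 0 < C -> (modular m c Psi f C <= 1)%E -> lux m c Psi f <= C.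
Proof. by move=> C0 H; apply: ge_inf; [exists 0 => x [/ltW]|split]. Qed.

Lemma lux_ge0 f : 0 <= lux m c Psi f.
Proof.
rewrite /lux; set E := mkset _; have [->|/set0P En] := eqVneq E set0; first by rewrite inf0.
by apply: lb_le_inf => // x [/ltW].
Qed.

(* The infimum of the empty set is 0, whence the membership hypothesis. *)
Lemma lux_lt f C : mabs f -> inL m c Psi f -> lux m c Psi f < C ->
  (modular m c Psi f C <= 1)%E.
Proof.
move=> mf [C1 HC1]; have hi : has_inf [set C : R | 0 < C /\ (modular m c Psi f C <= 1)%E].
  by split; [exists C1|exists 0 => x [/ltW]].
move=> lC; have [|C' [C'0 H'] C'C] := inf_adherent (_ : 0 < C - lux m c Psi f) hi; first by rewrite subr_gt0.
apply: le_trans (modular_mono mf C'0 _) H'; rewrite ltW //.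
by move: C'C; rewrite /lux addrC subrK.
Qed.

Lemma inL_add f g h : mabs f -> mabs g -> mabs h ->
  (forall p, disk p -> cabs (h (toC p)) <= cabs (f (toC p)) + cabs (g (toC p))) ->
  inL m c Psi f -> inL m c Psi g -> inL m c Psi h.
Proof.
move=> mf mg mh H [C1 [C10 H1]] [C2 [C20 H2]]; exists (C1 + C2).
by rewrite addr_gt0 //; split=> //; exact: (modular_add mf mg mh).
Qed.

Lemma limn_einf_ge (u : nat -> \bar R) a :
  (\forall n \near \oo, a <= u n)%E -> (a <= limn_einf u)%E.
Proof.
move=> [N _ H]; rewrite limn_einf_lim; apply: lime_ge; first exact: is_cvg_einfs.
exists N => // n Nn; apply: le_ereal_inf_tmp => _ [k nk <-]; apply: H.
exact: leq_trans Nn nk.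
Qed.

Lemma limn_einf_le (u : nat -> \bar R) a :
  (\forall n \near \oo, u n <= a)%E -> (limn_einf u <= a)%E.
Proof.
move=> [N _ H]; rewrite limn_einf_lim; apply: lime_le; first exact: is_cvg_einfs.
exists N => // n Nn; apply: le_trans (H n Nn); apply: ereal_inf_lbound.
by exists n => //=.
Qed.

(** Where [g] does not vanish, [cabs (v n)] is eventually at least half of [cabs g]; the factor 2 in
    the scale thus lets monotonicity of [Psi] stand in for continuity. *)
Lemma modular_fatou (v : nat -> R[i] -> R[i]) g C : (forall n, mabs (v n)) -> mabs g -> 0 < C ->
  (forall p, disk p -> cabs (v n (toC p) - g (toC p)) @[n --> \oo] --> 0) ->
  (\forall n \near \oo, modular m c Psi (v n) C <= 1)%E ->
  (modular m c Psi g (2 * C) <= 1)%E.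
Proof.
move=> mv mg C0 vg H; have md := @measurable_disk R.
have C2 : 0 < 2 * C by rewrite mulr_gt0.
have vP n p : disk p -> (0 <= (Psi (cabs (v n (toC p)) / C))%:E)%E.
  by move=> _; rewrite lee_fin Psi_cabs_ge0.
have gP p : disk p -> (0 <= (Psi (cabs (g (toC p)) / (2 * C)))%:E)%E.
  by move=> _; rewrite lee_fin Psi_cabs_ge0.
have F := @fatou _ _ _ m _ md (fun n p => (Psi (cabs (v n (toC p)) / C))%:E)
  (fun n => mabs_Psi (mv n) C0) vP.
have mlim : measurable_fun disk
    (fun p => limn_einf (fun n => (Psi (cabs (v n (toC p)) / C))%:E)).
  apply: (@emeasurable_fun_cvg _ _ _ _ (fun n p => einfs (fun k => (Psi (cabs (v k (toC p)) / C))%:E) n)).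
    by move=> n; apply: measurable_fun_einfs => k; exact: mabs_Psi.
  by move=> p _; rewrite limn_einf_lim; exact: is_cvg_einfs.
have {}F : (\int[m]_(p in disk) (Psi (cabs (g (toC p)) / (2 * C)))%:E <=
  limn_einf (fun n => \int[m]_(p in disk) (Psi (cabs (v n (toC p)) / C))%:E))%E.
  apply: le_trans F; apply: ge0_le_integral => //; first exact: mabs_Psi.
  move=> p Dp; apply: limn_einf_ge.
  have [g0|gn0] := eqVneq (cabs (g (toC p))) 0.
    by near=> n; have [P0 _ _ _ _] := oP; rewrite g0 mul0r P0; exact: vP.
  have g0 : 0 < cabs (g (toC p)) / 2 by rewrite divr_gt0 // lt_neqAle eq_sym gn0 cabs_ge0.
  have /cvgr0Pnorm_lt /(_ _ g0) hn := vg p Dp.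
  near=> n; rewrite lee_fin; have [_ _ Pm _ _] := oP; apply: Pm.
    by rewrite divr_ge0 ?cabs_ge0 // ltW.
  rewrite invfM mulrA ler_wpM2r ?invr_ge0 ?(ltW C0) //.
  have : `|cabs (v n (toC p) - g (toC p))| < cabs (g (toC p)) / 2 by near: n.
  rewrite ger0_norm ?cabs_ge0 //.
  have := cabs_trian (v n (toC p)) (g (toC p)) 0; rewrite !subr0 cabs_sym; lra.
have [c_0|cn0] := eqVneq c 0; first by rewrite /modular c_0 mul0e lee_fin.
have cp : 0 < c by rewrite lt_neqAle eq_sym cn0.
have {}F : (\int[m]_(p in disk) (Psi (cabs (g (toC p)) / (2 * C)))%:E <= c^-1%:E)%E.
  apply: le_trans F _; apply: limn_einf_le; near=> n.
  rewrite -(@lee_pmul2l _ c%:E) // -EFinM mulfV //.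
  by near: n.
apply: le_trans (lee_wpmul2l _ F) _; first by rewrite lee_fin.
by rewrite -EFinM mulfV.
Unshelve. all: by end_near. Qed.

End Modular.

(** * Carleson windows and the test kernels *)

Section Windows.
Variable R : realType.
Implicit Types (h x t : R) (z w xi : R[i]).

Lemma sin_mvt x : 0 < x -> exists2 y, 0 < y < x & sin x = cos y * x.
Proof.
move=> x0; have [y] := @MVT R (@sin R) (@cos R) _ _ x0 (fun y _ => is_derive_sin y)
  (continuous_subspaceT (@continuous_sin R)).
by rewrite in_itv /= => yx; rewrite sin0 !subr0 => ?; exists y.
Qed.

Lemma sin_le x : 0 <= x -> sin x <= x.
Proof.
rewrite le_eqVlt => /predU1P[<-|x0]; first by rewrite sin0.
by have [y _ ->] := sin_mvt x0; rewrite ler_piMl ?cos_le1 // ltW.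
Qed.

Lemma one_sub_cos x : 1 - cos x = 2 * sin (x / 2) ^+ 2.
Proof.
have -> : cos x = cos (x / 2 + x / 2) by congr cos; field.
by rewrite cosD -!expr2 cos2sin2; ring.
Qed.

Lemma cos_ge x : 0 <= x -> x <= pi -> 1 - x ^+ 2 / 2 <= cos x.
Proof.
move=> x0 xpi; have x2 : 0 <= x / 2 by rewrite divr_ge0.
have s1 : sin (x / 2) <= x / 2 := sin_le x2.
have s0 : 0 <= sin (x / 2) by apply: sin_ge0_pi; lra.
have := one_sub_cos x; nra.
Qed.

Lemma sin_ge_half x : 0 <= x -> x <= 1 -> x / 2 <= sin x.
Proof.
rewrite le_eqVlt => /predU1P[<-|x0 x1]; first by rewrite sin0 mul0r.
have [y /andP[y0 yx] ->] := sin_mvt x0.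
rewrite mulrC ler_wpM2r ?(ltW x0) //.
have := @cos_ge y (ltW y0) (_ : y <= pi) => H; apply: le_trans (H _); first nra.
by have p2 := @pi_ge2 R; lra.
Qed.

Lemma cos_le_quad x : 0 <= x -> x <= 2 -> cos x <= 1 - x ^+ 2 / 8.
Proof.
move=> x0 x2; have a0 : 0 <= x / 2 by lra.
have a1 : x / 2 <= 1 by lra.
have := sin_ge_half a0 a1; have := one_sub_cos x.
move: (sin (x / 2)) (cos x) => s c H1 H2; nra.
Qed.

Lemma le_cos_in x y : 0 <= x <= pi -> 0 <= y <= pi -> (cos y <= cos x) = (x <= y).
Proof. by move=> hx hy; rewrite !leNgt ltr_cos ?in_itv. Qed.

(** Since [cos] decreases on [[0, pi]], the existence of an angle of size at most [pi h] becomes an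
    inequality on a real part, suited both to measurability and to estimates. *)
Lemma windowP xi h (p : R * R) : circle xi -> 0 < h -> h < 1 ->
  window xi h p <-> [/\ disk p, 1 - h <= cabs (toC p) &
    cabs (toC p) * cos (pi * h) <= complex.Re (toC p * conjc xi)].
Proof.
move=> cxi h0 h1; have ph0 : 0 <= pi * h by rewrite mulr_ge0 ?pi_ge0 ?ltW.
have php : pi * h <= pi by rewrite ger_pMr ?pi_gt0 ?ltW.
split.
  move=> [Dp [hp [th [tl E]]]]; split=> //; rewrite E /= mul0r subr0.
  rewrite ler_wpM2l ?cabs_ge0 //.
  have -> : cos th = cos `|th|.
    by have [t0|t0] := ltrP th 0; [rewrite ltr0_norm // cosN|rewrite ger0_norm].
  by rewrite le_cos_in ?ph0 ?php // normr_ge0 (le_trans tl).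
move=> [Dp hp H]; split=> //; split=> //.
set w := toC p * conjc xi in H *; set r := cabs (toC p) in hp H *.
have r0 : 0 < r by lra.
have wr : cabs w = r by rewrite /w cabsM cabs_conj (cxi : cabs xi = 1) mulr1.
(* [s] is the cosine of the argument of [w]; [acos s] is its absolute value, and the sign of the
   imaginary part decides between this angle and its opposite. *)
pose s := complex.Re w / r.
have s1 : -1 <= s <= 1.
  by rewrite -ler_norml /s normrM normfV (gtr0_norm r0) ler_pdivrMr // mul1r -wr Re_le_cabs.
have Rw : complex.Re w = r * s by rewrite /s mulrC divfK // gt_eqF.
have Iw : complex.Im w ^+ 2 = (r * sin (acos s)) ^+ 2.
  rewrite exprMn sin2cos2 acosK ?in_itv //= mulrBr mulr1 -exprMn -Rw.
  by rewrite -wr sqr_cabs addrAC subrr add0r.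
have ap : acos s <= pi * h.
  rewrite -le_cos_in ?acos_ge0 ?acos_lepi ?ph0 ?php // acosK ?in_itv //.
  by rewrite ler_pdivlMr // mulrC.
have a0 : 0 <= acos s by rewrite acos_ge0.
have : complex.Im w = r * sin (acos s) \/ complex.Im w = - (r * sin (acos s)).
  by move/eqP: Iw; rewrite eqf_sqr => /orP[/eqP|/eqP]; [left|right].
case=> Ew; [exists (acos s)|exists (- acos s)]; rewrite ?normrN ger0_norm //; split=> //;
  apply/eqP; rewrite eq_complex /= ?cosN ?sinN acosK ?in_itv //= !mul0r subr0 addr0 Rw eqxx Ew /=;
  by rewrite ?mulrN.
Qed.

Lemma measurable_window xi h : circle xi -> 0 < h -> h < 1 -> measurable (window xi h).
Proof.
move=> cxi h0 h1.
pose g1 (p : R * R) := cabs (toC p).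
pose g2 (p : R * R) := complex.Re (toC p * conjc xi) - cabs (toC p) * cos (pi * h).
have mg1 : measurable_fun setT g1 := @measurable_cabs R.
have mg2 : measurable_fun setT g2.
  apply: measurable_funB; last by apply: measurable_funM.
  apply: measurable_cont => // p _.
  by have [] := @ccont_cont_at _ (fun z => z * conjc xi) p (ccontM (ccont_id _) (ccont_cst _ _)).
rewrite (_ : window xi h = disk `&` ((setT `&` g1 @^-1` `[1 - h, +oo[%classic) `&`
   (setT `&` g2 @^-1` `[0, +oo[%classic))).
  apply: measurableI; first exact: measurable_disk.
  apply: measurableI; [apply: mg1 => //|apply: mg2 => //]; exact: measurable_itv.
apply/seteqP; split=> p.
  by move=> /(windowP _ cxi h0 h1)[d1 d2 d3]; split=> //=; rewrite !in_itv /= !andbT subr_ge0.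
move=> [d1 [[_ d2] [_ d3]]]; apply/(windowP _ cxi h0 h1); move: d2 d3.
by rewrite /= !in_itv /= !andbT subr_ge0.
Qed.

(** Normalized to be at most 1 on the disk. The fourth power gives a decay like [16^-j] at distance
    about [2^j h] from [xi], against an area growing like [4^j]. *)
Definition kern xi h z : R[i] := (h%:C / (1 - (1 - h)%:C * conjc xi * z))%C ^+ 4.

Lemma kern_den xi h z : circle xi -> 0 < h -> h < 1 -> cabs z < 1 ->
  [/\ h <= cabs (1 - ((1 - h)%:C)%C * conjc xi * z),
      1 - cabs z <= cabs (1 - ((1 - h)%:C)%C * conjc xi * z) &
      cabs (z - xi) <= 2 * cabs (1 - ((1 - h)%:C)%C * conjc xi * z)].
Proof.
move=> cxi h0 h1 z1; set a := (((1 - h)%:C)%C * conjc xi).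
have ca : cabs a = 1 - h.
  by rewrite /a cabsM cabs_conj (cxi : cabs xi = 1) mulr1 cabsR ger0_norm // subr_ge0 ltW.
have z0 := cabs_ge0 z.
have A : 1 <= cabs (1 - a * z) + (1 - h) * cabs z.
  by rewrite -ca -cabsM -{1}(@cabs1 R) -{1}[1](subrK (a * z)) cabsD.
have B : h <= cabs (1 - a * z) by nra.
have C : 1 - cabs z <= cabs (1 - a * z) by nra.
split=> //.
have E : z - xi = - (xi * (1 - a * z)) + h%:C%C * z.
  have xx : xi * conjc xi = 1 by rewrite mul_conj (cxi : cabs xi = 1) expr1n.
  have -> : xi * (1 - a * z) = xi - ((1 - h)%:C)%C * (xi * conjc xi) * z by rewrite /a; ring.
  by rewrite xx mulr1 rmorphB /= rmorph1; ring.
rewrite E; apply: le_trans (cabsD _ _) _.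
rewrite cabsN !cabsM (cxi : cabs xi = 1) mul1r cabsR gtr0_norm //; nra.
Qed.

Lemma cabs_kern xi h z : 0 < h ->
  cabs (kern xi h z) = (h / cabs (1 - ((1 - h)%:C)%C * conjc xi * z)) ^+ 4.
Proof. by move=> h0; rewrite /kern cabsX cabsM cabsV cabsR gtr0_norm. Qed.

Lemma kern_analytic xi h (P : R) : circle xi -> 0 < h -> h < 1 ->
  analytic_on_disk (fun z => (P%:C)%C * kern xi h z).
Proof.
move=> cxi h0 h1 z z1; apply: cdiffM; first exact: cdiff_cst.
have [d1 _ _] := kern_den cxi h0 h1 z1.
have dk : cdifferentiable (fun z => (h%:C / (1 - (1 - h)%:C * conjc xi * z))%C) z.
  apply: cdiffM; first exact: cdiff_cst.
  apply: cdiffV.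
    by apply: contraTneq d1 => ->; rewrite cabs0 -ltNge.
  apply: cdiffD; first exact: cdiff_cst.
  have -> : (fun w => - (((1 - h)%:C)%C * conjc xi * w)) = (fun w => - (((1 - h)%:C)%C * conjc xi) * w).
    by apply/funext => w; rewrite mulNr.
  by apply: cdiffM; [exact: cdiff_cst|exact: cdiff_id].
rewrite /kern (_ : (fun w => _) = (fun w => (h%:C / (1 - (1 - h)%:C * conjc xi * w))%C *
   ((h%:C / (1 - (1 - h)%:C * conjc xi * w))%C * ((h%:C / (1 - (1 - h)%:C * conjc xi * w))%C *
    (h%:C / (1 - (1 - h)%:C * conjc xi * w))%C)))); last by apply/funext => w; rewrite !exprS expr0 mulr1.
by do 3 (apply: cdiffM => //).
Qed.

Lemma kern_le1 xi h z : circle xi -> 0 < h -> h < 1 -> cabs z < 1 -> cabs (kern xi h z) <= 1.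
Proof.
move=> cxi h0 h1 z1; have [d1 _ _] := kern_den cxi h0 h1 z1.
rewrite cabs_kern // exprn_ile1 ?divr_ge0 ?cabs_ge0 ?(ltW h0) //.
by rewrite ler_pdivrMr ?mul1r // (lt_le_trans h0).
Qed.

Lemma kern_point xi h z : circle xi -> 0 < h -> h < 1 -> cabs z < 1 ->
  cabs (kern xi h z) <= (h / (1 - cabs z)) ^+ 4.
Proof.
move=> cxi h0 h1 z1; have [d1 d2 _] := kern_den cxi h0 h1 z1.
have z1' : 0 < 1 - cabs z by rewrite subr_gt0.
rewrite cabs_kern // lerXn2r ?nnegrE ?divr_ge0 ?cabs_ge0 ?(ltW h0) ?(ltW z1') //.
by rewrite ler_wpM2l ?(ltW h0) // lef_pV2 ?posrE // (lt_le_trans z1').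
Qed.

(** With [w = z * conjc xi] and [r = cabs z], the squared modulus of the denominator is
    [(1 - (1 - h) r)^2 + 2 (1 - h) (r - Re w)]. On the window the first term is at most [4 h^2] and,
    as [pi <= 4], the second at most [16 h^2]; so the modulus is at most [6 h]. *)
Lemma kern_window xi h p : circle xi -> 0 < h -> h < 1 / 2 -> window xi h p ->
  6^-1 ^+ 4 <= cabs (kern xi h (toC p)).
Proof.
move=> cxi h0 h2 wp; have h1 : h < 1 by lra.
have [Dp w1 w2] := (windowP _ cxi h0 h1).1 wp.
have [d1 _ _] := kern_den cxi h0 h1 Dp.
set D := 1 - _ in d1; have D0 : 0 < cabs D := lt_le_trans h0 d1.
rewrite cabs_kern // lerXn2r ?nnegrE ?divr_ge0 ?cabs_ge0 ?(ltW h0) //.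
rewrite -/D ler_pdivlMr // mulrC ler_pdivrMr //.
have p4 : pi <= 4 :> R by have := @pihalf_lt2 R; lra.
have p0 := @pi_ge0 R.
have ph0 : 0 <= pi * h by rewrite mulr_ge0 // ltW.
have php : pi * h <= pi by rewrite ger_pMr ?pi_gt0 ?ltW.
have c1 := cos_ge ph0 php.
set r := cabs (toC p) in w1 w2.
have r1 : r < 1 := Dp.
have r0 : 0 < r by lra.
set w := toC p * conjc xi in w2.
have wr : cabs w = r by rewrite /w cabsM cabs_conj (cxi : cabs xi = 1) mulr1.
have Dw : D = 1 - ((1 - h)%:C)%C * w by rewrite /D /w; ring.
have wr2 := sqr_cabs w; rewrite wr in wr2.
rewrite -(@ler_pXn2r _ 2) ?nnegrE ?cabs_ge0 ?mulr_ge0 ?(ltW h0) // Dw sqr_cabs.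
case: w w2 wr2 {wr Dw} => u v /= w2 wr2.
rewrite !mul0r !subr0 ?addr0.
have ph : pi * h <= 4 * h by rewrite ler_wpM2r // ltW.
have u1 : r * (1 - (4 * h) ^+ 2 / 2) <= u.
  apply: le_trans w2; rewrite ler_wpM2l ?(ltW r0) //; apply: le_trans c1.
  by rewrite lerD2l lerN2 ler_wpM2r // lerXn2r ?nnegrE // mulr_ge0 // ltW.
rewrite [leLHS](_ : _ = 1 - 2 * (1 - h) * u + (1 - h) ^+ 2 * r ^+ 2); last by rewrite wr2; ring.
have a0 : 0 <= 2 * (1 - h) by lra.
have := ler_wpM2l a0 u1.
have b1 : (1 - (1 - h) * r) ^+ 2 <= (2 * h) ^+ 2.
  by rewrite lerXn2r ?nnegrE ?mulr_ge0 ?(ltW h0) //; nra.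
have b2 : (1 - h) * r * h ^+ 2 <= h ^+ 2.
  by rewrite ler_piMl ?sqr_ge0 //; nra.
nra.
Qed.

End Windows.

(** * Area integral and norm of the test kernels *)

Section KernelIntegral.
Variable R : realType.

(** The smallest dyadic square about [xi] containing [p] decides: [p] is outside the previous one,
    so the denominator is at least [h 2^(j-1)]. This shift by one level is the source of the factor
    16. The square of index [N] has half side at least 2 and covers the disk. *)
Lemma kern_layers (xi : R[i]) (h : R) N p : circle xi -> 0 < h -> h < 1 -> disk p ->
  2 <= 2 * h * 2 ^+ N ->
  cabs (kern xi h (toC p)) <= \sum_(j < N.+1) 16 * 16^-1 ^+ j *
     \1_(sq (complex.Re xi, complex.Im xi) (2 * h * 2 ^+ j)) p.
Proof.
move=> cxi h0 h1 Dp HN; set q := (complex.Re xi, complex.Im xi).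
pose r j : R := 2 * h * 2 ^+ j.
have r0 j : 0 < r j by rewrite !mulr_gt0 ?exprn_gt0.
have d2 : cabs (toC p - xi) <= 2.
  by apply: le_trans (cabsB _ _) _; rewrite (cxi : cabs xi = 1); have := ltW (Dp : cabs (toC p) < 1); lra.
have SN : exists j, `[< sq q (r j) p >].
  exists N; apply/asboolP; split; rewrite /q /=.
    by have := Re_le_cabs (toC p - xi); rewrite raddfB /= => /le_trans; apply; exact: le_trans HN.
  by have := Im_le_cabs (toC p - xi); rewrite raddfB /= => /le_trans; apply; exact: le_trans HN.
case: (ex_minnP SN) => j /asboolP Sj minj.
have jN : (j < N.+1)%N.
  rewrite ltnS; apply: minj; apply/asboolP; split; rewrite /q /=.
    by have := Re_le_cabs (toC p - xi); rewrite raddfB /= => /le_trans; apply; exact: le_trans HN.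
  by have := Im_le_cabs (toC p - xi); rewrite raddfB /= => /le_trans; apply; exact: le_trans HN.
rewrite (bigD1 (Ordinal jN)) //= -/(r j) indicE mem_set // mulr1.
apply: (@le_trans _ _ (16 * 16^-1 ^+ j)); last first.
  by rewrite lerDl sumr_ge0 // => i _; rewrite mulr_ge0 // mulr_ge0 // exprn_ge0 // invr_ge0.
have [d1 _ d3] := kern_den cxi h0 h1 Dp.
case: j {jN} Sj minj => [|j] Sj minj.
  by rewrite expr0 mulr1; apply: le_trans (kern_le1 cxi h0 h1 Dp) _; rewrite ler1n.
have nS : ~ sq q (r j) p by move=> /asboolP /minj; rewrite ltnn.
have rj : r j <= cabs (toC p - xi).
  rewrite leNgt; apply/negP => lt; apply: nS; split; rewrite /q /=.
    by have := Re_le_cabs (toC p - xi); rewrite raddfB /= => /le_trans; apply; exact: ltW.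
  by have := Im_le_cabs (toC p - xi); rewrite raddfB /= => /le_trans; apply; exact: ltW.
have D0 := lt_le_trans h0 d1.
rewrite cabs_kern // [16^-1 ^+ j.+1]exprS mulrA mulfV ?mul1r ?pnatr_eq0 //.
rewrite (_ : 16^-1 = 2^-1 ^+ 4); last by field.
rewrite -exprM mulnC exprM lerXn2r ?nnegrE ?divr_ge0 ?exprn_ge0 ?invr_ge0 ?(ltW h0) ?(ltW D0) //.
rewrite ler_pdivrMr // exprVn ler_pdivlMl ?exprn_gt0 //.
have := le_trans rj d3; rewrite /r -mulrA ler_pM2l // mulrC; exact.
Qed.

Lemma geom4_le n : \sum_(j < n) (4^-1 : R) ^+ j <= 2.
Proof.
have -> : \sum_(j < n) (4^-1 : R) ^+ j = 4 / 3 * (1 - 4^-1 ^+ n).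
  elim: n => [|n IH]; first by rewrite big_ord0 expr0 subrr mulr0.
  by rewrite big_ord_recr /= IH exprS; field.
have : 0 <= (4^-1 : R) ^+ n by rewrite exprn_ge0 // invr_ge0.
lra.
Qed.

(** Layer [j] contributes at most [16 * 16^-j] times the area [4 (2 h 2^j)^2], that is
    [256 h^2 4^-j], and the geometric sum is at most 2. *)
Lemma kern_integral (xi : R[i]) (h : R) : circle xi -> 0 < h -> h < 1 ->
  (\int[@plane_measure R]_(p in disk) (cabs (kern xi h (toC p)))%:E <= (512 * h ^+ 2)%:E)%E.
Proof.
move=> cxi h0 h1; have md := @measurable_disk R.
pose N := Num.bound h^-1.
have HN : 2 <= 2 * h * 2 ^+ N.
  rewrite -mulrA ler_peMr // mulrC -ler_pdivrMr // div1r ltW //.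
  apply: lt_le_trans (archi_boundP _) _; first by rewrite invr_ge0 ltW.
  by rewrite -natrX ler_nat ltnW // ltn_expl.
set q := (complex.Re xi, complex.Im xi).
pose S (j : nat) := sq q (2 * h * 2 ^+ j).
pose c (j : nat) : R := 16 * 16^-1 ^+ j.
have c0 j : 0 <= c j by rewrite mulr_ge0 // exprn_ge0 // invr_ge0.
have mS j : measurable (S j) := measurable_sq _ _.
have mk : mabs (kern xi h).
  have ak : analytic_on_disk (kern xi h).
    have -> : kern xi h = (fun z => (1%:C)%C * kern xi h z) by apply/funext => z; rewrite mul1r.
    exact: kern_analytic.
  by have [] := analytic_measurable ak.
have mi j : measurable_fun disk (fun p : R * R => (\1_(S j) p)%:E : \bar R).
  by apply: measurable_funE; apply: measurable_funTS; exact: measurable_indic.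
apply: (@le_trans _ _ (\int[@plane_measure R]_(p in disk) (\sum_(j < N.+1) (c j)%:E * (\1_(S j) p)%:E))%E).
  apply: ge0_le_integral => //.
  - by move=> p _; rewrite lee_fin cabs_ge0.
  - exact: measurable_funE.
  - by apply: emeasurable_sum => j; exact: measurable_funeM.
  - move=> p Dp; under eq_bigr do rewrite -EFinM.
    by rewrite sumEFin lee_fin; exact: kern_layers.
rewrite ge0_integral_sum //; first last.
- by move=> j p _; rewrite mule_ge0 ?lee_fin.
- by move=> j; exact: measurable_funeM.
apply: (@le_trans _ _ (\sum_(j < N.+1) (256 * h ^+ 2 * 4^-1 ^+ j)%:E)%E).
  apply: lee_sum => j _; rewrite ge0_integralZl_EFin //.
  rewrite integral_indic //.
  apply: (@le_trans _ _ ((c j)%:E * plane_measure (S j))%E).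
    apply: lee_wpmul2l; first by rewrite lee_fin.
    by apply: le_measure; rewrite ?inE //; exact: measurableI.
  rewrite /plane_measure leb2_sq; last by rewrite !mulr_gt0 ?exprn_gt0.
  rewrite -EFinM lee_fin /c !exprMn -!exprM mulnC exprM.
  have -> : (16^-1 : R) ^+ j = 4^-1 ^+ j * 4^-1 ^+ j.
    by rewrite -exprMn; congr (_ ^+ _); field.
  have e4 : (2 ^+ 2 : R) ^+ j * 4^-1 ^+ j = 1.
    by rewrite -exprMn (_ : _ * _ = 1) ?expr1n //; field.
  rewrite [leLHS](_ : _ = ((2 ^+ 2) ^+ j * 4^-1 ^+ j) * (256 * h ^+ 2 * 4^-1 ^+ j)).
    by rewrite e4 mul1r.
  by ring.
rewrite sumEFin lee_fin -mulr_sumr.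
have -> : 512 * h ^+ 2 = 256 * h ^+ 2 * 2 by ring.
apply: ler_wpM2l; last exact: geom4_le.
by apply: mulr_ge0; [exact: ler0n|exact: sqr_ge0].
Qed.

Lemma pi_gt1 : 1 < pi :> R. Proof. by apply: lt_le_trans (@pi_ge2 R); rewrite ltr1n. Qed.

(** The scale 512 is the constant of [kern_integral]: convexity takes it out of [Psi] together with
    the kernel, the two constants cancel after integration, and [pi^-1 <= 1] is left. *)
Lemma kern_modular (Psi : R -> R) (xi : R[i]) (h P : R) : orlicz Psi ->
  circle xi -> 0 < h -> h < 1 -> 0 <= P -> Psi P <= h ^- 2 ->
  (modular leb2 pi^-1 Psi (fun z => ((P%:C)%C * kern xi h z)%R) 512 <= 1)%E.
Proof.
move=> oP cxi h0 h1 P0 HP.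
rewrite -[leb2]/(@plane_measure R) /modular; have md := @measurable_disk R.
have pi1 := pi_gt1; have pi0 : 0 < pi :> R := pi_gt0 R.
have [_ _ mk] := analytic_measurable (kern_analytic P cxi h0 h1).
have [_ _ mk1] := analytic_measurable (kern_analytic 1 cxi h0 h1).
have mk1' : measurable_fun disk (fun p => cabs (kern xi h (toC p))).
  by apply: eq_measurable_fun mk1 => p _; rewrite mul1r.
have Psi0 : 0 <= Psi P := orlicz_ge0 oP P0.
have C0 : 0 <= h ^- 2 / 512.
  by apply: divr_ge0; [rewrite invr_ge0 sqr_ge0|exact: ler0n].
apply: (@le_trans _ _ ((pi^-1)%:E * ((h ^- 2 / 512)%:E * \int[@plane_measure R]_(p in disk) (cabs (kern xi h (toC p)))%:E))%E).
  apply: lee_wpmul2l; first by rewrite lee_fin invr_ge0 ltW.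
  rewrite -ge0_integralZl_EFin //; last 2 first.
  - by move=> p _; rewrite lee_fin cabs_ge0.
  - exact: measurable_funE.
  apply: ge0_le_integral => //.
  - move=> p _; rewrite lee_fin; apply: (orlicz_ge0 oP).
    by apply: divr_ge0; [exact: cabs_ge0|exact: ler0n].
  - have p512 : 0 < (512 : R) by rewrite ltr0n.
    exact: (mabs_Psi oP (f := fun z => (P%:C)%C * kern xi h z) mk p512).
  - by apply: measurable_funeM; exact: measurable_funE.
  - move=> p Dp; rewrite -EFinM lee_fin cabsM cabsR ger0_norm //.
    have k1 := kern_le1 cxi h0 h1 Dp; have k0 := cabs_ge0 (kern xi h (toC p)).
    have [Ps0 _ _ Pc _] := oP.
    pose t := cabs (kern xi h (toC p)) / 512.
    have t01 : 0 <= t <= 1 by rewrite /t; apply/andP; split; lra.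
    have := Pc P 0 t P0 (lexx _) t01; rewrite mulr0 addr0 Ps0 mulr0 addr0.
    rewrite (_ : P * _ / 512 = t * P); last by rewrite /t; ring.
    move/le_trans; apply.
    have /andP[t0 _] := t01.
    apply: le_trans (ler_wpM2l t0 HP) _; rewrite /t; lra.
apply: (@le_trans _ _ ((pi^-1)%:E * ((h ^- 2 / 512)%:E * (512 * h ^+ 2)%:E))%E).
  apply: lee_wpmul2l; first by rewrite lee_fin invr_ge0 ltW.
  by apply: lee_wpmul2l; [rewrite lee_fin|exact: kern_integral].
rewrite -!EFinM lee_fin (_ : _ / _ * _ = 1); last by field; rewrite gt_eqF.
by rewrite mulr1 invf_le1 // ltW.
Qed.

Lemma kern_inB (Psi : R -> R) (xi : R[i]) (h P : R) : orlicz Psi ->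
  circle xi -> 0 < h -> h < 1 -> 0 <= P -> Psi P <= h ^- 2 ->
  inB Psi (fun z => (P%:C)%C * kern xi h z) /\
  normB Psi (fun z => (P%:C)%C * kern xi h z) <= 512.
Proof.
move=> oP cxi h0 h1 P0 HP; have H := kern_modular oP cxi h0 h1 P0 HP.
have p512 : 0 < (512 : R) by rewrite ltr0n.
split; first by split; [exact: kern_analytic|exists 512; split; [exact: p512|exact: H]].
exact: (@lux_le R (@plane_measure R) pi^-1 Psi _ 512 p512 H).
Qed.

End KernelIntegral.

(** * The inverse of an Orlicz function as a supremum *)

Section OrliczInverse.
Variables (R : realType) (Psi : R -> R).
Hypothesis oP : orlicz Psi.

Lemma Psi_inv_has_ub y : has_ubound [set x | 0 <= x /\ Psi x <= y].
Proof.
have [_ _ Pm _ /cvgryPgt /(_ y) [M [_ HM]]] := oP.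
exists (Num.max 0 (M + 1)) => x [x0 Px]; rewrite leNgt; apply/negP.
rewrite gt_max => /andP[_ Mx]; have /HM : M < x by lra.
by rewrite ltNge Px.
Qed.

Lemma Psi_inv_ge x y : 0 <= x -> Psi x <= y -> x <= Psi_inv Psi y.
Proof. by move=> x0 Px; apply: (ub_le_sup (Psi_inv_has_ub y)). Qed.

Lemma Psi_inv_gt x y : 0 <= x -> x < Psi_inv Psi y -> Psi x <= y.
Proof.
move=> x0; rewrite /Psi_inv; set E := mkset _; have [->|/set0P En] := eqVneq E set0.
  by rewrite sup0 ltNge x0.
move=> /(sup_gt En) [z [z0 Pz] xz]; apply: le_trans Pz.
by have [_ _ Pm _ _] := oP; apply: Pm => //; exact: ltW.
Qed.

Lemma Psi_inv_gt0 y : 0 < y -> 0 < Psi_inv Psi y.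
Proof.
move=> y0; have [_ Pp _ _ _] := oP.
pose k := Num.max 1 (Psi 1 / y).
have k1 : 1 <= k by rewrite le_max lexx.
have k0 : 0 < k by lra.
apply: (@lt_le_trans _ _ (1 / k)); first by rewrite divr_gt0.
apply: Psi_inv_ge; first by rewrite divr_ge0 // ltW.
apply: le_trans (orlicz_scale oP k1 ler01) _.
by rewrite ler_pdivrMr // mulrC -ler_pdivrMr // le_max lexx orbT.
Qed.

(** Convexity forces at least linear growth, so [P] is [O(h^-2)]. It follows that [P h^4] tends to
    0, which makes the test functions vanish pointwise in the limit. *)
Lemma orlicz_growth P h : 0 <= P -> 0 < h -> h <= 1 -> Psi P <= h ^- 2 ->
  P * h ^+ 2 <= 1 + (Psi 1)^-1.
Proof.
move=> P0 h0 h1 HP; have [_ Pp _ _ _] := oP; have p1 := Pp 1 ltr01.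
have h2 : 0 < h ^+ 2 by rewrite exprn_gt0.
have [P1|P1] := leP P 1.
  have : P * h ^+ 2 <= 1 by rewrite mulr_ile1 ?(ltW h2) // exprn_ile1 // ltW.
  by move/le_trans; apply; rewrite lerDl invr_ge0 ltW.
have := orlicz_scale oP (ltW P1) P0; rewrite divff ?gt_eqF //; last lra.
rewrite ler_pdivlMr; last lra.
move=> H; have : Psi 1 * P * h ^+ 2 <= 1.
  by rewrite -ler_pdivlMr // div1r (le_trans H).
rewrite -mulrA mulrC -ler_pdivlMr // div1r => /le_trans; apply.
by rewrite lerDr.
Qed.

End OrliczInverse.

(** * Necessity of the condition on [rho] *)

Section Necessity.
Variables (R : realType) (mu : {finite_measure set (R * R)%type -> \bar R}).
Variables (Psi1 Psi2 : R -> R).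
Hypotheses (oP1 : orlicz Psi1) (oP2 : orlicz Psi2).

Lemma mabs_analytic (f : R[i] -> R[i]) : analytic_on_disk f -> mabs f.
Proof. by move=> /analytic_measurable[]. Qed.

Lemma mabs_sub (f g : R[i] -> R[i]) : analytic_on_disk f ->
  measurable_fun disk (fun p => complex.Re (g (toC p))) ->
  measurable_fun disk (fun p => complex.Im (g (toC p))) ->
  mabs (fun z => f z - g z).
Proof.
move=> /analytic_measurable[f1 f2 _] g1 g2; apply: measurable_cabs_comp.
  by under eq_fun do rewrite raddfB /=; exact: measurable_funB.
by under eq_fun do rewrite raddfB /=; exact: measurable_funB.
Qed.

Lemma necessity_core (eps : R) : compact_inclusion mu Psi1 Psi2 -> 0 < eps ->
  exists2 d : R, 0 < d & forall h xi P, 0 < h -> h < d -> circle xi -> 0 <= P ->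
    Psi1 P <= h ^- 2 -> (mu (window xi h) * (Psi2 (P / eps))%:E <= 1)%E.
Proof.
move=> [incl comp] eps0; apply: contrapT => nH.
(* The bound [1 / (n + 3)] sends [h] to 0 and keeps it below [1 / 2], as [kern_window] requires. *)
have ex n : exists u : R * R[i] * R, [/\ 0 < u.1.1, u.1.1 < n.+3%:R^-1, circle u.1.2,
    0 <= u.2 & Psi1 u.2 <= u.1.1 ^- 2] /\
    (1 < mu (window u.1.2 u.1.1) * (Psi2 (u.2 / eps))%:E)%E.
  apply: contrapT => nu; apply: nH; exists n.+3%:R^-1; first by rewrite invr_gt0.
  move=> h xi P h0 hn cxi P0 HP; rewrite leNgt; apply/negP => lt; apply: nu.
  by exists (h, xi, P).
have {}[s Hs] := choice ex.
pose u n z := (((s n).2)%:C)%C * kern (s n).1.2 (s n).1.1 z.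
have h3 n : (s n).1.1 < 3^-1.
  have [[_ + _ _ _] _] := Hs n; move/lt_le_trans; apply.
  by rewrite lef_pV2 ?posrE // ler_nat.
have h12 n : (s n).1.1 < 1 / 2 by have := h3 n; lra.
have h1 n : (s n).1.1 < 1 by have := h3 n; lra.
have uB n : inB Psi1 (u n) /\ normB Psi1 (u n) <= 512.
  by have [[a1 _ a3 a4 a5] _] := Hs n; apply: kern_inB.
have [phi [g [homphi mg1 mg2 Lg lim]]] := comp u 512 (fun n => (uB n).1) (fun n => (uB n).2).
have phige n : (n <= phi n)%N.
  by elim: n => // n IH; apply: leq_ltn_trans IH _; exact: homphi.
(* One third serves for [u (phi n) - g] and two thirds for [g], the factor 2 being the cost of
   Fatou; [6^-1 ^+ 4] is the lower bound of the kernel on the window. *)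
pose eps' := eps * 6^-1 ^+ 4 / 3.
have c6 : 0 < 6^-1 ^+ 4 :> R by rewrite exprn_gt0 // invr_gt0.
have eps'0 : 0 < eps' by rewrite divr_gt0 // mulr_gt0.
have mu_ n : mabs (u n) by have [[au _] _] := uB n; exact: mabs_analytic.
have mg : mabs g := measurable_cabs_comp mg1 mg2.
have mv n : mabs (fun z => u (phi n) z - g z).
  by apply: mabs_sub => //; have [[]] := uB (phi n).
have Lv n : inL mu 1 Psi2 (fun z => u (phi n) z - g z).
  apply: (@inL_add _ mu 1 ler01 Psi2 oP2 (u (phi n)) g) => //.
    by move=> p _; exact: cabsB.
  by apply: incl; have [] := uB (phi n).
have Hmod : (\forall n \near \oo, modular mu 1 Psi2 (fun z => (u (phi n) z - g z)%R) eps' <= 1)%E.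
  move: lim => /cvgr_lt /(_ eps' eps'0); apply: filterS => n.
  exact: (lux_lt ler01 oP2 (mv n) (Lv n)).
have mNg : mabs (fun z => - g z).
  by apply: eq_measurable_fun mg => p _; rewrite cabsN.
(* The norm limit [g] is not known beforehand to vanish almost everywhere. As [u (phi n)] tends to 0
   pointwise, [u (phi n) - g] tends to [- g], whose modular Fatou then controls. *)
have pt (p : R * R) : disk p -> cabs (u (phi n) (toC p) - g (toC p) - - g (toC p)) @[n --> \oo] --> 0.
  move=> Dp; apply/cvgr0Pnorm_le => e e0.
  have D0 : 0 < 1 - cabs (toC p) by rewrite subr_gt0.
  pose K := (1 + (Psi1 1)^-1) / (1 - cabs (toC p)) ^+ 4.
  have K0 : 0 < K.
    have [_ Pp _ _ _] := oP1; rewrite divr_gt0 ?exprn_gt0 // addr_gt0 // invr_gt0; exact: Pp.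
  have eK : 0 < e / K by rewrite divr_gt0.
  near=> n; rewrite opprK subrK ger0_norm ?cabs_ge0 // /u cabsM cabsR.
  have [[a1 a2 a3 a4 a5] _] := Hs (phi n).
  have a2' : (s (phi n)).1.1 < n.+1%:R^-1.
    by apply: lt_le_trans a2 _; rewrite lef_pV2 ?posrE // ler_nat ltnS leqW // leqW.
  set h := (s (phi n)).1.1 in a1 a2 a2' a5 *; set P := (s (phi n)).2 in a4 a5 *.
  have hh1 : h < 1 := h1 _.
  rewrite ger0_norm //.
  have gr := orlicz_growth oP1 a4 a1 (ltW hh1) a5.
  apply: le_trans (ler_wpM2l a4 (kern_point a3 a1 hh1 Dp)) _.
  apply: (@le_trans _ _ (K * h ^+ 2)).
    rewrite expr_div_n /K mulrA [leRHS]mulrAC ler_wpM2r ?invr_ge0 ?exprn_ge0 ?(ltW D0) //.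
    by rewrite (exprD _ 2 2) mulrA ler_wpM2r ?sqr_ge0.
  rewrite mulrC -ler_pdivlMr //.
  apply: (@le_trans _ _ h); first by rewrite expr2 ler_piMl // ltW.
  apply: le_trans (ltW a2') _; rewrite ltW //.
  by near: n; exact: (near_infty_natSinv_lt (PosNum eK)).
have modNg := @modular_fatou _ mu 1 ler01 Psi2 oP2 (fun n z => u (phi n) z - g z) (fun z => - g z)
  eps' mv mNg eps'0 pt Hmod.
have [n Hn] : exists n, (modular mu 1 Psi2 (fun z => (u (phi n) z - g z)%R) eps' <= 1)%E.
  by have [N _ HN] := Hmod; exists N; exact: (HN N (leqnn N)).
have Hu : (modular mu 1 Psi2 (u (phi n)) (eps' + 2 * eps')%R <= 1)%E.
  apply: (@modular_add _ mu 1 ler01 Psi2 oP2 (fun z => u (phi n) z - g z) (fun z => - g z)) => //.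
    by rewrite mulr_gt0.
  move=> p _; rewrite -{1}(subrK (g (toC p)) (u (phi n) (toC p))) cabsN; exact: cabsD.
have [[a1 a2 a3 a4 a5]] := Hs (phi n); apply/negP; rewrite -leNgt.
apply: le_trans Hu; rewrite /modular mul1e muleC.
set W := window _ _.
have mW : measurable W by apply: measurable_window.
have WD : W `<=` disk by move=> p [].
have E3 : eps' + 2 * eps' = eps * 6^-1 ^+ 4 by rewrite /eps'; field.
have e3 : 0 < eps * 6^-1 ^+ 4 by rewrite mulr_gt0.
rewrite E3 -integral_cst //.
have mPu := mabs_Psi oP2 (mu_ (phi n)) e3.
apply: (@le_trans _ _ (\int[mu]_(p in W) (Psi2 (cabs (u (phi n) (toC p)) / (eps * 6^-1 ^+ 4)))%:E)%E).
  apply: ge0_le_integral => //.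
  - by move=> p _; rewrite lee_fin (orlicz_ge0 oP2) // divr_ge0 // ltW.
  - by apply: (measurable_funS (@measurable_disk R) WD); exact: mPu.
  - move=> p Wp; rewrite lee_fin; have [_ _ Pm _ _] := oP2; apply: Pm.
      by rewrite divr_ge0 // ltW.
    rewrite /u cabsM cabsR ger0_norm //.
    have kw := kern_window a3 a1 (h12 _) Wp.
    rewrite ler_pdivlMr // mulrA divfK ?gt_eqF //.
    by rewrite ler_wpM2l.
apply: ge0_subset_integral => //; first exact: measurable_disk.
by move=> p _; rewrite lee_fin (Psi_cabs_ge0 oP2).
Unshelve. all: by end_near. Qed.

Lemma rho_fin h : 0 < h -> h < 1 -> exists2 r : R, 0 <= r & rho mu h = r%:E.
Proof.
move=> h0 h1.
have c1 : circle (1 : R[i]) by exact: cabs1.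
have r0 : (0 <= rho mu h)%E.
  apply: (@le_trans _ _ (mu (window 1 h))); first exact: measure_ge0.
  by apply: ereal_sup_ubound; exists 1.
have rT : (rho mu h <= mu setT)%E.
  apply: ge_ereal_sup => _ [xi cxi <-]; apply: le_measure; rewrite ?inE //.
  exact: measurable_window.
have fT : (mu setT < +oo)%E by rewrite -ge0_fin_numE // fin_num_measure.
exists (fine (rho mu h)); first exact: fine_ge0.
by rewrite fineK // ge0_fin_numE // (le_lt_trans rT).
Qed.

Lemma ereal_cvg0 (f : R -> \bar R) : (forall e : R, 0 < e ->
    exists2 d : R, 0 < d & forall h, 0 < h -> h < d -> (0 <= f h <= e%:E)%E) ->
  f h @[h --> 0^'+] --> 0%E.
Proof.
move=> H; apply/fine_cvgP; split.
  have [d d0 Hd] := H 1 ltr01; near=> h.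
  have /andP[f0 f1] : (0 <= f h <= 1%:E)%E by apply: Hd.
  by rewrite ge0_fin_numE // (le_lt_trans f1) // ltry.
apply/cvgr0Pnorm_le => e e0; have [d d0 Hd] := H e e0; near=> h.
have /andP[f0 f1] : (0 <= f h <= e%:E)%E by apply: Hd.
rewrite /= ger0_norm ?fine_ge0 // -lee_fin fineK // ge0_fin_numE // (le_lt_trans f1) // ltry.
Unshelve. all: by end_near. Qed.

Lemma necessity : compact_inclusion mu Psi1 Psi2 ->
  ((Psi_inv Psi1 (h ^- 2))%:E * (Psi_inv_e Psi2 (rho mu h)^-1)^-1)%E @[h --> 0^'+] --> 0%E.
Proof.
move=> comp; apply: ereal_cvg0 => e e0.
have [d d0 Hd] := necessity_core comp e0.
exists (Num.min d 1); first by rewrite lt_min d0 ltr01.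
move=> h h0; rewrite lt_min => /andP[hd h1].
have [r r0 rE] := rho_fin h0 h1; rewrite rE.
have p1 : 0 < Psi_inv Psi1 (h ^- 2) by apply: Psi_inv_gt0 => //; rewrite invr_gt0 exprn_gt0.
(* If [rho mu h = 0], its inverse is [+oo], so is the value of [Psi_inv_e], and the product is 0. *)
move: r0; rewrite le_eqVlt => /predU1P[r00|r0].
  by rewrite -r00 inve0 /= invey mule0 lexx lee_fin ltW.
rewrite inver gt_eqF //= inver gt_eqF; last by apply: Psi_inv_gt0 => //; rewrite invr_gt0.
have q0 : 0 < Psi_inv Psi2 r^-1 by apply: Psi_inv_gt0 => //; rewrite invr_gt0.
rewrite -EFinM !lee_fin; apply/andP; split; first by rewrite divr_ge0 // ltW.
rewrite ler_pdivrMr //.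
(* For each member [P] of the set that defines [Psi_inv Psi1 (h ^- 2)], the number [P / e] is shown
   to lie in the set that defines [Psi_inv Psi2 r^-1]; no supremum has to be attained. *)
apply: ge_sup.
  by exists 0; split=> //; have [-> _ _ _ _] := oP1; rewrite invr_ge0 sqr_ge0.
move=> P [P0 HP]; rewrite mulrC -ler_pdivrMr //.
apply: Psi_inv_ge => //; first by rewrite divr_ge0 // ltW.
have [Q0|Q0] := leP (Psi2 (P / e)) 0; first by apply: le_trans Q0 _; rewrite invr_ge0 ltW.
rewrite -[leLHS]invrK lef_pV2 ?posrE ?invr_gt0 // -lee_fin -rE.
apply: ge_ereal_sup => _ [xi cxi <-].
have := Hd h xi P h0 hd cxi P0 HP.
have mW : measurable (window xi h) by exact: measurable_window.
have fW : mu (window xi h) \is a fin_num by exact: fin_num_measure.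
rewrite -(fineK fW) -EFinM !lee_fin => H.
by rewrite -[leRHS]div1r ler_pdivlMr.
Unshelve. all: by end_near. Qed.

End Necessity.

(** * The sufficient condition as a bound on window masses *)

Section WindowDomination.
Variables (R : realType) (mu : {finite_measure set (R * R)%type -> \bar R}).
Variables (Psi1 Psi2 : R -> R).
Hypotheses (oP1 : orlicz Psi1) (oP2 : orlicz Psi2).

Lemma Psi_inv0 (Psi : R -> R) : orlicz Psi -> Psi_inv Psi 0 = 0.
Proof.
move=> oP; have [P0 Pp _ _ _] := oP; apply/eqP; rewrite eq_le; apply/andP; split.
  rewrite leNgt; apply/negP => s0.
  have h : 0 < Psi_inv Psi 0 / 2 by rewrite divr_gt0.
  have := Psi_inv_gt oP (ltW h) (_ : _ < Psi_inv Psi 0); rewrite leNgt Pp // => H.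
  by have : false by apply: H; lra.
by apply: Psi_inv_ge => //; rewrite P0.
Qed.

(** For [K2 mu h] positive and finite, where [h ^- 2 = Psi1 s], the limit gives
    [Psi2 (s / delta) <= 1 / (h^2 K2 mu h)]. The condition [T ^+ 2 * Psi1 s < 1] means [T < h], so
    [mu (window xi T) <= T^2 K2 mu h], and [K2 mu h] drops out of the product. The threshold [s0]
    makes [h] small enough for the limit to act. *)
Lemma windows_dominated (delta : R) :
  (((Psi_inv Psi1 (h ^- 2))%:E
      * (Psi_inv_e Psi2 ((h ^+ 2)%:E * K2 mu h)^-1)^-1)%E @[h --> 0^'+] --> 0%E) ->
  0 < delta ->
  exists2 s0 : R, 0 < s0 & forall s T xi, s0 < s -> 0 < T -> T < 1 -> T ^+ 2 * Psi1 s < 1 ->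
    circle xi -> (mu (window xi T) * (Psi2 (s / delta))%:E <= (T ^+ 2 * Psi1 s)%:E)%E.
Proof.
move=> lim d0; have /fine_cvgP[ffin flim] := lim.
have flt := cvgr_lt _ flim delta d0.
have [h0 h00 Hh0] : exists2 h0 : R, 0 < h0 & forall h, 0 < h -> h < h0 ->
   ((Psi_inv Psi1 (h ^- 2))%:E * (Psi_inv_e Psi2 ((h ^+ 2)%:E * K2 mu h)^-1)^-1 < delta%:E)%E.
  have [/= e e0 He] : \forall h \near (0 : R)^'+,
     ((Psi_inv Psi1 (h ^- 2))%:E * (Psi_inv_e Psi2 ((h ^+ 2)%:E * K2 mu h)^-1)^-1 < delta%:E)%E.
    near=> h; rewrite -[ltLHS]fineK; last by near: h; exact: ffin.
    by rewrite lte_fin; near: h; exact: flt.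
  exists e => // h h0 he; apply: He => //=.
  by rewrite sub0r normrN gtr0_norm.
exists (Psi_inv Psi1 (h0 ^- 2)).
  by apply: Psi_inv_gt0 => //; rewrite invr_gt0 exprn_gt0.
move=> s T xi ss0 T0 T1 TP cxi.
have s0 : 0 < s.
  by apply: lt_trans ss0; apply: Psi_inv_gt0 => //; rewrite invr_gt0 exprn_gt0.
have P0 : h0 ^- 2 < Psi1 s.
  by rewrite ltNge; apply/negP => /(Psi_inv_ge oP1 (ltW s0)); rewrite leNgt ss0.
have Ps0 : 0 < Psi1 s by apply: lt_trans P0; rewrite invr_gt0 exprn_gt0.
pose h := (Num.sqrt (Psi1 s))^-1.
have h_gt0 : 0 < h by rewrite invr_gt0 sqrtr_gt0.
have h2 : h ^- 2 = Psi1 s by rewrite /h exprVn invrK sqr_sqrtr // ltW.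
have h2' : h ^+ 2 = (Psi1 s)^-1 by rewrite -h2 invrK.
have hh0 : h < h0.
  rewrite -(@ltr_pXn2r _ 2) ?nnegrE ?ltW // h2' -[ltRHS]invrK ltf_pV2 ?posrE //.
  by rewrite invr_gt0 exprn_gt0.
have Th : T < h.
  by rewrite -(@ltr_pXn2r _ 2) ?nnegrE ?ltW // h2' -[ltRHS]mul1r ltr_pdivlMr.
have := Hh0 h h_gt0 hh0; rewrite h2.
have [rT rT0 rTE] := rho_fin mu T0 T1.
have WT : (mu (window xi T) <= rT%:E)%E by rewrite -rTE; apply: ereal_sup_ubound; exists xi.
have mW : measurable (window xi T) by exact: measurable_window.
have fW : mu (window xi T) \is a fin_num by exact: fin_num_measure.
have T2 : 0 < T ^+ 2 by rewrite exprn_gt0.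
have KT : ((rT / T ^+ 2)%:E <= K2 mu h)%E.
  by apply: ereal_sup_ubound; exists T; [rewrite /= in_itv /= T0|rewrite rTE].
have sinv : s <= Psi_inv Psi1 (Psi1 s) by apply: Psi_inv_ge => //; exact: ltW.
have pinv : 0 < Psi_inv Psi1 (Psi1 s) by exact: lt_le_trans sinv.
have P20 : 0 <= Psi2 (s / delta) by rewrite (orlicz_ge0 oP2) // divr_ge0 // ltW.
move: KT; case: (K2 mu h) => [k| |].
- rewrite lee_fin ler_pdivrMr // => KT.
  have k0 : 0 <= k by rewrite -(pmulr_lge0 _ T2) (le_trans rT0).
  rewrite -EFinM; move: k0; rewrite le_eqVlt => /predU1P[k0|k0] H.
    have W0 : mu (window xi T) = 0%E.
      by apply/eqP; rewrite eq_le measure_ge0 andbT (le_trans WT) // lee_fin (le_trans KT) // -k0 mul0r.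
    by rewrite W0 mul0e lee_fin mulr_ge0 // ltW.
  have hk : 0 < h ^+ 2 * k by rewrite mulr_gt0 // exprn_gt0.
  move: H; rewrite inver gt_eqF //= inver gt_eqF; last by apply: Psi_inv_gt0 => //; rewrite invr_gt0.
  have b0 : 0 < Psi_inv Psi2 (h ^+ 2 * k)^-1 by apply: Psi_inv_gt0 => //; rewrite invr_gt0.
  rewrite -EFinM lte_fin ltr_pdivrMr // => H.
  have {}H : s / delta < Psi_inv Psi2 (h ^+ 2 * k)^-1.
    by rewrite ltr_pdivrMr // mulrC; exact: le_lt_trans H.
  have Q : Psi2 (s / delta) <= (h ^+ 2 * k)^-1.
    by apply: (Psi_inv_gt oP2) H; rewrite divr_ge0 // ltW.
  apply: (@le_trans _ _ ((k * T ^+ 2)%:E * ((h ^+ 2 * k)^-1)%:E)%E).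
    by apply: lee_pmul; rewrite ?lee_fin // (le_trans WT) // lee_fin.
  rewrite -EFinM lee_fin h2' invfM invrK le_eqVlt; apply/orP; left; apply/eqP.
  by field; rewrite gt_eqF.
(* [K2 mu h = +oo] makes [Psi_inv_e] vanish and the product [+oo], against the bound by [delta]. *)
- move=> _; rewrite mulry gtr0_sg ?exprn_gt0 // mul1e invey /= Psi_inv0 // inve0.
  by rewrite mulry gtr0_sg // mul1e.
- by [].
Unshelve. all: by end_near. Qed.

End WindowDomination.

(** * Geometry of squares and windows near the circle *)

Section TailEstimate.
Variables (R : realType) (mu : {finite_measure set (R * R)%type -> \bar R}).
Variables (Psi1 Psi2 : R -> R).
Hypotheses (oP1 : orlicz Psi1) (oP2 : orlicz Psi2).

Definition dist_bd (p : R * R) : R := 1 - cabs (toC p).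

Lemma measurable_dist_bd : measurable_fun setT dist_bd.
Proof. by apply: measurable_funB => //; exact: measurable_cabs. Qed.

Lemma sq_cabs (p q : R * R) t : sq p t q -> cabs (toC q - toC p) ^+ 2 <= 2 * t ^+ 2.
Proof.
move=> [h1 h2]; rewrite sqr_cabs /toC !raddfB /=.
have H (x : R) : `|x| <= t -> x ^+ 2 <= t ^+ 2.
  by move=> xt; rewrite -(real_normK (num_real x)) lerXn2r ?nnegrE // (le_trans _ xt).
by have := H _ h1; have := H _ h2; lra.
Qed.

Lemma sq_dist_bd p q : 0 < dist_bd p -> sq p (dist_bd p / 4) q ->
  [/\ cabs (toC q - toC p) ^+ 2 <= dist_bd p ^+ 2 / 8,
      dist_bd p / 2 <= dist_bd q & dist_bd q <= 3 / 2 * dist_bd p].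
Proof.
move=> t0 /sq_cabs H.
have H2 : cabs (toC q - toC p) ^+ 2 <= dist_bd p ^+ 2 / 8.
  by apply: le_trans H _; rewrite expr_div_n; lra.
have H3 : cabs (toC q - toC p) <= dist_bd p / 2.
  rewrite -(@ler_pXn2r _ 2) ?nnegrE ?cabs_ge0 ?divr_ge0 ?(ltW t0) //.
  apply: le_trans H2 _; rewrite expr_div_n; have := sqr_ge0 (dist_bd p); lra.
split=> //; rewrite /dist_bd in t0 H3 *.
  by have := cabs_trian (toC p) (toC q) 0; rewrite !subr0; lra.
by have := cabs_trian (toC q) (toC p) 0; rewrite !subr0 cabs_sym; lra.
Qed.

(** The window is attached to [q] alone, whereas the square is attached to [p]: this allows [p] to
    vary for fixed [q]. The bound [1 / 8] keeps [T] below 1. *)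
Lemma sq_in_window p q : 0 < dist_bd p -> dist_bd p <= 1 / 8 ->
  sq p (dist_bd p / 4) q ->
  let T := 2 * dist_bd q in let xi := toC q * ((cabs (toC q))^-1%:C)%C in
  [/\ circle xi, 0 < T, T < 1, window xi T p & T <= 3 * dist_bd p].
Proof.
move=> t0 t1 S; have [D1 D2 D3] := sq_dist_bd t0 S => T xi.
set z := toC p in D1 *; set w := toC q in D1 xi *.
have tE : dist_bd p = 1 - cabs z by [].
have uE : dist_bd q = 1 - cabs w by [].
have w0 : 1 / 2 <= cabs w by lra.
have z0 : 1 / 2 <= cabs z by lra.
have wn : 0 < cabs w by lra.
have cxi : circle xi.
  by rewrite /circle /= /xi cabsM cabsR ger0_norm ?invr_ge0 ?cabs_ge0 // mulfV // gt_eqF.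
have T0 : 0 < T by rewrite /T; lra.
have T1 : T < 1 by rewrite /T; lra.
split=> //; last by rewrite /T; lra.
apply/(windowP _ cxi T0 T1); rewrite -/z; split.
- by rewrite /disk /= -/z; lra.
- by rewrite /T; lra.
have pT0 : 0 <= pi * T by rewrite mulr_ge0 ?pi_ge0 // ltW.
have pT2 : pi * T <= 2.
  have p4 : pi <= 4 :> R by have := @pihalf_lt2 R; lra.
  have T2 : T <= 1 / 2 by rewrite /T; lra.
  by apply: le_trans (ler_pM (pi_ge0 R) (ltW T0) p4 T2) _; lra.
have cT := cos_le_quad pT0 pT2.
have p2 := @pi_ge2 R.
have cT' : cos (pi * T) <= 1 - T ^+ 2 / 2.
  apply: le_trans cT _; have : T ^+ 2 * 4 <= (pi * T) ^+ 2.
    have p22 : 4 <= pi ^+ 2 :> R by nra.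
    apply: (@le_trans _ _ (pi ^+ 2 * T ^+ 2)); last by rewrite -exprMn.
    by rewrite [leLHS]mulrC; apply: ler_wpM2r => //; exact: sqr_ge0.
  lra.
have TT : dist_bd p ^+ 2 <= T ^+ 2.
  by rewrite lerXn2r ?nnegrE ?(ltW t0) ?(ltW T0) // /T; lra.
(* Polarization. The angular condition then follows from [cabs (w - z) ^+ 2 <= cabs z * cabs w * T
   ^+ 2], which holds because both moduli are at least [1 / 2] and [T >= dist_bd p]. *)
have E : complex.Re (z * conjc xi) = (cabs z ^+ 2 + cabs w ^+ 2 - cabs (w - z) ^+ 2) / (2 * cabs w).
  have Ew : cabs w != 0 by rewrite gt_eqF.
  rewrite !sqr_cabs /xi; move: (cabs w) Ew => c Ew.
  by case: (z) (w) => [a b] [x y] /=; field.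
rewrite E ler_pdivlMr ?mulr_gt0 //.
have czn : 0 <= cabs z := cabs_ge0 z.
have A : cabs z * cos (pi * T) * (2 * cabs w) <= cabs z * (1 - T ^+ 2 / 2) * (2 * cabs w).
  by rewrite ler_wpM2r ?mulr_ge0 ?(ltW wn) // ler_wpM2l.
apply: le_trans A _.
have B : dist_bd p ^+ 2 / 8 <= cabs z * cabs w * T ^+ 2.
  have : 1 / 4 <= cabs z * cabs w by nra.
  move: (cabs z * cabs w) => k kk; have := sqr_ge0 T; nra.
have := sqr_ge0 (cabs z - cabs w); lra.
Qed.

End TailEstimate.

(** * The double integral over pairs of neighbouring points *)

Section TailTonelli.
Variables (R : realType) (mu : {finite_measure set (R * R)%type -> \bar R}).
Variables (Psi1 Psi2 : R -> R).
Hypotheses (oP1 : orlicz Psi1) (oP2 : orlicz Psi2).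

Lemma measurable_fun_invr d (T : measurableType d) (D : set T) (g : T -> R) :
  measurable D -> measurable_fun D g -> (forall x, D x -> 0 < g x) ->
  measurable_fun D (fun x => (g x)^-1).
Proof.
move=> mD mg g0.
have mi : measurable_fun (`]0, +oo[%classic : set R) (fun x : R => x^-1).
  apply: open_continuous_measurable_fun; first exact: interval_open.
  by move=> x; rewrite inE /= in_itv /= andbT => x0; apply: inv_continuous; rewrite gt_eqF.
have sub : g @` D `<=` (`]0, +oo[%classic : set R).
  by move=> _ [x Dx <-] /=; rewrite in_itv /= andbT g0.
exact: (measurable_comp (measurable_itv _) sub mi mg).
Qed.

Lemma sq_disk (p : R * R) : disk p -> sq p (dist_bd p / 4) `<=` disk.
Proof.
move=> Dp q S; have t0 : 0 < dist_bd p by rewrite subr_gt0.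
have [_ h _] := sq_dist_bd t0 S.
have : 0 < dist_bd q by lra.
by rewrite subr_gt0.
Qed.

Definition whitney : set ((R * R) * (R * R)) :=
  [set z | sq z.1 (dist_bd z.1 / 4) z.2].

Lemma measurable_whitney : measurable whitney.
Proof.
have mt : measurable_fun setT (fun z : (R * R) * (R * R) => dist_bd z.1 / 4).
  by apply: measurable_funM => //; apply: (measurableT_comp (@measurable_dist_bd R)).
have m1 : measurable_fun setT (fun z : (R * R) * (R * R) => dist_bd z.1 / 4 - `|z.2.1 - z.1.1|).
  apply: measurable_funB => //; apply: (measurableT_comp (@normr_measurable R setT)).
  apply: measurable_funB.
    by apply: (measurableT_comp measurable_fst); exact: measurable_snd.
  by apply: (measurableT_comp measurable_fst); exact: measurable_fst.
have m2 : measurable_fun setT (fun z : (R * R) * (R * R) => dist_bd z.1 / 4 - `|z.2.2 - z.1.2|).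
  apply: measurable_funB => //; apply: (measurableT_comp (@normr_measurable R setT)).
  apply: measurable_funB.
    by apply: (measurableT_comp measurable_snd); exact: measurable_snd.
  by apply: (measurableT_comp measurable_snd); exact: measurable_fst.
rewrite (_ : whitney =
  (setT `&` (fun z : (R * R) * (R * R) => dist_bd z.1 / 4 - `|z.2.1 - z.1.1|) @^-1` `[0, +oo[%classic) `&`
  (setT `&` (fun z : (R * R) * (R * R) => dist_bd z.1 / 4 - `|z.2.2 - z.1.2|) @^-1` `[0, +oo[%classic)).
  by apply: measurableI; [apply: m1 => //|apply: m2 => //]; exact: measurable_itv.
apply/seteqP; split=> z.
  by move=> [h1 h2]; split; split=> //=; rewrite in_itv /= andbT subr_ge0.
by move=> [[_ h1] [_ h2]]; move: h1 h2; rewrite /= !in_itv /= !andbT !subr_ge0; split.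
Qed.

(** Dividing the argument by [M] divides [Psi1] by at least [M]. As [pi < 4], the value
    [288 = 72 * 4] exceeds [72 pi], which yields both [36 pi / M < 1], needed to apply [dom], and
    the final bound [36 pi / M <= 1 / 2]. *)
Variables (f : R[i] -> R[i]) (C0 M delta s0 r : R).
Hypotheses (af : analytic_on_disk f) (C00 : 0 < C0) (M288 : 288 <= M).
Hypotheses (d0 : 0 < delta) (s00 : 0 < s0) (r8 : r <= 1 / 8).
Hypothesis fC0 : (modular leb2 pi^-1 Psi1 f C0 <= 1)%E.
Hypothesis dom : forall s T xi, s0 < s -> 0 < T -> T < 1 -> T ^+ 2 * Psi1 s < 1 ->
    circle xi -> (mu (window xi T) * (Psi2 (s / delta))%:E <= (T ^+ 2 * Psi1 s)%:E)%E.

Let s (p : R * R) := cabs (f (toC p)) / (16 * (M * C0)).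
Let G (q : R * R) := Psi1 (cabs (f (toC q)) / C0).

Let M0 : 0 < M. Proof. by apply: lt_le_trans M288; rewrite ltr0n. Qed.
Let s_ge0 p : 0 <= s p.
Proof. by rewrite divr_ge0 ?cabs_ge0 // mulr_ge0 // mulr_ge0 // ltW. Qed.
Let G0 p : 0 <= G p. Proof. by rewrite (orlicz_ge0 oP1) // divr_ge0 ?cabs_ge0 // ltW. Qed.
Let mf : measurable_fun disk (fun p => cabs (f (toC p))).
Proof. exact: mabs_analytic. Qed.
Let ms : measurable_fun disk s.
Proof. exact: measurable_funM. Qed.
Let mG : measurable_fun disk G.
Proof.
apply: measurable_Psi => //; first by move=> x _; rewrite divr_ge0 ?cabs_ge0 // ltW.
  exact: measurable_disk.
exact: measurable_funM.
Qed.

(** The half side is a quarter of the distance to the circle, so the area factor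
    [4 (dist_bd p / 4)^2] is [dist_bd p ^+ 2 / 4]: hence the 4. The scale [M] comes out of [Psi1] by
    convexity. *)
Lemma local_area p : disk p ->
  ((dist_bd p ^+ 2 * Psi1 (s p))%:E <=
   (4 / M)%:E * \int[@plane_measure R]_(q in sq p (dist_bd p / 4)) (G q)%:E)%E.
Proof.
move=> Dp; have t0 : 0 < dist_bd p by rewrite subr_gt0.
have t4 : 0 < dist_bd p / 4 by rewrite divr_gt0.
have H := orlicz_plane oP1 t4 C00 (fun q Sq => af (sq_disk Dp Sq)).
apply: le_trans (lee_wpmul2l _ H); last by rewrite lee_fin divr_ge0 // ltW.
rewrite -EFinM lee_fin.
have sE : s p = cabs (f (toC p)) / (16 * C0) / M by rewrite /s; field; rewrite !gt_eqF.
have := @orlicz_scale _ _ oP1 M (cabs (f (toC p)) / (16 * C0)).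
rewrite -sE => /(_ _ _)/(ler_wpM2l (sqr_ge0 (dist_bd p))) h.
apply: le_trans (h _ _) _; first by have := M288; lra.
  by rewrite divr_ge0 ?cabs_ge0 // mulr_ge0 // ltW.
rewrite le_eqVlt; apply/orP; left; apply/eqP; field; by rewrite gt_eqF.
Qed.

Lemma total_area : (\int[@plane_measure R]_(q in disk) (G q)%:E <= pi%:E)%E.
Proof.
have p0 := pi_gt0 R; move: fC0; rewrite /modular -[leb2]/(@plane_measure R) => H.
have pp : (0 <= (pi : R)%:E)%E by rewrite lee_fin ltW.
have := lee_wpmul2l pp H; rewrite mule1 muleA -EFinM mulfV ?gt_eqF // mul1e.
exact.
Qed.

Lemma pi_lt4 : pi < 4 :> R. Proof. by have := @pihalf_lt2 R; lra. Qed.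

Lemma local_bound p : disk p -> dist_bd p ^+ 2 * Psi1 (s p) <= 4 * pi / M.
Proof.
move=> Dp; rewrite -lee_fin; apply: le_trans (local_area Dp) _.
rewrite [X in (_ <= X%:E)%E]mulrAC [X in (_ <= X)%E]EFinM.
apply: lee_wpmul2l; first by rewrite lee_fin divr_ge0 // ltW.
apply: le_trans _ total_area; apply: ge0_subset_integral => //.
- exact: measurable_sq.
- exact: measurable_disk.
- exact: measurable_funE.
- by move=> q _; rewrite lee_fin.
- exact: sq_disk.
Qed.

(** The condition [s0 < s p] is the range of validity of [dom]; smaller values are left to the small
    mass near the circle. *)
Definition tail_set : set (R * R) := [set p | [/\ disk p, dist_bd p < r & s0 < s p]].

Lemma measurable_tail_set : measurable tail_set.
Proof.
have md := @measurable_disk R.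
rewrite (_ : tail_set = (disk `&` (setT `&` @dist_bd R @^-1` `]-oo, r[%classic)) `&`
   (disk `&` s @^-1` `]s0, +oo[%classic)).
  apply: measurableI; last by apply: ms => //; exact: measurable_itv.
  by apply: measurableI => //; apply: measurable_dist_bd => //; exact: measurable_itv.
apply/seteqP; split=> p.
  by move=> [h1 h2 h3]; rewrite /setI /= !in_itv /= andbT.
by move=> [[h1 [_ h2]] [_ h3]]; move: h2 h3; rewrite /= !in_itv /= ?andbT; split.
Qed.

(** The weight of the double integral: its denominator is what [local_area] recovers from the
    integral in [q], and what [dom] compares with the mass of a window for the integral in [p]. *)
Let a := (fun p => Psi2 (s p / delta) / (dist_bd p ^+ 2 * Psi1 (s p))) \_ tail_set.
Let g := G \_ (@disk R).

Let tail_pos p : tail_set p -> 0 < dist_bd p ^+ 2 * Psi1 (s p).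
Proof.
move=> [Dp _ sp]; have [_ Pp _ _ _] := oP1.
by rewrite mulr_gt0 ?exprn_gt0 ?subr_gt0 //; apply: Pp; exact: lt_trans sp.
Qed.

Let P2_ge0 p : 0 <= Psi2 (s p / delta).
Proof. by rewrite (orlicz_ge0 oP2) // divr_ge0 // ltW. Qed.

Let aE p : tail_set p -> a p = Psi2 (s p / delta) / (dist_bd p ^+ 2 * Psi1 (s p)).
Proof. by move=> Ep; rewrite /a patchE mem_set. Qed.

Let a_out p : ~ tail_set p -> a p = 0.
Proof. by move=> Ep; rewrite /a patchE memNset. Qed.

Let a0 p : 0 <= a p.
Proof.
have [Ep|Ep] := pselect (tail_set p); last by rewrite a_out.
by rewrite aE // divr_ge0 // ltW // tail_pos.
Qed.

Let g0 p : 0 <= g p. Proof. by rewrite /g patchE; case: ifP. Qed.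

Let mP2 : measurable_fun disk (fun p => Psi2 (s p / delta)).
Proof.
apply: measurable_Psi => //; first by move=> x _; rewrite divr_ge0 // ltW.
  exact: measurable_disk.
exact: measurable_funM.
Qed.

Let tail_disk : tail_set `<=` disk. Proof. by move=> p []. Qed.

Let ma : measurable_fun setT a.
Proof.
apply/(@measurable_restrictT _ _ _ _ _ (fun p => Psi2 (s p / delta) / (dist_bd p ^+ 2 * Psi1 (s p))) measurable_tail_set).
have md := @measurable_disk R.
apply: measurable_funM; first by apply: (measurable_funS md tail_disk).
apply: measurable_fun_invr; [exact: measurable_tail_set| |exact: tail_pos].
apply: (measurable_funS md tail_disk); apply: measurable_funM.
  by apply: measurable_funX; apply: measurable_funTS; exact: measurable_dist_bd.
by apply: measurable_Psi.
Qed.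

Let mg : measurable_fun setT g.
Proof. by apply/(@measurable_restrictT _ _ _ _ _ G (@measurable_disk R)). Qed.

Let H := (fun z : (R * R) * (R * R) => (a z.1 * g z.2)%:E) \_ whitney.

Let mH : measurable_fun setT H.
Proof.
apply/(@measurable_restrictT _ _ _ _ _ (fun z : (R * R) * (R * R) => (a z.1 * g z.2)%:E) measurable_whitney).
apply: measurable_funE; apply: measurable_funTS; apply: measurable_funM.
  by apply: (measurableT_comp ma); exact: measurable_fst.
by apply: (measurableT_comp mg); exact: measurable_snd.
Qed.

Let H0 z : (0 <= H z)%E.
Proof. by rewrite /H patchE; case: ifP => // _; rewrite lee_fin mulr_ge0. Qed.

Let lower p : tail_set p ->
  ((M / 4 * Psi2 (s p / delta))%:E <= \int[@plane_measure R]_q H (p, q))%E.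
Proof.
move=> Ep; have [Dp _ _] := Ep.
have -> : (\int[@plane_measure R]_q H (p, q) =
    (a p)%:E * \int[@plane_measure R]_(q in sq p (dist_bd p / 4)) (G q)%:E)%E.
  rewrite -ge0_integralZl_EFin //; first last.
  - apply: measurable_funE; apply: measurable_funS (sq_disk Dp) mG.
    exact: measurable_disk.
  - by move=> q _; rewrite lee_fin.
  - exact: measurable_sq.
  rewrite [RHS]integral_mkcond; apply: eq_integral => q _.
  rewrite /H !patchE; have [Sq|Sq] := pselect (sq p (dist_bd p / 4) q).
    by rewrite !mem_set // /g patchE mem_set //=; exact: sq_disk Sq.
  by rewrite !memNset.
apply: (@le_trans _ _ ((a p)%:E * ((M / 4)%:E * (dist_bd p ^+ 2 * Psi1 (s p))%:E))%E).
  rewrite -!EFinM lee_fin aE // le_eqVlt; apply/orP; left; apply/eqP.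
  have := tail_pos Ep; move: (dist_bd p ^+ 2 * _) => k k0; field; by rewrite gt_eqF.
apply: lee_wpmul2l; first by rewrite lee_fin.
have M4 : (0 <= (M / 4)%:E)%E by rewrite lee_fin divr_ge0 // ltW.
apply: le_trans (lee_wpmul2l M4 (local_area Dp)) _.
rewrite muleA -EFinM (_ : M / 4 * (4 / M) = 1) ?mul1e //.
by field; rewrite gt_eqF.
Qed.

(** Every contributing [p] lies in the window [W] given by [q], and [dom] together with
    [T <= 3 * dist_bd p] bounds [a p] by [9 / mu W] there. Integrating this constant over [W]
    removes the mass of the window. *)
Let upper q : (\int[mu]_p H (p, q) <= (9 * g q)%:E)%E.
Proof.
have [[p0 [Ep0 Sp0]]|nex] := pselect (exists p, tail_set p /\ sq p (dist_bd p / 4) q); last first.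
  rewrite integral0_eq; first by rewrite lee_fin mulr_ge0.
  move=> p _; rewrite /H patchE; case: ifP => // /set_mem Sp.
  by rewrite a_out ?mul0r // => Ep; apply: nex; exists p.
have geo p : tail_set p -> sq p (dist_bd p / 4) q ->
    let T := 2 * dist_bd q in let xi := toC q * ((cabs (toC q))^-1%:C)%C in
    [/\ circle xi, 0 < T, T < 1, window xi T p & T <= 3 * dist_bd p].
  move=> [Dp tr sp]; apply: sq_in_window; first by rewrite subr_gt0.
  by rewrite (le_trans (ltW tr)).
have [cxi T0 T1 _ _] := geo _ Ep0 Sp0.
move: geo cxi T0 T1; set T := 2 * _; set xi := toC q * _ => geo cxi T0 T1.
set W := window xi T.
have mW : measurable W by exact: measurable_window.
have fW : mu W \is a fin_num by exact: fin_num_measure.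
have mHq : measurable_fun setT (fun p => H (p, q)).
  by apply: (measurableT_comp mH); exact: pair2_measurable.
have -> : (\int[mu]_p H (p, q) = \int[mu]_(p in W) H (p, q))%E.
  rewrite [RHS]integral_mkcond; apply: eq_integral => p _.
  rewrite [RHS]patchE; case: ifPn => // /negP pW; rewrite /H patchE; case: ifP => // /set_mem Sp.
  rewrite a_out ?mul0r // => Ep; apply: pW; apply/mem_set.
  by have [] := geo _ Ep Sp.
have mHW : measurable_fun W (fun p => H (p, q)) by exact: measurable_funTS.
have [W0|Wn0] := eqVneq (mu W) 0%E.
  by rewrite null_set_integral // lee_fin mulr_ge0.
have b0 : 0 < fine (mu W).
  by rewrite -lte_fin fineK // lt_neqAle eq_sym Wn0 measure_ge0.
apply: (@le_trans _ _ (\int[mu]_(p in W) (9 * g q / fine (mu W))%:E)%E); last first.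
  rewrite (_ : \int[mu]_(p in W) _ = (9 * g q / fine (mu W))%:E * mu W)%E; last first.
    exact: integral_cst.
  by rewrite -(fineK fW) -EFinM divfK ?gt_eqF.
apply: ge0_le_integral => //.
move=> p Wp; rewrite /H patchE; case: ifP => [/set_mem Sp|_]; last first.
  by rewrite lee_fin divr_ge0 ?mulr_ge0 // ltW.
have [Ep|nEp] := pselect (tail_set p); last first.
  by rewrite a_out // mul0r lee_fin divr_ge0 ?mulr_ge0 // ltW.
rewrite lee_fin [9 * _ / _]mulrAC ler_wpM2r //= aE //.
have k0 := tail_pos Ep; rewrite ler_pdivrMr // [leRHS]mulrAC ler_pdivlMr //.
have [Dp tr sp] := Ep; have [_ _ _ _ T3] := geo _ Ep Sp.
have P1 : 0 <= Psi1 (s p) by rewrite (orlicz_ge0 oP1).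
have T2 : T ^+ 2 * Psi1 (s p) <= 9 * (dist_bd p ^+ 2 * Psi1 (s p)).
  rewrite mulrA ler_wpM2r // (_ : 9 * dist_bd p ^+ 2 = (3 * dist_bd p) ^+ 2); last by ring.
  by rewrite lerXn2r ?nnegrE ?(ltW T0) // (le_trans (ltW T0)).
have lb := local_bound Dp.
have : T ^+ 2 * Psi1 (s p) < 1.
  apply: le_lt_trans T2 _; apply: le_lt_trans (_ : 9 * (4 * pi / M) < 1).
    by rewrite ler_pM2l.
  have p4 := pi_lt4; rewrite mulrA ltr_pdivrMr //; have := M288; lra.
move=> /(dom sp T0 T1)/(_ cxi); rewrite -/W -(fineK fW) -EFinM lee_fin mulrC => /le_trans; apply.
exact: T2.
Qed.

Lemma tail_core : (\int[mu]_(p in tail_set) (Psi2 (s p / delta))%:E <= (1 / 2)%:E)%E.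
Proof.
have mE := measurable_tail_set; have md := @measurable_disk R.
have mPE : measurable_fun tail_set (fun p => (Psi2 (s p / delta))%:E).
  by apply: measurable_funE; apply: (measurable_funS md tail_disk).
have M4 : 0 <= M / 4 by rewrite divr_ge0 // ltW.
have F1 := @fubini_tonelli1 _ _ _ _ R mu (@plane_measure R) H mH H0.
have F2 := @fubini_tonelli2 _ _ _ _ R mu (@plane_measure R) H mH H0.
have mF := @measurable_fun_fubini_tonelli_F _ _ _ _ R (@plane_measure R) H mH H0.
have mG' := @measurable_fun_fubini_tonelli_G _ _ _ _ R mu H mH H0.
have L : ((M / 4)%:E * \int[mu]_(p in tail_set) (Psi2 (s p / delta))%:E <=
   \int[mu]_p \int[@plane_measure R]_q H (p, q))%E.
  rewrite -ge0_integralZl_EFin //; last by move=> p _; rewrite lee_fin.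
  apply: (@le_trans _ _ (\int[mu]_(p in tail_set) \int[@plane_measure R]_q H (p, q))%E).
    apply: ge0_le_integral => //.
    - by move=> p _; rewrite -EFinM lee_fin mulr_ge0.
    - exact: measurable_funeM.
    - exact: measurable_funTS.
  apply: ge0_subset_integral => // p _; exact: integral_ge0.
have U : (\int[@plane_measure R]_q \int[mu]_p H (p, q) <= (9 * pi)%:E)%E.
  apply: (@le_trans _ _ (\int[@plane_measure R]_q (9 * g q)%:E)%E).
    apply: ge0_le_integral => //.
    - by move=> q _; exact: integral_ge0.
    - by apply: measurable_funE; exact: measurable_funM.
  under eq_integral do rewrite EFinM.
  rewrite ge0_integralZl_EFin //; first last.
  - exact: measurable_funE.
  - by move=> q _; rewrite lee_fin.
  rewrite EFinM; apply: lee_wpmul2l => //; apply: le_trans total_area.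
  rewrite [leRHS]integral_mkcond; apply: ge0_le_integral => //.
  - by move=> q _; rewrite lee_fin.
  - exact: measurable_funE.
  - by apply/(@measurable_restrictT _ _ _ _ _ (fun q => (G q)%:E) md); exact: measurable_funE.
  - by move=> q _; rewrite /g !patchE; case: ifP.
have LU := le_trans L (le_trans (_ : _ <= _)%E U).
have {LU} : ((M / 4)%:E * \int[mu]_(p in tail_set) (Psi2 (s p / delta))%:E <= (9 * pi)%:E)%E.
  apply: LU; rewrite /fubini_F /fubini_G in F1 F2.
  by rewrite -F1 F2.
have M40 : 0 < M / 4 by rewrite divr_gt0.
have iM : (0 <= (M / 4)^-1%:E)%E by rewrite lee_fin invr_ge0.
move=> /(lee_wpmul2l iM); rewrite muleA -!EFinM mulVf ?gt_eqF // mul1e => /le_trans; apply.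
rewrite lee_fin ler_pdivrMl //; have := pi_lt4; have := M288; lra.
Qed.

End TailTonelli.

(** * Uniform smallness near the circle and bounds inside the disk *)

Section CollarAndBounds.
Variables (R : realType) (mu : {finite_measure set (R * R)%type -> \bar R}).
Variables (Psi1 Psi2 : R -> R).
Hypotheses (oP1 : orlicz Psi1) (oP2 : orlicz Psi2).

Definition collar (r : R) : set (R * R) := [set p | disk p /\ dist_bd p < r].

Lemma measurable_collar r : measurable (collar r).
Proof.
rewrite (_ : collar r = disk `&` (setT `&` @dist_bd R @^-1` `]-oo, r[%classic)).
  apply: measurableI; first exact: measurable_disk.
  by apply: measurable_dist_bd => //; exact: measurable_itv.
by apply/seteqP; split=> p; rewrite /collar /setI /= in_itv /=; [move=> [? ?]|move=> [? [_ ?]]].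
Qed.

(** Collars of the open disk decrease to the empty set and [mu] is finite. The radii [1 / (n + 8)]
    respect the bound [1 / 8]. *)
Lemma collar_small (e : R) : 0 < e -> exists r, [/\ 0 < r, r <= 1 / 8 & (mu (collar r) <= e%:E)%E].
Proof.
move=> e0; pose F n := collar (n.+4.+4%:R^-1).
have F0 : \bigcap_n F n = set0.
  apply/seteqP; split=> // p Hp; have [Dp _] := Hp 0%N I.
  have t0 : 0 < dist_bd p by rewrite subr_gt0.
  have [n Hn] : exists n, n.+1%:R^-1 < dist_bd p.
    by have [n _ Hn] := near_infty_natSinv_lt (PosNum t0); exists n; apply: (Hn n (leqnn n)).
  have [_ Fn] := Hp n I; have := lt_trans Hn Fn.
  by rewrite ltf_pV2 ?posrE // ltr_nat !ltnS ltnNge !leqW.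
have dF : nonincreasing_seq F.
  move=> n m nm; apply/subsetPset => p [Dp tp]; split=> //; apply: lt_le_trans tp _.
  by rewrite lef_pV2 ?posrE // ler_nat !ltnS.
have mF n : measurable (F n) by exact: measurable_collar.
have fF n : mu (F n) \is a fin_num by exact: fin_num_measure.
have F0fin : (mu (F 0%N) < +oo)%E by rewrite -ge0_fin_numE.
have cv : mu \o F @ \oo --> (0 : R)%:E.
  have -> : (0 : R)%:E = mu (\bigcap_n F n) by rewrite F0 measure0.
  by apply: nonincreasing_cvg_mu => //; rewrite F0.
have /fine_cvgP[_ flim] := cv; have [n _ /(_ n (leqnn n)) Hn] := cvgr_lt _ flim e e0.
exists n.+4.+4%:R^-1; split; first by rewrite invr_gt0.
  by rewrite div1r lef_pV2 ?posrE // ler_nat.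
by rewrite -(fineK (fF n)) lee_fin ltW.
Qed.

(** [r] is chosen before [f]. Values above [s0] cost [1 / 2] by [tail_core]; elsewhere [Psi2] is at
    most [c], and a collar of mass at most [1 / (4 (c + 1))] adds at most [1 / 4]. *)
Lemma tail_collar (delta M : R) :
  (((Psi_inv Psi1 (h ^- 2))%:E
      * (Psi_inv_e Psi2 ((h ^+ 2)%:E * K2 mu h)^-1)^-1)%E @[h --> 0^'+] --> 0%E) ->
  0 < delta -> 288 <= M -> exists r, [/\ 0 < r, r <= 1 / 8 &
   forall f C0, analytic_on_disk f -> 0 < C0 -> (modular leb2 pi^-1 Psi1 f C0 <= 1)%E ->
    (\int[mu]_(p in collar r) (Psi2 (cabs (f (toC p)) / (16 * (M * C0)) / delta))%:E <= (3 / 4)%:E)%E].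
Proof.
move=> lim d0 M288; have [s0 s00 dom] := windows_dominated oP1 oP2 lim d0.
have M0 : 0 < M by apply: lt_le_trans M288; rewrite ltr0n.
pose c := Psi2 (s0 / delta).
have c0 : 0 <= c by rewrite (orlicz_ge0 oP2) // divr_ge0 // ltW.
have e0 : 0 < (4 * (c + 1))^-1 by rewrite invr_gt0; lra.
have [r [r0 r8 mr]] := collar_small e0.
exists r; split=> // f C0 af C00 fC0.
have T := tail_core oP1 oP2 af C00 M288 d0 s00 r8 fC0 dom.
set E := tail_set _ _ _ _ _ in T.
have mE : measurable E by exact: measurable_tail_set.
have mC := measurable_collar r.
have EC : E `<=` collar r by move=> p [].
have K0 : 0 < 16 * (M * C0) by rewrite !mulr_gt0.
have mP : measurable_fun disk (fun p => Psi2 (cabs (f (toC p)) / (16 * (M * C0)) / delta)).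
  apply: measurable_Psi => //.
  - by move=> x _; rewrite !divr_ge0 ?cabs_ge0 // ltW.
  - exact: measurable_disk.
  - by do 2 (apply: measurable_funM => //); exact: mabs_analytic.
have CD : collar r `<=` disk by move=> p [].
have mPC : measurable_fun (collar r) (fun p => (Psi2 (cabs (f (toC p)) / (16 * (M * C0)) / delta))%:E).
  by apply: measurable_funE; apply: measurable_funS CD mP; exact: measurable_disk.
have Pge p : 0 <= Psi2 (cabs (f (toC p)) / (16 * (M * C0)) / delta).
  by rewrite (orlicz_ge0 oP2) // !divr_ge0 ?cabs_ge0 // ltW.
have -> : collar r = E `|` (collar r `\` E) by rewrite setDUK.
rewrite ge0_integral_setU //; first last.
- by apply/disj_setPS => p [h1 [_ h2]].
- by move=> p _; rewrite lee_fin.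
- by rewrite setDUK.
- exact: measurableD.
have mCE : measurable (collar r `\` E) by exact: measurableD.
apply: (@le_trans _ _ ((1 / 2)%:E + c%:E * (4 * (c + 1))^-1%:E)%E).
  apply: leeD; first exact: T.
  apply: (@le_trans _ _ (\int[mu]_(p in collar r `\` E) (cst c%:E p))%E).
    apply: ge0_le_integral => //.
    - by move=> p _; rewrite lee_fin.
    - by apply: measurable_funS mPC => //; exact: subDsetl.
    - move=> p [[Dp tr] nE]; rewrite lee_fin; have [_ _ Pm _ _] := oP2; apply: Pm.
        by rewrite !divr_ge0 ?cabs_ge0 // ltW.
      rewrite ler_wpM2r ?invr_ge0 ?(ltW d0) // leNgt; apply/negP => h; apply: nE; split=> //.
  rewrite integral_cst //; apply: lee_wpmul2l; first by rewrite lee_fin.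
  by apply: le_trans mr; apply: le_measure; rewrite ?inE //; exact: subDsetl.
rewrite -EFinM -EFinD lee_fin.
have : c / (4 * (c + 1)) <= 1 / 4 by rewrite ler_pdivrMr; lra.
lra.
Qed.

(** On the square of half side [rho / 4] the area integral is at most [pi], so
    [Psi1 (cabs f / (16 C0)) <= 4 pi / rho^2]; solving for [cabs f / C0] gives this quantity. *)
Definition growth (rho : R) := 16 * Psi_inv Psi1 (4 * pi / rho ^+ 2).

Lemma growth_ge0 rho : 0 < rho -> 0 <= growth rho.
Proof.
move=> r0; rewrite mulr_ge0 // ltW // Psi_inv_gt0 // divr_gt0 ?mulr_gt0 ?pi_gt0 //.
Qed.

Lemma growth_bound f C0 (p : R * R) rho : analytic_on_disk f -> 0 < C0 ->
  (modular leb2 pi^-1 Psi1 f C0 <= 1)%E -> 0 < rho -> rho <= dist_bd p ->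
  cabs (f (toC p)) <= C0 * growth rho.
Proof.
move=> af C00 fC0 r0 rp; have Dp : disk p by have := lt_le_trans r0 rp; rewrite subr_gt0.
have r4 : 0 < rho / 4 by rewrite divr_gt0.
have sub : sq p (rho / 4) `<=` disk.
  move=> q [h1 h2]; apply: (sq_disk Dp); split; [apply: le_trans h1 _|apply: le_trans h2 _];
  by rewrite ler_wpM2r.
have H := orlicz_plane oP1 r4 C00 (fun q Sq => af _ (sub q Sq)).
have := le_trans H (_ : _ <= pi%:E)%E; rewrite lee_fin => {}H.
have {}H : 4 * (rho / 4) ^+ 2 * Psi1 (cabs (f (toC p)) / (16 * C0)) <= pi.
  apply: H; apply: le_trans (total_area fC0); apply: ge0_subset_integral => //.
  - exact: measurable_sq.
  - exact: measurable_disk.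
  - by apply: (mabs_Psi oP1) => //; exact: mabs_analytic.
  - by move=> q _; rewrite lee_fin (Psi_cabs_ge0 oP1).
rewrite /growth mulrCA mulrA -ler_pdivrMl ?mulr_gt0 // mulrC.
apply: Psi_inv_ge => //; first by rewrite divr_ge0 ?cabs_ge0 // mulr_ge0 // ltW.
rewrite ler_pdivlMr ?exprn_gt0 //; move: H; rewrite expr_div_n; lra.
Qed.

(** The mean value theorem is applied to the real part of [c * f] along the segment, with [c] the
    conjugate of [f w - f z]: its increment is exactly [cabs (f w - f z) ^+ 2]. *)
Lemma cdiff_lipschitz (f : R[i] -> R[i]) z w L : 0 <= L ->
  (forall t : R, 0 <= t <= 1 -> exists l : R[i], cabs l <= L /\
    forall e : R, 0 < e -> exists d : R, 0 < d /\ forall v, cabs (v - (z + (t%:C)%C * (w - z))) < d ->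
      cabs (f v - f (z + (t%:C)%C * (w - z)) - l * (v - (z + (t%:C)%C * (w - z)))) <=
        e * cabs (v - (z + (t%:C)%C * (w - z)))) ->
  cabs (f w - f z) <= L * cabs (w - z).
Proof.
move=> L0 H; have [->|wz] := eqVneq w z; first by rewrite !subrr cabs0 mulr0.
have [E|fwz] := eqVneq (f w - f z) 0; first by rewrite E cabs0 mulr_ge0 ?cabs_ge0.
pose c := conjc (f w - f z).
pose g t := z + (t%:C)%C * (w - z).
have gB s t : g s - g t = ((s - t)%:C)%C * (w - z) by rewrite /g rmorphB /=; ring.
pose phi t := complex.Re (c * f (g t)).
have wz0 : 0 < cabs (w - z) by rewrite cabs_gt0 // subr_eq0.
have c0 : 0 < cabs c by rewrite cabs_conj cabs_gt0.
have gen (c' x y k D : R[i]) (h : R) : complex.Re (c' * x) - complex.Re (c' * y) -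
    h * complex.Re (c' * (k * D)) = complex.Re (c' * (x - y - k * ((h%:C)%C * D))).
  by case: c' x y k D => [c1 c2] [x1 x2] [y1 y2] [k1 k2] [D1 D2] /=; ring.
have /choice[l Hl] : forall t : R, exists l : R[i], 0 <= t <= 1 -> cabs l <= L /\
    forall e : R, 0 < e -> exists d : R, 0 < d /\ forall v, cabs (v - g t) < d ->
      cabs (f v - f (g t) - l * (v - g t)) <= e * cabs (v - g t).
  move=> t; have [t01|nt] := pselect (is_true (0 <= t <= 1)); last by exists 0.
  by have [l Hl] := H t t01; exists l.
have dphi (t : R) : 0 <= t <= 1 -> is_derive t 1 phi (complex.Re (c * (l t * (w - z)))).
  move=> t01; have [_ Hd] := Hl t t01.
  have cv : h^-1 *: (phi (h *: 1 + t) - phi t) @[h --> 0^'] --> complex.Re (c * (l t * (w - z))).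
    apply/cvgrPdist_le => e e0.
    have e1 : 0 < e / (cabs c * cabs (w - z)) by rewrite divr_gt0 // mulr_gt0.
    have [d [d0 {}Hd]] := Hd _ e1.
    have d1 : 0 < d / cabs (w - z) by rewrite divr_gt0.
    near=> h.
    have h0 : h != 0 by near: h; exact: nbhs_dnbhs_neq.
    have hd : `|h| < d / cabs (w - z) by near: h; apply: dnbhs0_lt.
    have gh : g (h *: 1 + t) - g t = (h%:C)%C * (w - z) by rewrite gB /GRing.scale /= mulr1 addrK.
    have := Hd (g (h *: 1 + t)); rewrite gh cabsM cabsR -ltr_pdivlMr // => /(_ hd) K.
    have hh : 0 < `|h| by rewrite normr_gt0.
    rewrite distrC -(ler_pM2l hh) -normrM mulrBr /GRing.scale /= mulVKf //.
    have -> : phi (h * 1 + t) - phi t - h * complex.Re (c * (l t * (w - z))) =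
       complex.Re (c * (f (g (h *: 1 + t)) - f (g t) - l t * ((h%:C)%C * (w - z)))).
      exact: gen.
    apply: le_trans (Re_le_cabs _) _; rewrite cabsM.
    apply: le_trans (ler_wpM2l (ltW c0) K) _.
    rewrite le_eqVlt; apply/orP; left; apply/eqP; field; by rewrite !gt_eqF.
  by apply: DeriveDef; [exact: cvgP cv|exact: cvg_lim cv].
have D1 (t : R) : t \in `]0, 1[ -> is_derive t 1 phi (complex.Re (c * (l t * (w - z)))).
  by rewrite in_itv /= => /andP[t0 t1]; apply: dphi; rewrite !ltW.
have D2 : {within `[0, 1], continuous phi}.
  apply: derivable_within_continuous => t; rewrite in_itv /= => t01.
  by have [] := dphi t t01.
have [t t01 E] := MVT ltr01 D1 D2.
have t01' : 0 <= t <= 1 by move: t01; rewrite in_itv /= => /andP[? ?]; rewrite !ltW.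
have [lL _] := Hl t t01'.
move: E; rewrite subr0 mulr1 /phi -raddfB -mulrBr.
have -> : g 1 = w by rewrite /g rmorph1 mul1r addrC subrK.
have -> : g 0 = z by rewrite /g rmorph0 mul0r addr0.
rewrite /c mulrC mul_conj /= => E.
have cn : 0 < cabs (f w - f z) by rewrite cabs_gt0.
rewrite -(ler_pM2l cn) -expr2 E; apply: le_trans (ler_norm _) _.
apply: le_trans (Re_le_cabs _) _; rewrite !cabsM cabs_conj ler_wpM2l ?cabs_ge0 //.
by rewrite ler_wpM2r ?cabs_ge0.
Unshelve. all: by end_near. Qed.

End CollarAndBounds.

(** * Montel's theorem *)

Section Montel.
Variable R : realType.

(** [G] is a cluster point in a product of compact intervals, given by Tychonoff's theorem. Finitely
    many coordinates at a time are enough once equicontinuity reduces a disk to a finite net. *)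
Lemma prod_cluster_approx (I : eqType) (F : nat -> I -> R) (bd : I -> R) :
  (forall n i, `|F n i| <= bd i) ->
  exists G : I -> R, forall (S : seq I) (e : R) (N : nat), 0 < e ->
    exists2 n, (N <= n)%N & forall i, i \in S -> `|F n i - G i| < e.
Proof.
move=> Fb.
pose T (i : I) : topologicalType := R : topologicalType.
pose A (i : I) : set (T i) := `[- bd i, bd i]%classic.
have cA i : compact (A i) by exact: segment_compact.
have cK := @tychonoff I T A cA.
pose FF : set_system (prod_topology T) := (F : nat -> prod_topology T) @ \oo.
have FP : ProperFilter FF by exact: fmap_proper_filter.
have FK : FF [set f | forall i, A i (f i)].
  by exists 0%N => // n _ i; rewrite /A /= in_itv /= -ler_norml.
have [G [_ clG]] := cK FF FP FK.
exists G => S e N e0.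
have nb : nbhs (G : prod_topology T) [set f : prod_topology T | forall i, i \in S -> `|f i - G i| < e].
  elim: S => [|i S IH]; first by apply: filterE.
  have : nbhs (G : prod_topology T) [set f : prod_topology T | `|f i - G i| < e].
    have pc := @proj_continuous I T i G.
    have nR : nbhs (proj i G : R) [set y : R | `|y - G i| < e].
      have := nbhsx_ballx (G i : R) e e0; rewrite -ball_normE /ball_.
      by apply: filterS => y /=; rewrite distrC.
    exact: (pc _ nR).
  move=> h; apply: filterS2 IH h => f h1 h2 j; rewrite inE => /predU1P[->|] //; exact: h1.
have [|f [[n /= Nn <-] Hn]] := clG [set f | exists2 n, (N <= n)%N & F n = f] _ _ nb.
  by exists N => // n /= Nn; exists n.
by exists n.
Qed.

(** Coordinates are rounded towards 0, so the chosen net point stays in the disk of radius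
    [1 - rho], where the Lipschitz bound holds. *)
Lemma grid_net (rho d : R) : 0 < d -> exists S : seq R[i],
  forall z, cabs z <= 1 - rho -> exists2 s, s \in S & cabs s <= 1 - rho /\ cabs (z - s) <= d.
Proof.
move=> d0; pose k : R := (Num.bound (2 / d)).+1%:R.
have k0 : 0 < k by rewrite ltr0n.
have kd : 2 / k <= d.
  rewrite ler_pdivrMr // mulrC -ler_pdivrMr // ltW //.
  by apply: lt_trans (archi_boundP _) _; rewrite ?divr_ge0 ?(ltW d0) // ltr_nat.
pose N := (Num.truncn ((1 - rho) * k)).+1.
pose X : seq R := [seq i%:R / k | i <- iota 0 N] ++ [seq - (i%:R / k) | i <- iota 0 N].
have tr x : `|x| <= 1 - rho -> exists2 a, a \in X & `|a| <= `|x| /\ `|x - a| <= k^-1.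
  move=> xr; pose i := Num.truncn (`|x| * k).
  have xk : 0 <= `|x| * k by rewrite mulr_ge0 // ltW.
  have /andP[i1 i2] := truncn_itv xk; rewrite -/i in i1 i2.
  have iN : i \in iota 0 N.
    by rewrite mem_iota /= add0n ltnS; apply: le_truncn; rewrite ler_wpM2r // ltW.
  have ik : i%:R / k <= `|x| by rewrite ler_pdivrMr.
  have xi : `|x| - i%:R / k <= k^-1.
    rewrite lerBlDr -[X in X + _]mul1r -mulrDl ler_pdivlMr // ltW //.
    by rewrite addrC -natr1 in i2 *.
  have i0 : 0 <= i%:R / k by rewrite divr_ge0 // ltW.
  have [x0|x0] := leP 0 x.
    exists (i%:R / k); first by rewrite mem_cat (map_f (fun i => i%:R / k) iN).
    rewrite (ger0_norm x0) in ik xi *; rewrite (ger0_norm i0).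
    by rewrite ger0_norm ?subr_ge0.
  exists (- (i%:R / k)); first by rewrite mem_cat (map_f (fun i => - (i%:R / k)) iN) orbT.
  rewrite normrN ger0_norm // opprK; split=> //.
  have -> : x + i%:R / k = - (`|x| - i%:R / k) by rewrite (ltr0_norm x0); ring.
  by rewrite normrN ger0_norm // subr_ge0.
exists [seq (a +i* b)%C | a <- X, b <- X] => z hz.
have [a aX [a1 a2]] := tr _ (le_trans (Re_le_cabs z) hz).
have [b bX [b1 b2]] := tr _ (le_trans (Im_le_cabs z) hz).
exists (a +i* b)%C; first exact: allpairs_f.
split.
  apply: le_trans hz; rewrite ler_wsqrtr //= lerD //.
    by rewrite -(real_normK (num_real a)) -(real_normK (num_real (complex.Re z))) lerXn2r ?nnegrE.
  by rewrite -(real_normK (num_real b)) -(real_normK (num_real (complex.Im z))) lerXn2r ?nnegrE.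
apply: le_trans (cabs_le_sum _) _; rewrite !raddfB /=; apply: le_trans kd.
by rewrite mulrDl mul1r lerD.
Qed.

(** The index [n] measures both the radius and the precision, so that one term per [n], picked
    beyond the previous one, already gives the subsequence. *)
Lemma montel (u : nat -> R[i] -> R[i]) (B L : R -> R) :
  (forall rho, 0 < rho -> 0 <= L rho) ->
  (forall rho n z, 0 < rho -> cabs z <= 1 - rho -> cabs (u n z) <= B rho) ->
  (forall rho n z w, 0 < rho -> cabs z <= 1 - rho -> cabs w <= 1 - rho ->
     cabs (u n z - u n w) <= L rho * cabs (z - w)) ->
  exists (phi : nat -> nat) (g : R[i] -> R[i]),
    {homo phi : m n / (m < n)%N >-> (m < n)%N} /\
    forall n z, cabs z <= 1 - n.+1%:R^-1 -> cabs (u (phi n) z - g z) <= n.+1%:R^-1.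
Proof.
move=> L0 uB uL.
pose F n (i : R[i] * bool) : R :=
  if cabs i.1 < 1 then (if i.2 then complex.Re (u n i.1) else complex.Im (u n i.1)) else 0.
pose bd (i : R[i] * bool) : R := if cabs i.1 < 1 then B (1 - cabs i.1) else 0.
have Fb n i : `|F n i| <= bd i.
  rewrite /F /bd; case: ifP => // i1; last by rewrite normr0.
  have h : cabs (u n i.1) <= B (1 - cabs i.1) by apply: uB; [rewrite subr_gt0|rewrite subKr].
  by case: i.2; apply: le_trans h; [exact: Re_le_cabs|exact: Im_le_cabs].
have [G HG] := prod_cluster_approx Fb.
pose g z : R[i] := (G (z, true) +i* G (z, false))%C.
have approx (S : seq R[i]) e N : 0 < e -> exists2 n, (N <= n)%N &
    forall z, z \in S -> cabs z < 1 -> cabs (u n z - g z) <= e.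
  move=> e0; have e2 : 0 < e / 2 by lra.
  have [n Nn Hn] := HG ([seq (z, true) | z <- S] ++ [seq (z, false) | z <- S]) _ N e2.
  exists n => // z zS z1; apply: le_trans (cabs_le_sum _) _; rewrite !raddfB /=.
  have := Hn (z, true); rewrite mem_cat map_f // /F /= z1 => /(_ isT).
  have := Hn (z, false); rewrite mem_cat (map_f _ zS) orbT /F /= z1 => /(_ isT).
  lra.
have gL rho z w : 0 < rho -> cabs z <= 1 - rho -> cabs w <= 1 - rho ->
    cabs (g z - g w) <= L rho * cabs (z - w).
  move=> r0 hz hw; apply/ler_addgt0Pr => e e0; have e2 : 0 < e / 2 by lra.
  have [n _ Hn] := approx [:: z; w] _ 0%N e2.
  have z1 : cabs z < 1 by lra.
  have w1 : cabs w < 1 by lra.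
  have hz' := Hn z; rewrite !inE eqxx /= in hz'.
  have hw' := Hn w; rewrite !inE eqxx orbT /= in hw'.
  have := uL rho n z w r0 hz hw; have := hz' isT z1; have := hw' isT w1.
  have := cabs_trian (u n z) (g z) (g w); have := cabs_trian (u n w) (u n z) (g w).
  rewrite (cabs_sym (g z) (u n z)); lra.
(* The precision [rho] is split: half on the net, and a quarter each for the variation of [u n] and
   of [g] between a point and its neighbour in the net. *)
have unif j N : exists2 n, (N <= n)%N & forall z, cabs z <= 1 - j.+1%:R^-1 ->
    cabs (u n z - g z) <= j.+1%:R^-1.
  pose rho : R := j.+1%:R^-1; have r0 : 0 < rho by rewrite invr_gt0.
  have l0 := L0 _ r0; pose d := rho / (4 * (L rho + 1)).
  have l1 : 0 < 4 * (L rho + 1) by lra.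
  have d0 : 0 < d by rewrite divr_gt0.
  have Ld : L rho * d <= rho / 4.
    rewrite /d mulrA ler_pdivrMr // -[leRHS]mulrA (_ : 4^-1 * (4 * (L rho + 1)) = L rho + 1).
      by rewrite mulrC ler_wpM2l ?(ltW r0) // lerDl.
    by rewrite mulKf.
  have [S HS] := grid_net rho d0.
  have r2 : 0 < rho / 2 by lra.
  have [n Nn Hn] := approx S _ N r2.
  exists n => // z hz; have [s sS [hs zs]] := HS z hz.
  have s1 : cabs s < 1 by lra.
  have h1 := Hn s sS s1; have h2 := uL rho n z s r0 hz hs; have h3 := gL rho s z r0 hs hz.
  have h4 : L rho * cabs (z - s) <= L rho * d by rewrite ler_wpM2l.
  rewrite (cabs_sym s z) in h3.
  have := cabs_trian (u n s) (u n z) (g z); have := cabs_trian (g s) (u n s) (g z).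
  rewrite -/rho; lra.
have /choice[pick Hpick] : forall jN : nat * nat, exists n, (jN.2 <= n)%N /\
    forall z, cabs z <= 1 - jN.1.+1%:R^-1 -> cabs (u n z - g z) <= jN.1.+1%:R^-1.
  by move=> [j N]; have [n Nn Hn] := unif j N; exists n.
pose phi := fix phi n := if n is m.+1 then pick (m.+1, (phi m).+1) else pick (0%N, 0%N).
exists phi, g; split.
  by apply: homo_ltn; [exact: ltn_trans|move=> n; have [] := Hpick (n.+1, (phi n).+1)].
by move=> [|n] z; [have [_] := Hpick (0%N, 0%N); apply|have [_] := Hpick (n.+1, (phi n).+1); apply].
Qed.

End Montel.

(** * Sufficiency of the condition on [K2] *)

Section Sufficiency.
Variables (R : realType) (mu : {finite_measure set (R * R)%type -> \bar R}).
Variables (Psi1 Psi2 : R -> R).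
Hypotheses (oP1 : orlicz Psi1) (oP2 : orlicz Psi2).

Lemma modular_split (v : R[i] -> R[i]) (C r b : R) : mabs v -> 0 < C -> 0 <= b ->
  (\int[mu]_(p in collar r) (Psi2 (cabs (v (toC p)) / C))%:E <= (3 / 4)%:E)%E ->
  (forall p, disk p -> r <= dist_bd p -> Psi2 (cabs (v (toC p)) / C) <= b) ->
  (modular mu 1 Psi2 v C <= (3 / 4)%:E + b%:E * mu disk)%E.
Proof.
move=> mv C0 b0 Ht Hi; rewrite /modular mul1e.
have md := @measurable_disk R; have mC := measurable_collar (R := R) r.
have mP := mabs_Psi oP2 mv C0.
have CD : collar r `<=` disk by move=> p [].
have mDC : measurable (disk `\` collar r : set (R * R)) by exact: measurableD.
have -> : (\int[mu]_(p in disk) (Psi2 (cabs (v (toC p)) / C))%:E =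
  \int[mu]_(p in collar r) (Psi2 (cabs (v (toC p)) / C))%:E +
  \int[mu]_(p in disk `\` collar r) (Psi2 (cabs (v (toC p)) / C))%:E)%E.
  rewrite -ge0_integral_setU ?setDUK //.
  - by move=> p _; rewrite lee_fin (Psi_cabs_ge0 oP2).
  - by apply/disj_setPS => p [h1 [_ h2]].
apply: leeD => //.
apply: (@le_trans _ _ (\int[mu]_(p in disk `\` collar r) (cst b%:E p))%E).
  apply: ge0_le_integral => //.
  - by move=> p _; rewrite lee_fin (Psi_cabs_ge0 oP2).
  - by apply: measurable_funS mP => //; exact: subDsetl.
  - move=> p [Dp nC]; rewrite lee_fin; apply: Hi => //.
    by rewrite leNgt; apply/negP => h; apply: nC.
rewrite integral_cst //; apply: lee_wpmul2l; first by rewrite lee_fin.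
by apply: le_measure; rewrite ?inE //; exact: subDsetl.
Qed.

Lemma toC_ReIm (z : R[i]) : toC (complex.Re z, complex.Im z) = z.
Proof. by case: z. Qed.

Hypothesis lim : (((Psi_inv Psi1 (h ^- 2))%:E
      * (Psi_inv_e Psi2 ((h ^+ 2)%:E * K2 mu h)^-1)^-1)%E @[h --> 0^'+] --> 0%E).

Lemma inclusion f : inB Psi1 f -> inL mu 1 Psi2 f.
Proof.
move=> [af [C0 [C00 fC0]]].
have [M M288] : exists M : R, 288 <= M by exists 288; exact: lexx.
have M0 : 0 < M by apply: lt_le_trans M288; rewrite ltr0n.
have [r [r0 r8 Ht]] := tail_collar oP1 oP2 lim ltr01 M288.
have K0 : 0 < 16 * (M * C0) by rewrite !mulr_gt0.
pose b := Psi2 (C0 * growth Psi1 r / (16 * (M * C0))).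
have b0 : 0 <= b.
  by rewrite (orlicz_ge0 oP2) // divr_ge0 ?(ltW K0) // mulr_ge0 ?(ltW C00) // growth_ge0.
have mf : mabs f by exact: mabs_analytic.
have fin : mu disk \is a fin_num by apply: fin_num_measure; exact: measurable_disk.
apply: (@inL_bounded _ mu 1 ler01 Psi2 oP2 f (16 * (M * C0)) (3 / 4 + b * fine (mu disk))) => //.
apply: (@le_trans _ _ ((3 / 4)%:E + b%:E * mu disk)%E); last by rewrite -(fineK fin) -EFinM -EFinD.
apply: (modular_split mf K0 b0).
  apply: le_trans (Ht f C0 af C00 fC0); rewrite le_eqVlt; apply/orP; left; apply/eqP.
  by apply: eq_integral => p _; rewrite divr1.
move=> p Dp rp; have [_ _ Pm _ _] := oP2; apply: Pm.
  by rewrite divr_ge0 ?cabs_ge0 // ltW.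
by rewrite ler_wpM2r ?invr_ge0 ?(ltW K0) //; exact: (growth_bound oP1).
Qed.

(** About a point of modulus at most [1 - rho], the square of half side [rho / 4] stays within
    modulus [1 - rho / 2]; [cauchy_deriv] there gives the Lipschitz constant, segments remaining in
    the smaller disk by convexity. *)
Lemma bounded_montel (u : nat -> R[i] -> R[i]) C0 : 0 < C0 ->
  (forall n, analytic_on_disk (u n)) ->
  (forall n, modular leb2 pi^-1 Psi1 (u n) C0 <= 1)%E ->
  exists (phi : nat -> nat) (g : R[i] -> R[i]),
    {homo phi : m n / (m < n)%N >-> (m < n)%N} /\
    forall n z, cabs z <= 1 - n.+1%:R^-1 -> cabs (u (phi n) z - g z) <= n.+1%:R^-1.
Proof.
move=> C00 au uC.
pose B rho := C0 * growth Psi1 rho.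
have uB rho n z : 0 < rho -> cabs z <= 1 - rho -> cabs (u n z) <= B rho.
  move=> r0 hz; rewrite -(toC_ReIm z); apply: (growth_bound oP1) => //.
  by rewrite /dist_bd toC_ReIm; lra.
have B0 rho : 0 < rho -> 0 <= B rho by move=> r0; rewrite mulr_ge0 ?(ltW C00) // growth_ge0.
apply: (@montel _ u B (fun rho => 4 * B (rho / 2) / (rho / 4))) => //.
  move=> rho r0; have r2 : 0 < rho / 2 by lra.
  by apply: divr_ge0; [rewrite mulr_ge0 // B0|lra].
move=> rho n z w r0 hz hw; rewrite (cabs_sym z w) cabs_sym.
have r2 : 0 < rho / 2 by lra.
have r4 : 0 < rho / 4 by lra.
apply: cdiff_lipschitz.
  by apply: divr_ge0; [rewrite mulr_ge0 // B0|exact: ltW].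
move=> t /andP[t0 t1]; set x := z + _.
have hx : cabs x <= 1 - rho.
  have -> : x = ((1 - t)%:C)%C * z + (t%:C)%C * w by rewrite /x rmorphB rmorph1 /=; ring.
  apply: le_trans (cabsD _ _) _; rewrite !cabsM !cabsR (ger0_norm t0) ger0_norm ?subr_ge0 //.
  have := ler_wpM2l t0 hw; have t1' : 0 <= 1 - t by lra.
  have := ler_wpM2l t1' hz; lra.
have near_x v : in_square x (rho / 4) v -> cabs v <= 1 - rho / 2.
  move=> [v1 v2]; have := cabs_trian x v 0; rewrite !subr0.
  have := cabs_le_sum (v - x); rewrite !raddfB /=; lra.
have x1 : diskC x by rewrite /diskC /=; lra.
have [l Hl] := au n x x1; exists l; split; last exact: Hl.
apply: (@cauchy_deriv _ (u n) x (rho / 4) l) => // v /near_x hv; last exact: uB.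
by apply: au; rewrite /diskC /=; lra.
Qed.

Lemma sufficiency : compact_inclusion mu Psi1 Psi2.
Proof.
split; first exact: inclusion.
move=> u M0 uB uM.
have au n : analytic_on_disk (u n) by have [] := uB n.
(* [lux_lt] bounds the modular only at a scale strictly above the norm. *)
pose C0 := Num.max 0 M0 + 1.
have C00 : 0 < C0 by rewrite ltr_wpDl // le_max lexx.
have MC : M0 < C0.
  by apply: (@le_lt_trans _ _ (Num.max 0 M0)); [rewrite le_max lexx orbT|rewrite ltrDl].
have mu_ n : mabs (u n) by exact: mabs_analytic.
have pi0 : 0 <= pi^-1 :> R by rewrite invr_ge0 pi_ge0.
have uC n : (modular leb2 pi^-1 Psi1 (u n) C0 <= 1)%E.
  have [_ Ln] := uB n.
  exact: (@lux_lt _ (@plane_measure R) pi^-1 pi0 Psi1 oP1 (u n) C0 (mu_ n) Ln (le_lt_trans (uM n) MC)).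
have [phi [g [hphi Hg]]] := bounded_montel C00 au uC.
have pt (z : R[i]) : cabs z < 1 -> cabs (u (phi n) z - g z) @[n --> \oo] --> 0.
  move=> z1; have t0 : 0 < 1 - cabs z by rewrite subr_gt0.
  apply/cvgr0Pnorm_le => e e0; near=> n; rewrite ger0_norm ?cabs_ge0 //.
  have h1 : n.+1%:R^-1 < 1 - cabs z by near: n; exact: (near_infty_natSinv_lt (PosNum t0)).
  have h2 : n.+1%:R^-1 < e by near: n; exact: (near_infty_natSinv_lt (PosNum e0)).
  by apply: le_trans (ltW h2); apply: Hg; rewrite lerBrDr -lerBrDl ltW.
have md := @measurable_disk R.
have mgR : measurable_fun disk (fun p => complex.Re (g (toC p))).
  apply: (@measurable_fun_cvg _ _ _ _ (fun n p => complex.Re (u (phi n) (toC p)))) => //.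
    by move=> n; have [] := analytic_measurable (au (phi n)).
  move=> p Dp; apply/cvgrPdist_le => e e0.
  have /cvgr0Pnorm_le /(_ e e0) := pt _ Dp; apply: filterS => n.
  by rewrite ger0_norm ?cabs_ge0 // cabs_sym -raddfB => /(le_trans (Re_le_cabs _)).
have mgI : measurable_fun disk (fun p => complex.Im (g (toC p))).
  apply: (@measurable_fun_cvg _ _ _ _ (fun n p => complex.Im (u (phi n) (toC p)))) => //.
    by move=> n; have [] := analytic_measurable (au (phi n)).
  move=> p Dp; apply/cvgrPdist_le => e e0.
  have /cvgr0Pnorm_le /(_ e e0) := pt _ Dp; apply: filterS => n.
  by rewrite ger0_norm ?cabs_ge0 // cabs_sym -raddfB => /(le_trans (Im_le_cabs _)).
have mg : mabs g by exact: measurable_cabs_comp.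
have mug n : mabs (fun z => u (phi n) z - g z) by exact: mabs_sub.
have adiff n m : analytic_on_disk (fun z => u n z - u m z).
  move=> z z1; have -> : (fun z => u n z - u m z) = (fun z => u n z + (-1) * u m z).
    by apply/funext => w; rewrite mulN1r.
  by apply: cdiffD; [exact: au|apply: cdiffM; [exact: cdiff_cst|exact: au]].
have [M M288] : exists M : R, 288 <= M by exists 288; exact: lexx.
have Mp : 0 < M by apply: lt_le_trans M288; rewrite ltr0n.
(* [g] is only a pointwise limit, so the tail bound, which concerns analytic functions, is applied
   to [u (phi n) - u (phi m)]; letting [m] tend to infinity by Fatou costs a factor 2, hence
   [e' = e / 2]. *)
have key (e : R) : 0 < e -> \forall n \near \oo,
    (modular mu 1 Psi2 (fun z => (u (phi n) z - g z)%R) e <= 1)%E.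
  move=> e0; pose e' := e / 2; have e'0 : 0 < e' by rewrite divr_gt0.
  have K0 : 0 < 16 * (M * (C0 + C0)) by rewrite !mulr_gt0 // addr_gt0.
  (* Differences have modular at most 1 at the scale [C0 + C0]; this [delta] turns the scale of the
     tail bound into [e']. *)
  pose delta := e' / (16 * (M * (C0 + C0))); have d0 : 0 < delta by rewrite divr_gt0.
  have [r [r0 r8 Ht]] := tail_collar oP1 oP2 lim d0 M288.
  pose c := Psi2 (2 / e').
  have c0 : 0 <= c by rewrite (orlicz_ge0 oP2) // divr_ge0 // ltW.
  have fin : mu disk \is a fin_num by exact: fin_num_measure.
  pose b := fine (mu disk); have b0 : 0 <= b by exact: fine_ge0.
  have cb0 : 0 < (4 * (c * b + 1))^-1 by rewrite invr_gt0 mulr_gt0 // ltr_wpDl // mulr_ge0.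
  (* [N1] puts the complement of the collar in the region of uniform control from [N] on. [N2] makes
     its contribution at most [1 / 4], since convexity gives
     [Psi2 (2 / ((N + 1) e')) <= c / (N + 1)]. *)
  have [N [N1 N2]] : exists N, N.+1%:R^-1 < r /\ N.+1%:R^-1 < (4 * (c * b + 1))^-1.
    have h1 := near_infty_natSinv_lt (PosNum r0).
    have h2 := near_infty_natSinv_lt (PosNum cb0).
    have [N _ HN] := filterI h1 h2; exists N; exact: HN (leqnn N).
  have cauchy n m : (N <= n)%N -> (N <= m)%N ->
      (modular mu 1 Psi2 (fun z => (u (phi n) z - u (phi m) z)%R) e' <= 1)%E.
    move=> Nn Nm; set v := fun z => _.
    have av : analytic_on_disk v by exact: adiff.
    have mv : mabs v by exact: mabs_analytic.
    have vC : (modular leb2 pi^-1 Psi1 v (C0 + C0)%R <= 1)%E.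
      apply: (@modular_add _ (@plane_measure R) pi^-1 pi0 Psi1 oP1 (u (phi n)) (u (phi m)) v) => //.
      by move=> p _; exact: cabsB.
    have N0 : 0 < N.+1%:R :> R by rewrite ltr0n.
    have cN0 : 0 <= c / N.+1%:R by rewrite divr_ge0.
    apply: (@le_trans _ _ ((3 / 4)%:E + (c / N.+1%:R)%:E * mu disk)%E).
      apply: (@modular_split v e' r) => //.
        apply: le_trans (Ht v _ av (addr_gt0 C00 C00) vC).
        rewrite le_eqVlt; apply/orP; left; apply/eqP.
        apply: eq_integral => p _; congr (Psi2 _)%:E; rewrite /delta.
        move: K0 e'0; move: (16 * _) (e') => K k K0 k0; field.
        by rewrite !gt_eqF.
      move=> p Dp rp.
      have inv k : (N <= k)%N -> k.+1%:R^-1 <= N.+1%:R^-1 :> R.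
        by move=> Nk; rewrite lef_pV2 ?posrE // ler_nat ltnS.
      have hk k : (N <= k)%N -> cabs (u (phi k) (toC p) - g (toC p)) <= N.+1%:R^-1.
        move=> Nk; have ik := inv k Nk; apply: le_trans (ik); apply: Hg.
        move: ik N1 rp; rewrite /dist_bd; move: (k.+1%:R^-1) (N.+1%:R^-1) => x y; lra.
      have N1' : 1 <= N.+1%:R :> R by rewrite ler1n.
      apply: le_trans (orlicz_scale oP2 N1' (_ : 0 <= 2 / e')); last by rewrite divr_ge0 // ltW.
      have [_ _ Pm _ _] := oP2; apply: Pm; first by rewrite divr_ge0 ?cabs_ge0 // ltW.
      rewrite mulrAC ler_wpM2r ?invr_ge0 ?(ltW e'0) // /v.
      apply: le_trans (cabs_trian (g (toC p)) _ _) _.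
      rewrite (cabs_sym (g _) (u (phi m) _)); have := hk n Nn; have := hk m Nm.
      by move: (N.+1%:R^-1) => x; lra.
    rewrite -(fineK fin) -EFinM -EFinD lee_fin -/b.
    have : c / N.+1%:R * b <= 1 / 4.
      rewrite mulrAC; apply: le_trans (ler_wpM2l (mulr_ge0 c0 b0) (ltW N2)) _.
      have cb : 0 <= c * b by rewrite mulr_ge0.
      by rewrite ler_pdivrMr; lra.
    by move: (c / _ * b) => x; lra.
  exists N => // n /= Nn.
  have -> : e = 2 * e' by rewrite /e'; field.
  apply: (@modular_fatou _ mu 1 ler01 Psi2 oP2 (fun m z => u (phi n) z - u (phi m) z)) => //.
  - by move=> m; apply: mabs_analytic.
  - move=> p Dp; have := pt _ Dp; apply: cvg_trans; apply: near_eq_cvg; near=> m.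
    by rewrite cabs_sym; congr cabs; ring.
  - by exists N => // m /= Nm; exact: cauchy.
exists phi, g; split=> //.
  have [N _ /(_ N (leqnn N)) HN] := key 1 ltr01.
  apply: (@inL_add _ mu 1 ler01 Psi2 oP2 (u (phi N)) (fun z => u (phi N) z - g z)) => //.
  - by move=> p _; rewrite -{1}(subKr (u (phi N) (toC p)) (g (toC p))); exact: cabsB.
  - by apply: inclusion; exact: uB.
  - by exists 1; split.
apply/cvgr0Pnorm_le => e e0; have := key e e0; apply: filterS => n Hn.
by rewrite ger0_norm ?lux_ge0 //; exact: lux_le.
Unshelve. all: by end_near. Qed.

End Sufficiency.

Unset Implicit Arguments.
Set Strict Implicit.
Set Printing Implicit Defensive.

Theorem theorem2p5 (R : realType)
  (mu : {finite_measure set (R * R)%type -> \bar R})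
  (Psi1 Psi2 : R -> R) :
  orlicz Psi1 -> orlicz Psi2 -> mu (~` disk) = 0%E ->
  (compact_inclusion mu Psi1 Psi2 ->
     ((Psi_inv Psi1 (h ^- 2))%:E * (Psi_inv_e Psi2 (rho mu h)^-1)^-1)%E
       @[h --> 0^'+] --> 0%E)
  /\
  (((Psi_inv Psi1 (h ^- 2))%:E
      * (Psi_inv_e Psi2 ((h ^+ 2)%:E * K2 mu h)^-1)^-1)%E
       @[h --> 0^'+] --> 0%E ->
   compact_inclusion mu Psi1 Psi2).
Proof.
move=> oP1 oP2 _; split; first exact: necessity.
exact: sufficiency.
Qed.
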